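(* Let $\mathcal H$ be a separable complex Hilbert space and $\mathbf H$ a self-adjoint operator on $\mathcal H$ with $\sigma(\mathbf H)=\sigma_{ac}(\mathbf H)=\operatorname{ess\,supp}\sigma_{ac}(\mathbf H)=\mathbb R^+$, of multiplicity one, and let $\mathbf U(t)=e^{-i\mathbf H t}$, $t\in\mathbb R$. Let $\Omega_f:\mathcal H\to\mathscr H^+(\mathbb R)$ be a map such that (i) $\Omega_f$ is a contractive quasi-affine map of $\mathcal H$ into $\mathscr H^+(\mathbb R)$, and (ii) $\Omega_f\mathbf U(t)g=T_u^+(t)\Omega_f g$ for all $t\ge 0$ and $g\in\mathcal H$, and let $\Omega_b:\mathcal H\to\mathscr H^-(\mathbb R)$ be a map such that (i') $\Omega_b$ is a contractive quasi-affine map of $\mathcal H$ into $\mathscr H^-(\mathbb R)$, and (ii') $\Omega_b\mathbf U(t)g=T_u^-(t)\Omega_b g$ for all $t\le 0$ and $g\in\mathcal H$. Let $\mathbf T_F=(\Omega_f^*\Omega_f)^{-1}=\Omega_f^{-1}(\Omega_f^* )^{-1}$ with domain $\operatorname{Ran}\Omega_f^*\Omega_f$ and $\mathbf T_B=(\Omega_b^*\Omega_b)^{-1}=\Omega_b^{-1}(\Omega_b^* )^{-1}$ with domain $\operatorname{Ran}\Omega_b^*\Omega_b$ (positive self-adjoint operators in $\mathcal H$). Then: (1) $\inf\sigma(\mathbf T_F)=\inf\sigma(\mathbf T_B)=1$. (2) Let $\xi_{\mathcal H}$ be the spectral (projection valued) measure of $\mathbf T_F$ and let $a>1$. Then for any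 nonzero $g\in\mathcal H$ satisfying $\xi_{\mathcal H}([1,a))g=g$ there exists a time $\tau>0$ such that $\xi_{\mathcal H}([a,\infty))\mathbf U(t)g\neq 0$ for all $t>\tau$ and, moreover, $\lim_{t\to\infty}\Vert\xi_{\mathcal H}([1,a))\mathbf U(t)g\Vert=0$. (3) Let $\zeta_{\mathcal H}$ be the spectral measure of $\mathbf T_B$ and let $a>1$. Then for any nonzero $g\in\mathcal H$ satisfying $\zeta_{\mathcal H}([1,a))g=g$ there exists a time $\tau'<0$ such that $\zeta_{\mathcal H}([a,\infty))\mathbf U(t)g\neq 0$ for all $t<\tau'$ and, moreover, $\lim_{t\to-\infty}\Vert\zeta_{\mathcal H}([1,a))\mathbf U(t)g\Vert=0$.
   Context: $\mathbb R^+=[0,\infty)$. $\mathscr H^{+}(\mathbb R)$ (resp. $\mathscr H^-(\mathbb R)$) is the closed subspace of $L^2(\mathbb R)$ consisting of the boundary values on $\mathbb R$ of functions in the scalar Hardy space $\mathscr H^2(\mathbb C^+)$ of the upper half-plane (resp. $\mathscr H^2(\mathbb C^-)$ of the lower half-plane); $P_\pm$ is the orthogonal projection of $L^2(\mathbb R)$ onto $\mathscr H^\pm(\mathbb R)$. For $t\in\mathbb R$, $u(t)$ is the multiplication operator $[u(t)f](\sigma)=e^{-i\sigma t}f(\sigma)$ on $L^2(\mathbb R)$, and $T_u^\pm(t)f=P_\pm u(t)f$ for $f\in\mathscr H^\pm(\mathbb R)$. A quasi-affine map from a Hilbert space $\mathcal H_1$ into a Hilbert space $\mathcal H_0$ is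 a linear, injective, continuous map of $\mathcal H_1$ onto a dense linear manifold in $\mathcal H_0$. $\sigma(\cdot)$ denotes the spectrum and $\sigma_{ac}(\cdot)$ the absolutely continuous spectrum.
   Formalization: Part (1) is proved under the added assumption that Ω_f (resp. Ω_b) has operator norm exactly 1; without it (1) is false, since replacing Ω_f by Ω_f/2 keeps (i),(ii) but multiplies T_F by 4. Parts (2) and (3) are unchanged. *)

(* Defs.v *)
From HB Require Import structures.
From mathcomp Require Import all_boot all_order all_algebra.
From mathcomp Require Import all_classical all_reals all_analysis.
From mathcomp Require Import complex.

Set Implicit Arguments.
Unset Strict Implicit.
Unset Printing Implicit Defensive.

Import Order.TTheory GRing.Theory Num.Theory.
Import numFieldNormedType.Exports.

Local Open Scope classical_set_scope.
Local Open Scope ring_scope.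
Local Open Scope complex_scope.

(* [Re] alone would be the norm-field projection, valued in R[i]. *)
Local Notation Re := complex.Re.
Local Notation Im := complex.Im.

Section ComplexIntegral.
Context {R : realType}.

Definition expi (theta : R) : R[i] := cos theta +i* sin theta.

Definition cintegral d (T : measurableType d) (mu : {measure set T -> \bar R})
    (f : T -> R[i]) : R[i] :=
  (\int[mu]_s Re (f s)) +i* (\int[mu]_s Im (f s)).

Definition cmeasurable (f : R -> R[i]) : Prop :=
  measurable_fun setT (fun s => Re (f s)) /\
  measurable_fun setT (fun s => Im (f s)).

Definition sqnorm (z : R[i]) : R := Re z ^+ 2 + Im z ^+ 2.

End ComplexIntegral.

(* Elements of $L^2(\mathbb R)$ are represented by functions; equality in
   $L^2(\mathbb R)$ is Lebesgue-almost-everywhere equality [aeq]. *)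
Section L2.
Context {R : realType}.
Local Notation C := (R[i]).
Local Notation leb := (@lebesgue_measure R).

Definition aeq (f g : R -> C) : Prop := {ae leb, forall s, f s = g s}.

Definition L2 : set (R -> C) :=
  [set f | cmeasurable f /\ (\int[leb]_s (sqnorm (f s))%:E < +oo)%E].

Definition L2dot (f g : R -> C) : C := cintegral leb (fun s => f s * conjc (g s)).

Definition L2norm (f : R -> C) : R := Num.sqrt (Re (L2dot f f)).

(* [L2proj M f p]: p is (a representative of) the orthogonal projection of f
   onto the subspace M. *)
Definition L2proj (M : set (R -> C)) (f p : R -> C) : Prop :=
  M p /\ forall h, M h -> L2dot (f - p) h = 0.

(* The half-plane $\mathbb C^+$ is [halfplane 1], $\mathbb C^-$ is
   [halfplane (-1)]; likewise for the Hardy spaces below. *)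
Definition halfplane (s : R) : set C := [set z | 0 < s * Im z].

Definition hardy2 (s : R) : set (C -> C) :=
  [set F | (forall z, halfplane s z -> derivable (F : C^o -> C^o) z 1) /\
    exists M : R, forall y, 0 < y ->
      (\int[leb]_x (sqnorm (F (x +i* (s * y))))%:E <= M%:E)%E].

Definition cone (s x kappa : R) : set C :=
  halfplane s `&` [set z | `|Re z - x| < kappa * (s * Im z)].

Definition nontangential_limit (s : R) (F : C -> C) (x : R) (l : C) : Prop :=
  forall kappa : R, 0 < kappa ->
    F z @[z --> within (cone s x kappa) (nbhs (x%:C : C^o))] --> (l : C^o).

Definition hardy_boundary (s : R) : set (R -> C) :=
  [set f | L2 f /\ exists F, hardy2 s F /\
     {ae leb, forall x, nontangential_limit s F x (f x)}].

Definition Hplus : set (R -> C) := hardy_boundary 1.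
Definition Hminus : set (R -> C) := hardy_boundary (-1).

Definition umul (t : R) (f : R -> C) : R -> C :=
  fun s => expi (- (s * t)) * f s.

(* $p = T_u^\pm(t)f = P_\pm u(t)f$, with [M] standing for
   $\mathscr H^\pm(\mathbb R)$. *)
Definition toeplitz (M : set (R -> C)) (t : R) (f p : R -> C) : Prop :=
  L2proj M (umul t f) p.

End L2.

Section Hilbert.
Context {R : realType} (V : completeNormedModType R[i]).
Local Notation C := (R[i]).
Local Notation leb := (@lebesgue_measure R).

Definition separable : Prop := exists2 S : set V, countable S & dense S.

Variable dot : {dot V for @conjc R}.

(* [V] with [dot] is a Hilbert space when its (complete) norm comes from
   [dot]; as in the library, [dot] is linear in its first argument. *)
Definition hilbert_norm : Prop := forall x : V, `|x| ^+ 2 = dot x x.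

(* Unbounded operators are given by their graphs. *)
Definition graph_dom (G : set (V * V)) : set V := [set x | exists y, G (x, y)].

Definition is_operator (G : set (V * V)) : Prop :=
  [/\ G 0,
      forall (a : C) p q, G p -> G q -> G (a *: p + q) &
      forall x y y', G (x, y) -> G (x, y') -> y = y'].

Definition graph_adjoint (G : set (V * V)) : set (V * V) :=
  [set p | forall q, G q -> dot q.2 p.1 = dot q.1 p.2].

Definition graph_inverse (G : set (V * V)) : set (V * V) :=
  [set p | G (p.2, p.1)].

Definition self_adjoint (G : set (V * V)) : Prop :=
  [/\ is_operator G, dense (graph_dom G) & graph_adjoint G = G].

(* Resolvent set of the part of G in the subspace M, i.e. of G `&` (M `*` M):
   $G-\lambda$ is onto M and injective with bounded inverse. *)
Definition resolvent_on (M : set V) (G : set (V * V)) : set C :=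
  [set l | (forall y, M y -> exists2 x, M x & G (x, y + l *: x)) /\
     exists c : R, forall x y, M x -> M y -> G (x, y + l *: x) ->
       `|x| <= c%:C * `|y|].

Definition spectrum (G : set (V * V)) : set C := ~` resolvent_on setT G.

(* Each [E B] is an orthogonal projection (linear, symmetric, idempotent), and
   $\langle E(B)x,x\rangle=\langle E(B)x,E(B)x\rangle$ is a measure in [B]. *)
Record pvm := Pvm {
  pvm_proj :> set R -> V -> V ;
  pvm_linear : forall B, measurable B -> linear (pvm_proj B) ;
  pvm_sym : forall B, measurable B ->
    forall x y, dot (pvm_proj B x) y = dot x (pvm_proj B y) ;
  pvmI : forall A B, measurable A -> measurable B ->
    forall x, pvm_proj (A `&` B) x = pvm_proj A (pvm_proj B x) ;
  pvm0 : forall x, pvm_proj set0 x = 0 ;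
  pvmT : forall x, pvm_proj setT x = x ;
  pvm_sigma_additive : forall x, semi_sigma_additive
    (fun B => (Re (dot (pvm_proj B x) (pvm_proj B x)))%:E)
}.

Definition pvm_measure (E : pvm) (x : V) (B : set R) : \bar R :=
  (Re (dot (E B x) (E B x)))%:E.

Section pvm_measure_instance.
Variables (E : pvm) (x : V).

Let pvm_measure0 : pvm_measure E x set0 = 0%E.
Proof. by rewrite /pvm_measure pvm0 linear0. Qed.

Let pvm_measure_ge0 B : (0 <= pvm_measure E x B)%E.
Proof.
rewrite /pvm_measure lee_fin; have [->|xN0] := eqVneq (E B x) 0.
  by rewrite linear0.
by move/ltW: (neq0_dnorm_gt0 (s := dot) _ xN0); rewrite lecE => /andP[].
Qed.

HB.instance Definition _ := isMeasure.Build _ _ R (pvm_measure E x)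
  pvm_measure0 pvm_measure_ge0 (@pvm_sigma_additive E x).

End pvm_measure_instance.

Definition in_pvm_dom (E : pvm) (f : R -> C) (x : V) : Prop :=
  (\int[pvm_measure E x]_l (sqnorm (f l))%:E < +oo)%E.

(* $\int f\,d\langle E(\cdot)x,z\rangle$, by polarization. *)
Definition pvm_cintegral (E : pvm) (f : R -> C) (x z : V) : C :=
  4^-1 * (\sum_(k < 4) 'i%C ^+ k *
            cintegral (pvm_measure E (x + 'i%C ^+ k *: z)) f).

(* Graph of $\int f\,dE$, for a measurable $f:\mathbb R\to\mathbb C$. *)
Definition spectral_integral (E : pvm) (f : R -> C) : set (V * V) :=
  [set p | in_pvm_dom E f p.1 /\
     forall z, in_pvm_dom E f z -> dot p.2 z = pvm_cintegral E f p.1 z].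

Definition spectral_measure_of (E : pvm) (G : set (V * V)) : Prop :=
  G = spectral_integral E (fun l => l%:C).

(* $U(t)=e^{-iHt}$, where [E] is the spectral measure of $H$. *)
Definition unitary_group_of (E : pvm) (U : R -> V -> V) : Prop :=
  forall t x, spectral_integral E (fun l => expi (- (l * t))) (x, U t x).

Definition ac_subspace (E : pvm) : set V :=
  [set x | pvm_measure E x `<< leb].

Definition ac_spectrum (E : pvm) (G : set (V * V)) : set C :=
  ~` resolvent_on (ac_subspace E) G.

(* [S] supports the absolutely continuous part of [E] and is minimal, up to
   Lebesgue null sets, with this property. *)
Definition ac_ess_support (E : pvm) (S : set R) : Prop :=
  measurable S /\ forall B, measurable B ->
    ((forall x, ac_subspace E x -> E B x = 0) <-> leb (B `&` S) = 0%E).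

(* Existence of a cyclic vector. *)
Definition multiplicity_one (E : pvm) : Prop :=
  exists x : V, dense [set y | exists (n : nat) (c : 'I_n -> C)
    (B : 'I_n -> set R), (forall i, measurable (B i)) /\
      y = \sum_(i < n) c i *: E (B i) x].

(* Maps from V into a subspace M of $L^2(\mathbb R)$. *)
Section MapsToL2.
Variables (M : set (R -> C)) (Om : V -> R -> C).

Definition quasi_affine : Prop :=
  [/\ forall x, M (Om x),
      forall (a : C) x y, aeq (Om (a *: x + y)) (a *: Om x + Om y),
      forall x y, aeq (Om x) (Om y) -> x = y,
      forall x, L2norm (Om y - Om x) @[y --> x] --> (0 : R) &
      forall h, M h -> forall e : R, 0 < e -> exists x, L2norm (Om x - h) < e].

Definition contractive : Prop := forall x, (L2norm (Om x))%:C <= `|x|.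

Definition op_norm : R := sup [set L2norm (Om x) | x in [set x | `|x| <= 1]].

Definition map_adjoint (h : R -> C) (y : V) : Prop :=
  M h /\ forall x, dot x y = L2dot (Om x) h.

(* Graph of $\Omega^*\Omega$: the pairs $(x,\Omega^*\Omega x)$. *)
Definition gram_graph : set (V * V) := [set p | map_adjoint (Om p.1) p.2].

(* $(\Omega^*\Omega)^{-1}$, with domain $\operatorname{Ran}\Omega^*\Omega$. *)
Definition inverse_gram : set (V * V) := graph_inverse gram_graph.

End MapsToL2.

End Hilbert.

(* Main.v *)
(** Riesz' theorem gives [A = Om^* Om], with [0 <= A <= 1], and the operator of
    the theorem is [A^{-1}].  Vectors nearly attaining the norm of [Om] are
    approximate eigenvectors of [A] for the value 1, and [1 - l A] is coercive
    when [Re l < 1]; this locates the bottom of the spectrum.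

    If [E] is the spectral measure of [A^{-1}], then
    [|E([1, a)) x|^2 <= a <A x, x> = a |Om x|^2], so everything reduces to the
    strong convergence to 0 of [P_+ u(t)] on the Hardy space (the lower half-plane
    being handled by a sign [s = -1]).  For [f] in that space, with
    [p = P_+ u(t) f] and [q = e^{i t .} p], one has [|p|^2 = <f, q>]; moving [f]
    to the line [Im z = e] moves [q] there too, and costs a factor [e^{- t e}].

    No Poisson kernel is needed: by Cauchy's theorem on a strip the product
    [<F_a, K_b>] of two Hardy functions restricted to horizontal lines depends
    only on [a + b].  Hence [|F_y|^2] is midpoint convex and bounded, so it is
    nonincreasing, and
    [|F_a - F_b|^2 = |F_a|^2 + |F_b|^2 - 2 |F_{(a+b)/2}|^2] makes [F_y] Cauchy as
    [y -> 0]; by Fatou's lemma its limit is the boundary function. *)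

(* A spectral integral is given only weakly, by polarisation. Facts about it are therefore obtained
   from identities between the finite measures [B -> |E(B) v|^2] of several vectors [v]: the
   parallelogram law, scaling, commutation with a projection. In this way [A^{-1} >= 1] is turned
   into the statement that the spectral measure lives on [[1, oo)].

   Decay of the window [[1, a)] alone does not make the part of [U(t) g] in [[a, oo)] nonzero; a
   lower bound on [|U(t) g|] is needed too. A crude one suffices, [|g|^2 <= 16 |U(t) g|^2], read off
   the weak form of the exponential. Once the window part is below [|g|^2 / 16], the remainder
   cannot vanish.

   For Hardy functions only integrals over horizontal lines are bounded, with no pointwise decay at
   infinity. This shapes the form of Cauchy's theorem used here: the vertical sides of the
   rectangles are chosen by averaging, at abscissae where the integral across the strip happens to
   be small. *)
Require Import Defs.
From HB Require Import structures.
From mathcomp Require Import all_boot all_order all_algebra.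
From mathcomp Require Import all_classical all_reals all_analysis.
From mathcomp Require Import measurable_realfun complex ring lra.

Import Order.TTheory GRing.Theory Num.Theory.
Import numFieldNormedType.Exports.

Local Open Scope classical_set_scope.
Local Open Scope ring_scope.
Local Open Scope complex_scope.

Local Notation Re := complex.Re.
Local Notation Im := complex.Im.

(** * Hilbert space geometry *)

Section RealFacts.
Context {R : realType}.

Lemma discriminant (A B C : R) : 0 <= C ->
  (forall t : R, 0 <= A + 2 * t * B + t ^+ 2 * C) -> B ^+ 2 <= A * C.
Proof.
rewrite le_eqVlt => /orP[/eqP <-|C0] h.
  have [->|B0] := eqVneq B 0; first by rewrite expr0n mulr0.
  (* With [C = 0] the expression is affine in [t], and this [t] gives it the value -1. *)
  have := h (- (A + 1) / (2 * B)).
  rewrite (_ : A + _ + _ = -1); last by field.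
  by rewrite oppr_ge0 ler10.
have := h (- B / C).
rewrite (_ : A + _ + _ = (A * C - B ^+ 2) / C); last by field; rewrite gt_eqF.
by rewrite pmulr_lge0 ?invr_gt0// subr_ge0.
Qed.

(** Turns a Cauchy-Schwarz bound into one that is linear in [K] and [n], with a free weight [t]; the
    later estimates can then be closed by linear arithmetic. *)
Lemma sqr_le_amgm (L K n t : R) : 0 < t -> 0 <= K -> 0 <= n -> L ^+ 2 <= K * n ->
  2 * L <= t * K + n / t.
Proof.
move=> t0 K0 n0 h; apply: (le_trans (ler_norm _)).
rewrite -(ler_pXn2r (n := 2)) ?nnegrE ?addr_ge0 ?mulr_ge0 ?invr_ge0 ?(ltW t0) //.
rewrite real_normK ?num_real//.
apply: (@le_trans _ _ (4 * (K * n))).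
  by rewrite exprMn (_ : 2 ^+ 2 = 4) ?ler_pM2l //; ring.
rewrite -subr_ge0 (_ : _ - _ = (t * K - n / t) ^+ 2) ?sqr_ge0//.
by field; rewrite gt_eqF.
Qed.

Lemma sqnorm_ge0 (z : R[i]) : 0 <= sqnorm z.
Proof. by rewrite addr_ge0 ?sqr_ge0. Qed.

Lemma normcsq (z : R[i]) : `|z| = (Num.sqrt (sqnorm z))%:C.
Proof. by rewrite normc_def. Qed.

Lemma ReD (x y : R[i]) : Re (x + y) = Re x + Re y. Proof. by case: x; case: y. Qed.
Lemma ImD (x y : R[i]) : Im (x + y) = Im x + Im y. Proof. by case: x; case: y. Qed.
Lemma ReN (x : R[i]) : Re (- x) = - Re x. Proof. by case: x. Qed.
Lemma ImN (x : R[i]) : Im (- x) = - Im x. Proof. by case: x. Qed.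
Lemma ReM (x y : R[i]) : Re (x * y) = Re x * Re y - Im x * Im y.
Proof. by case: x; case: y. Qed.
Lemma ImM (x y : R[i]) : Im (x * y) = Re x * Im y + Im x * Re y.
Proof. by case: x; case: y. Qed.
Lemma ReJ (x : R[i]) : Re (conjc x) = Re x. Proof. by case: x. Qed.
Lemma ImJ (x : R[i]) : Im (conjc x) = - Im x. Proof. by case: x. Qed.
Lemma complex_ext (x y : R[i]) : Re x = Re y -> Im x = Im y -> x = y.
Proof. by case: x => a b; case: y => c d /= -> ->. Qed.

Lemma sqnormM (x y : R[i]) : sqnorm (x * y) = sqnorm x * sqnorm y.
Proof. by rewrite /sqnorm ReM ImM; ring. Qed.

Lemma sqnorm_eq0 (z : R[i]) : sqnorm z = 0 -> z = 0.
Proof.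
move/eqP; rewrite paddr_eq0 ?sqr_ge0// !sqrf_eq0 => /andP[/eqP a /eqP b].
exact: complex_ext.
Qed.

End RealFacts.

Definition ReImE := (@ReD, @ImD, @ReN, @ImN, @ReM, @ImM, @ReJ, @ImJ).

Section Hilbert.
Context {R : realType} {V : completeNormedModType R[i]}.
Variable dot : {dot V for @conjc R}.
Hypothesis hn : hilbert_norm dot.
Local Notation C := (R[i]).

Lemma dotDl x y z : dot (x + y) z = dot x z + dot y z.
Proof. exact: linearDl. Qed.
Lemma dotDr x y z : dot x (y + z) = dot x y + dot x z.
Proof. exact: linearDr. Qed.
Lemma dotZl a x z : dot (a *: x) z = a * dot x z.
Proof. exact: linearZl_LR. Qed.
Lemma dotZr a x z : dot x (a *: z) = conjc a * dot x z.
Proof. exact: linearZr_LR. Qed.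
Lemma dotNl x z : dot (- x) z = - dot x z. Proof. exact: linearNl. Qed.
Lemma dotNr x z : dot x (- z) = - dot x z. Proof. exact: linearNr. Qed.
Lemma dot0l z : dot 0 z = 0. Proof. exact: linear0l. Qed.
Lemma dotJ x y : dot y x = conjc (dot x y).
Proof. by rewrite (hermC dot) expr0 mul1r. Qed.

(** The norm of [V] takes values in [R[i]]; its square, taken as a real number, keeps the estimates
    in an ordered field. *)
Definition sqnrm (x : V) : R := Re (dot x x).

Lemma ReJdot x y : Re (dot y x) = Re (dot x y).
Proof. by rewrite dotJ ReJ. Qed.

Lemma Im_dotxx x : Im (dot x x) = 0.
Proof.
have := congr1 (@complex.Im R) (dotJ x x); rewrite ImJ => h; lra.
Qed.

Lemma dotxx x : dot x x = (sqnrm x)%:C.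
Proof. by apply: complex_ext => //=; rewrite Im_dotxx. Qed.

Lemma nrm2_ge0 x : 0 <= sqnrm x.
Proof.
rewrite /sqnrm; have [->|x0] := eqVneq x 0; first by rewrite dot0l.
by move/ltW: (neq0_dnorm_gt0 (s := dot) _ x0); rewrite lecE => /andP[].
Qed.

Lemma nrm2_eq0 x : sqnrm x = 0 -> x = 0.
Proof.
move=> h; apply: contrapT => /eqP x0.
move: (neq0_dnorm_gt0 (s := dot) _ x0).
by rewrite dotxx h ltxx.
Qed.

Lemma nrm2_0 : sqnrm 0 = 0. Proof. by rewrite /sqnrm dot0l. Qed.

Lemma normE x : `|x| = (Num.sqrt (sqnrm x))%:C.
Proof.
have h : `|x| ^+ 2 = ((Num.sqrt (sqnrm x))%:C) ^+ 2.
  by rewrite hn dotxx -[RHS]rmorphXn /= sqr_sqrtr// nrm2_ge0.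
apply/eqP; rewrite -(eqrXn2 (n := 2)) //; first by apply/eqP.
by rewrite lecR sqrtr_ge0.
Qed.

Lemma nrm2D x y : sqnrm (x + y) = sqnrm x + sqnrm y + 2 * Re (dot x y).
Proof. by rewrite /sqnrm !(dotDl, dotDr, ReImE) (ReJdot x y); ring. Qed.

Lemma nrm2N x : sqnrm (- x) = sqnrm x.
Proof. by rewrite /sqnrm dotNl dotNr opprK. Qed.

Lemma nrm2B x y : sqnrm (x - y) = sqnrm x + sqnrm y - 2 * Re (dot x y).
Proof. by rewrite nrm2D nrm2N dotNr ReN; ring. Qed.

Lemma nrm2Z a x : sqnrm (a *: x) = sqnorm a * sqnrm x.
Proof.
by rewrite /sqnrm dotZl dotZr dotxx /sqnorm !ReImE /=; ring.
Qed.

Lemma parallelogram x y : sqnrm (x + y) + sqnrm (x - y) = 2 * sqnrm x + 2 * sqnrm y.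
Proof. by rewrite nrm2D nrm2B; ring. Qed.

Lemma dot_CS x y : Re (dot x y) ^+ 2 <= sqnrm x * sqnrm y.
Proof.
apply: discriminant => [|t]; first exact: nrm2_ge0.
have := nrm2_ge0 (x + t%:C *: y).
by rewrite nrm2D nrm2Z dotZr /sqnorm !ReImE /=; congr (_ <= _); ring.
Qed.

Lemma nrm2_complete (u : nat -> V) :
  (forall e : R, 0 < e -> exists N, forall n m, (N <= n)%N -> (N <= m)%N ->
     sqnrm (u n - u m) < e) ->
  exists l, forall e : R, 0 < e -> exists N, forall n, (N <= n)%N ->
     sqnrm (u n - l) < e.
Proof.
move=> h.
have sqrtP x (e : R) : 0 < e -> (`|x : V| < e%:C) = (sqnrm x < e ^+ 2).
  move=> e0; rewrite normE ltcR -[in RHS](sqr_sqrtr (nrm2_ge0 x)).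
  by rewrite ltr_pXn2r// nnegrE ?sqrtr_ge0 ?ltW.
have epsE (e : C) : 0 < e -> e = (Re e)%:C /\ 0 < Re e.
  rewrite ltcE => /andP[/eqP i r]; split=> //.
  by apply: complex_ext => //=; rewrite i.
have cu : cvgn u.
  apply: cauchy_cvg; apply: cauchy_exP => e /epsE[-> e0].
  have [N hN] := h (Re e ^+ 2) (exprn_gt0 2 e0).
  exists (u N); exists N => // n /= Nn.
  by rewrite /= -ball_normE /= sqrtP// hN.
exists (limn u) => e e0.
have s0 : 0 < Num.sqrt e by rewrite sqrtr_gt0.
move/cvgrPdist_lt : (cu) => /(_ (Num.sqrt e)%:C).
rewrite ltcR => /(_ s0) [N _ hN].
exists N => n Nn; have := hN n Nn.
by rewrite sqrtP// sqr_sqrtr ?ltW// -nrm2N opprB.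
Qed.

(** Strong midpoint convexity makes a minimising sequence Cauchy, because [Q] at a midpoint is at
    least the infimum. The last hypothesis is a quantitative lower semicontinuity at [x]: [t] is
    chosen first to make [t * K] small, then [y] close to [x]. *)
Lemma quadratic_min (Q : V -> R) (c m0 : R) : 0 < c -> (forall x, m0 <= Q x) ->
  (forall x y, c * sqnrm (x - y) <= Q x + Q y - 2 * Q (2^-1 *: (x + y))) ->
  (forall x, exists K : R, forall y t, 0 < t ->
     Q x <= Q y + t * K + sqnrm (y - x) / t) ->
  exists x, forall y, Q x <= Q y.
Proof.
move=> c0 lb mid usc.
set S := range Q; set m := inf S.
have infS : has_inf S.
  by split; [exists (Q 0); exists 0 | exists m0 => _ [x _ <-]; exact: lb].
have mQ x : m <= Q x by apply: ge_inf; [case: infS | exists x].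
have apx n : exists x, Q x < m + n.+1%:R^-1.
  have [|_ [x _ <-] hx] := inf_adherent (eps := n.+1%:R^-1) _ infS.
    by rewrite invr_gt0.
  by exists x.
have [u hu] := choice apx.
have smalln (e : R) : 0 < e -> exists N, forall n, (N <= n)%N -> n.+1%:R^-1 < e.
  move=> e0; have [N _ hN] := near_infty_natSinv_lt (PosNum e0).
  by exists N => n /hN.
have [l hl] : exists l, forall e : R, 0 < e -> exists N, forall n, (N <= n)%N ->
     sqnrm (u n - l) < e.
  apply: nrm2_complete => e e0.
  have [N hN] := smalln (c * e / 2) (divr_gt0 (mulr_gt0 c0 e0) (ltr0n _ 2)).
  exists N => n p Nn Np.
  rewrite -(ltr_pM2l c0); apply: (le_lt_trans (mid _ _)).
  have := hN _ Nn; have := hN _ Np.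
  have := hu n; have := hu p; have := mQ (2^-1 *: (u n + u p)).
  move: (p.+1%:R^-1) (n.+1%:R^-1) => a b; lra.
exists l => y; apply: (le_trans _ (mQ y)); apply/ler_addgt0Pr => e e0.
have [K hK] := usc l.
(* The error [e] is shared in three: [t * K], the distance term divided by [t], and the gap between
   [Q (u n)] and the infimum. *)
pose t := e / (3 * (`|K| + 1)).
have K1 : 0 < `|K| + 1 by rewrite ltr_wpDl.
have t0 : 0 < t by rewrite divr_gt0// mulr_gt0.
have tK : t * K <= e / 3.
  apply: (@le_trans _ _ (t * (`|K| + 1))).
    by rewrite ler_pM2l// (le_trans (ler_norm K))// lerDl.
  by rewrite /t le_eqVlt; apply/orP; left; apply/eqP; field; rewrite gt_eqF.
have e3 : 0 < e / 3 by rewrite divr_gt0.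
have [N1 hN1] := hl (t * (e / 3)) (mulr_gt0 t0 e3).
have [N2 hN2] := smalln (e / 3) e3.
pose n := maxn N1 N2.
have a1 := hN1 n (leq_maxl _ _); have a2 := hN2 n (leq_maxr _ _).
have a3 : sqnrm (u n - l) / t <= e / 3.
  by rewrite ler_pdivrMr// mulrC ltW.
move: (hK (u n) t t0) (hu n) a2; move: (n.+1%:R^-1) => b; lra.
Qed.

Lemma re_dot_eq0 (r : V) : (forall h, Re (dot h r) = 0) -> r = 0.
Proof. by move=> h; apply: nrm2_eq0; exact: h. Qed.

Lemma variation0 (a b : R) : (forall t : R, 0 <= 2 * t * a + t ^+ 2 * b) -> a = 0.
Proof.
move=> h; have b0 : 0 <= b.
  have := h 1; have := h (-1); rewrite sqrrN expr1n; lra.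
have := @discriminant R 0 a b b0.
rewrite mul0r => H; apply/eqP; rewrite -sqrf_eq0; apply/eqP/le_anti.
by rewrite sqr_ge0 andbT; apply: H => t; rewrite add0r.
Qed.

(** The representing vector minimises [|x|^2 - 2 Re (phi x)]: the first variation there gives the
    real parts, and replacing [x] by [i x] gives the imaginary parts. *)
Lemma riesz (phi : V -> C) (K : R) : linear_for *%R phi -> 0 <= K ->
  (forall x, Re (phi x) ^+ 2 <= K * sqnrm x) ->
  exists y, forall x, dot x y = phi x.
Proof.
move=> lin K0 bnd.
have phiD x y : phi (x + y) = phi x + phi y.
  by have := lin 1 x y; rewrite scale1r mul1r.
have phi0 : phi 0 = 0.
  by have := phiD 0 0; rewrite addr0 => /eqP; rewrite -subr_eq subrr => /eqP <-.
have phiZ a x : phi (a *: x) = a * phi x.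
  by have := lin a x 0; rewrite addr0 phi0 addr0.
have phiN x : phi (- x) = - phi x by rewrite -scaleN1r phiZ mulN1r.
pose Q x := sqnrm x - 2 * Re (phi x).
have half : sqnorm (2^-1 : C) = 4^-1.
  rewrite (_ : 2^-1 = (2^-1 : R)%:C); last by rewrite fmorphV rmorph_nat.
  by rewrite /sqnorm /= expr0n addr0; field.
have hRe (z : C) : Re (2^-1 * z) = 2^-1 * Re z.
  rewrite (_ : 2^-1 = (2^-1 : R)%:C); last by rewrite fmorphV rmorph_nat.
  by rewrite ReM /= mul0r subr0.
have [y hy] : exists y, forall x, Q y <= Q x.
  apply: (@quadratic_min Q (2^-1) (- K)).
  - by rewrite invr_gt0.
  - move=> x; have := @sqr_le_amgm R (Re (phi x)) K (sqnrm x) 1 ltr01 K0 (nrm2_ge0 x) (bnd x).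
    rewrite mul1r divr1 /Q; lra.
  - move=> x y; rewrite /Q nrm2Z half phiZ hRe phiD ReD.
    have := parallelogram x y; lra.
  (* The two first-order terms, in [dot x h] and in [phi h], are each split with weight [2 t]; this
     produces the factor 2 and, in total, one [|h|^2 / t]. *)
  - move=> x; exists (2 * (sqnrm x + K)) => z t t0.
    pose h := z - x.
    have zE : z = x + h by rewrite /h addrC subrK.
    have h1 := @dot_CS (- x) h; rewrite nrm2N dotNl ReN in h1.
    have h2 := bnd h.
    have n0 := nrm2_ge0 h.
    have g1 := @sqr_le_amgm R _ _ _ (2 * t) (mulr_gt0 (ltr0n _ 2) t0) (nrm2_ge0 x) n0 h1.
    have g2 := @sqr_le_amgm R _ _ _ (2 * t) (mulr_gt0 (ltr0n _ 2) t0) K0 n0 h2.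
    have e : sqnrm h / (2 * t) = sqnrm h / t / 2 by field; rewrite gt_eqF.
    rewrite e in g1 g2.
    rewrite /Q [in leRHS]zE phiD ReD nrm2D.
    have -> : x + h - x = h by rewrite addrAC subrr add0r.
    lra.
exists y.
have E h : Re (dot h y) = Re (phi h).
  apply/eqP; rewrite -subr_eq0; apply/eqP.
  apply: (@variation0 _ (sqnrm h)) => t.
  have := hy (y + t%:C *: h); rewrite /Q nrm2D nrm2Z phiD phiZ dotZr.
  rewrite !ReImE /= /sqnorm /= (ReJdot h y) -subr_ge0.
  by congr (_ <= _); ring.
move=> x; apply: complex_ext; first exact: E.
have := E ('i%C *: x); rewrite dotZl phiZ !ReM /=; lra.
Qed.

(** Minimise [|B x - y|^2]. The residual [r] at the minimum is orthogonal to the range of [B], in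
    particular to [B r], so coercivity at [r] forces [r = 0]. *)
Lemma coercive_surj (B : V -> V) (c K : R) : linear B -> 0 < c -> 0 <= K ->
  (forall x, c * sqnrm x <= Re (dot (B x) x)) ->
  (forall x, sqnrm (B x) <= K * sqnrm x) ->
  forall y, exists x, B x = y.
Proof.
move=> lin c0 K0 coer bnd y.
have BD u v : B (u + v) = B u + B v.
  by have := lin 1 u v; rewrite !scale1r.
have B0 : B 0 = 0.
  by have := BD 0 0; rewrite addr0 => /eqP; rewrite -subr_eq subrr => /eqP <-.
have BZ a u : B (a *: u) = a *: B u.
  by have := lin a u 0; rewrite addr0 B0 addr0.
have BN u : B (- u) = - B u by rewrite -scaleN1r BZ scaleN1r.
have lower u : c ^+ 2 * sqnrm u <= sqnrm (B u).
  have h1 := dot_CS (B u) u; have h2 := coer u; have n0 := nrm2_ge0 u.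
  have cn : 0 <= c * sqnrm u by rewrite mulr_ge0// ltW.
  move: n0; rewrite le_eqVlt => /orP[/eqP <-|n0]; first by rewrite mulr0 nrm2_ge0.
  rewrite -(ler_pM2r n0); apply: le_trans h1.
  rewrite -mulrA -expr2 -exprMn.
  by rewrite ler_pXn2r ?nnegrE// (le_trans cn).
pose Q x := sqnrm (B x - y).
have half2 : (2^-1 : C) = (2^-1 : R)%:C by rewrite fmorphV rmorph_nat.
have half : sqnorm (2^-1 : C) = 4^-1.
  by rewrite half2 /sqnorm /= expr0n addr0; field.
have [x hx] : exists x, forall z, Q x <= Q z.
  (* By the parallelogram law the convexity defect of [Q] is [|B (x - z)|^2 / 2], and [lower] bounds
     it below. *)
  apply: (@quadratic_min Q (c ^+ 2 / 2) 0).
  - by rewrite divr_gt0 ?exprn_gt0.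
  - by move=> x; exact: nrm2_ge0.
  - move=> x z.
    have -> : Q (2^-1 *: (x + z)) = 4^-1 * sqnrm ((B x - y) + (B z - y)).
      rewrite /Q -half -nrm2Z BZ BD; congr sqnrm.
      rewrite addrACA -opprD scalerBr; congr (_ - _).
      by rewrite -mulr2n -[y *+ 2]scaler_nat scalerA mulVf ?scale1r// pnatr_eq0.
    have := parallelogram (B x - y) (B z - y).
    have -> : B x - y - (B z - y) = B (x - z).
      by rewrite BD BN opprB addrA subrK.
    have := lower (x - z); rewrite /Q; lra.
  - move=> x; exists (sqnrm (B x - y) * K) => z t t0.
    pose h := z - x.
    have zE : z = x + h by rewrite /h addrC subrK.
    have h1 := dot_CS (- (B x - y)) (B h).
    rewrite nrm2N in h1.
    have h2 : Re (dot (- (B x - y)) (B h)) ^+ 2 <= (sqnrm (B x - y) * K) * sqnrm h.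
      by apply: (le_trans h1); rewrite -mulrA ler_wpM2l ?nrm2_ge0.
    have n0 := nrm2_ge0 h.
    have g1 := @sqr_le_amgm R _ _ _ t t0 (mulr_ge0 (nrm2_ge0 _) K0) n0 h2.
    have b0 := nrm2_ge0 (B h).
    rewrite /Q [in leRHS]zE BD (addrAC (B x) (B h)) (nrm2D (B x - y)).
    have -> : x + h - x = h by rewrite addrAC subrr add0r.
    rewrite dotNl ReN in g1; lra.
exists x; apply/eqP; rewrite -subr_eq0; apply/eqP.
set r := B x - y.
have E h : Re (dot (B h) r) = 0.
  apply: (@variation0 _ (sqnrm (B h))) => t.
  have := hx (x + t%:C *: h); rewrite /Q BD BZ (addrAC (B x)) -/r (nrm2D r) nrm2Z dotZr.
  rewrite !ReImE /= /sqnorm /= (ReJdot (B h) r) -subr_ge0.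
  by congr (_ <= _); ring.
apply: nrm2_eq0; apply/le_anti; rewrite nrm2_ge0 andbT.
by rewrite -(ler_pM2l c0) mulr0 (le_trans (coer r))// E.
Qed.

End Hilbert.

(** * Integration against a spectral measure *)

Section MeasureCombination.
Context d (T : measurableType d) (R : realType).
Variables (m1 m2 n1 n2 : {measure set T -> \bar R}) (k1 k2 : {nonneg R}).
Hypothesis mn : forall S, measurable S ->
  (m1 S + m2 S = k1%:num%:E * n1 S + k2%:num%:E * n2 S)%E.

Lemma ge0_integral_combination (f : T -> \bar R) : (forall x, 0 <= f x)%E ->
  measurable_fun setT f ->
  (\int[m1]_x f x + \int[m2]_x f x =
   k1%:num%:E * \int[n1]_x f x + k2%:num%:E * \int[n2]_x f x)%E.
Proof.
move=> f0 mf; rewrite -ge0_integral_measure_add// -!ge0_integral_mscale//.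
rewrite -ge0_integral_measure_add//.
apply: eq_measure_integral => S mS _.
by rewrite /measure_add/= /msum/= !big_ord_recl/= !big_ord0 /= !adde0 mn.
Qed.

(** Identities between differences of spectral measures are put in this shape, negative terms being
    moved to the other side, so that no signed measure occurs. *)
Lemma Rintegral_combination (f : T -> R) :
  m1.-integrable setT (EFin \o f) -> m2.-integrable setT (EFin \o f) ->
  n1.-integrable setT (EFin \o f) -> n2.-integrable setT (EFin \o f) ->
  \int[m1]_x f x + \int[m2]_x f x =
  k1%:num * \int[n1]_x f x + k2%:num * \int[n2]_x f x.
Proof.
move=> i1 i2 j1 j2; have mf := measurable_int _ i1.
pose F : T -> \bar R := EFin \o f.
have hp : (\int[m1]_x F^\+ x + \int[m2]_x F^\+ x =
    k1%:num%:E * \int[n1]_x F^\+ x + k2%:num%:E * \int[n2]_x F^\+ x)%E.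
  by apply: ge0_integral_combination => //; exact: measurable_funepos.
have hm : (\int[m1]_x F^\- x + \int[m2]_x F^\- x =
    k1%:num%:E * \int[n1]_x F^\- x + k2%:num%:E * \int[n2]_x F^\- x)%E.
  by apply: ge0_integral_combination => //; exact: measurable_funeneg.
have fin (m : {measure set T -> \bar R}) (i : m.-integrable setT (EFin \o f)) :
    exists p q : R, [/\ (\int[m]_x F^\+ x = p%:E)%E,
      (\int[m]_x F^\- x = q%:E)%E & \int[m]_x f x = p - q].
  have a := integrable_pos_fin_num measurableT i; have b := integrable_neg_fin_num measurableT i.
  exists (fine (\int[m]_x F^\+ x)%E), (fine (\int[m]_x F^\- x)%E).
  rewrite !fineK//; split => //.
  by rewrite /Rintegral integralE fineB.
move: hp hm.
have [a1 [b1 [-> -> ->]]] := fin _ i1; have [a2 [b2 [-> -> ->]]] := fin _ i2.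
have [a3 [b3 [-> -> ->]]] := fin _ j1; have [a4 [b4 [-> -> ->]]] := fin _ j2.
rewrite -!EFinM -!EFinD => -[hp] [hm].
by rewrite !mulrBr addrACA hp -opprD hm; ring.
Qed.

End MeasureCombination.

Section SpectralMeasure.
Context {R : realType} {V : completeNormedModType R[i]}.
Context {dot : {dot V for @conjc R}}.
Variable E : pvm dot.
Local Notation nrm2 := (sqnrm dot).
Local Notation mu := (pvm_measure E).

Lemma pvmD B x y : measurable B -> E B (x + y) = E B x + E B y.
Proof.
by move=> mB; have := pvm_linear E mB 1 x y; rewrite !scale1r.
Qed.

Lemma pvm_0 B : measurable B -> E B 0 = 0.
Proof.
move=> mB; have := pvmD _ 0 0 mB; rewrite addr0 => /eqP.
by rewrite -subr_eq subrr => /eqP <-.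
Qed.

Lemma pvmZ B a x : measurable B -> E B (a *: x) = a *: E B x.
Proof.
by move=> mB; have := pvm_linear E mB a x 0; rewrite addr0 pvm_0// addr0.
Qed.

Lemma pvmN B x : measurable B -> E B (- x) = - E B x.
Proof. by move=> mB; rewrite -scaleN1r pvmZ// scaleN1r. Qed.

Lemma pvm_idem B x : measurable B -> E B (E B x) = E B x.
Proof. by move=> mB; rewrite -pvmI// setIid. Qed.

Lemma pvm_comm A B x : measurable A -> measurable B ->
  E A (E B x) = E B (E A x).
Proof. by move=> mA mB; rewrite -pvmI// setIC pvmI. Qed.

Lemma nrm2_pvm B x : measurable B -> nrm2 (E B x) = Re (dot (E B x) x).
Proof. by move=> mB; rewrite /sqnrm -(pvm_sym E mB) pvm_idem. Qed.

Lemma pvm_measureE x B : mu x B = (nrm2 (E B x))%:E. Proof. by []. Qed.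

Lemma pvm_measureT x : mu x setT = (nrm2 x)%:E.
Proof. by rewrite pvm_measureE pvmT. Qed.

Lemma pvm_additive x A B : measurable A -> measurable B -> A `&` B = set0 ->
  nrm2 (E (A `|` B) x) = nrm2 (E A x) + nrm2 (E B x).
Proof.
move=> mA mB AB; apply: EFin_inj; rewrite EFinD -!pvm_measureE.
by rewrite measureU.
Qed.

Lemma pvm_subadditive x A B : measurable A -> measurable B ->
  nrm2 (E (A `|` B) x) <= nrm2 (E A x) + nrm2 (E B x).
Proof.
move=> mA mB; rewrite -lee_fin EFinD -!pvm_measureE.
exact: measureU2.
Qed.

Lemma pvm_monotone x A B : measurable A -> measurable B -> A `<=` B ->
  nrm2 (E A x) <= nrm2 (E B x).
Proof.
move=> mA mB AB; rewrite -lee_fin -!pvm_measureE.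
by apply: le_measure; rewrite ?inE.
Qed.

Definition pvm_rintegral (f : R -> R) (x : V) : R := \int[mu x]_l f l.

Lemma pvm_integral_combination (f : R -> R) x1 x2 y1 y2 (k1 k2 : R) :
  0 <= k1 -> 0 <= k2 ->
  (forall S, measurable S -> nrm2 (E S x1) + nrm2 (E S x2) =
     k1 * nrm2 (E S y1) + k2 * nrm2 (E S y2)) ->
  (mu x1).-integrable setT (EFin \o f) -> (mu x2).-integrable setT (EFin \o f) ->
  (mu y1).-integrable setT (EFin \o f) -> (mu y2).-integrable setT (EFin \o f) ->
  pvm_rintegral f x1 + pvm_rintegral f x2 = k1 * pvm_rintegral f y1 + k2 * pvm_rintegral f y2.
Proof.
move=> k10 k20 h; apply: (@Rintegral_combination _ _ _ _ _ _ _ (NngNum k10) (NngNum k20)).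
move=> S mS; apply: (congr1 EFin (h S mS)).
Qed.

Lemma pvm_integrable_bounded (f : R -> R) x : measurable_fun setT f ->
  (forall l, `|f l| <= 1) -> (mu x).-integrable setT (EFin \o f).
Proof.
move=> mf f1; apply/integrableP; split; first exact/measurable_EFinP.
apply: (@le_lt_trans _ _ (\int[mu x]_l (cst 1%E) l)%E).
  apply: ge0_le_integral => //; last by move=> l _; rewrite /= lee_fin.
  by apply/measurable_EFinP; exact: measurableT_comp.
by rewrite integral_cst// mul1e [X in (X < _)%E]pvm_measureT ltry.
Qed.

Definition pvm_id_dom x := in_pvm_dom E (fun l => l%:C) x.

Lemma measurable_sqr_EFin : measurable_fun setT (fun l : R => (l ^+ 2)%:E).
Proof. by apply/measurable_EFinP; exact: measurable_funX. Qed.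

Lemma pvm_id_domE x : pvm_id_dom x <-> (\int[mu x]_l (l ^+ 2)%:E < +oo)%E.
Proof.
rewrite /pvm_id_dom /in_pvm_dom.
rewrite (eq_integral (fun l : R => (l ^+ 2)%:E)) //.
by move=> l _; rewrite /sqnorm /= expr0n addr0.
Qed.

(** The measure is finite and [|l| <= 1 + l^2]. *)
Lemma pvm_id_integrable x : pvm_id_dom x -> (mu x).-integrable setT (EFin \o @idfun R).
Proof.
move=> /pvm_id_domE h; apply/integrableP.
split; first by apply/measurable_EFinP; exact: measurable_id.
apply: (@le_lt_trans _ _ (\int[mu x]_l (1%:E + (l ^+ 2)%:E))%E).
  apply: ge0_le_integral => //.
  - by apply/measurable_EFinP; apply: (measurableT_comp (@normr_measurable R setT)); exact: measurable_id.
  - by apply: emeasurable_funD => //; exact: measurable_sqr_EFin.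
  - move=> l _; rewrite /= -EFinD lee_fin -real_normK ?num_real//.
    have := sqr_ge0 (`|l| - 2^-1); set a := `|l|; nra.
rewrite ge0_integralD//.
- rewrite integral_cst// mul1e; apply: lte_add_pinfty => //.
  by rewrite [X in (X < _)%E]pvm_measureT ltry.
- by move=> l _; rewrite lee_fin sqr_ge0.
- exact: measurable_sqr_EFin.
Qed.

Lemma pvm_parallelogram x y S : measurable S ->
  nrm2 (E S (x + y)) + nrm2 (E S (x - y)) = 2 * nrm2 (E S x) + 2 * nrm2 (E S y).
Proof. by move=> mS; rewrite !pvmD// pvmN// parallelogram. Qed.

(** By the parallelogram law, the measure of [x + y] is at most twice the sum of the measures of [x]
    and [y]. *)
Lemma pvm_id_domD x y : pvm_id_dom x -> pvm_id_dom y -> pvm_id_dom (x + y).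
Proof.
move=> /pvm_id_domE hx /pvm_id_domE hy; apply/pvm_id_domE.
have n2 : 0 <= (2 : R) by [].
have := @ge0_integral_combination _ _ _ (mu (x + y)) (mu (x - y)) (mu x) (mu y)
  (NngNum n2) (NngNum n2) _ (fun l => (l ^+ 2)%:E) _ measurable_sqr_EFin.
move=> h.
apply: (@le_lt_trans _ _ (\int[mu (x + y)%R]_l (l ^+ 2)%:E +
                          \int[mu (x - y)%R]_l (l ^+ 2)%:E)%E).
  by rewrite leeDl// integral_ge0// => l _; rewrite lee_fin sqr_ge0.
rewrite h; first by apply: lte_add_pinfty; apply: lte_mul_pinfty.
- by move=> S mS; apply: (congr1 EFin (pvm_parallelogram x y S mS)).
- by move=> l; rewrite lee_fin sqr_ge0.
Qed.

Lemma nrm2_pvmZ S a x : measurable S -> nrm2 (E S (a *: x)) = sqnorm a * nrm2 (E S x).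
Proof. by move=> mS; rewrite pvmZ// nrm2Z. Qed.

Lemma pvm_id_domZ a x : pvm_id_dom x -> pvm_id_dom (a *: x).
Proof.
move=> /pvm_id_domE hx; apply/pvm_id_domE.
rewrite (_ : integral _ _ _ = (sqnorm a)%:E * \int[mu x]_l (l ^+ 2)%:E)%E.
  by apply: lte_mul_pinfty => //; rewrite lee_fin sqnorm_ge0.
rewrite -(@ge0_integral_mscale _ _ _ (mu x) setT measurableT (NngNum (sqnorm_ge0 a)))//.
- apply: eq_measure_integral => S mS _.
  exact: (congr1 EFin (nrm2_pvmZ S a x mS)).
- exact: measurable_sqr_EFin.
- by move=> l _; rewrite lee_fin sqr_ge0.
Qed.

Lemma pvm_id_domN x : pvm_id_dom x -> pvm_id_dom (- x).
Proof. by rewrite -scaleN1r; exact: pvm_id_domZ. Qed.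

Lemma pvm_id_dom_proj B x : measurable B -> pvm_id_dom x -> pvm_id_dom (E B x).
Proof.
move=> mB /pvm_id_domE hx; apply/pvm_id_domE; apply: le_lt_trans hx.
apply: ge0_le_measure_integral => //.
- move=> S mS.
  have : ((nrm2 (E S (E B x)))%:E <= (nrm2 (E S x))%:E)%E.
    by rewrite lee_fin -pvmI// pvm_monotone//; exact: measurableI.
  by [].
- by move=> l; rewrite lee_fin sqr_ge0.
- exact: measurable_sqr_EFin.
Qed.

End SpectralMeasure.

(** * Spectral measure of the inverse of a positive contraction *)

Section SpectralIntegral.
Context {R : realType} {V : completeNormedModType R[i]}.
Context {dot : {dot V for @conjc R}}.
Variable E : pvm dot.
Local Notation C := (R[i]).
Local Notation nrm2 := (sqnrm dot).
Local Notation mu := (pvm_measure E).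
Local Notation J := (pvm_rintegral E).
Local Notation i := ('i%C : C).

Lemma pvm_cintegralE (f : R -> C) x z :
  let c w := cintegral (mu w) f in
  pvm_cintegral E f x z =
  4^-1 * (c (x + z) - c (x - z) + i * (c (x + i *: z) - c (x - i *: z))).
Proof.
rewrite /pvm_cintegral !big_ord_recl big_ord0 /=.
have i3 : (i ^+ 3 = - i)%R by rewrite exprS sqr_i mulrN1.
rewrite /bump /= !expr0 !expr1 sqr_i i3 !scale1r !scaleN1r !scaleNr.
congr (_ * _); ring.
Qed.

Lemma Re4V (z : C) : Re (4^-1 * z) = 4^-1 * Re z.
Proof.
rewrite (_ : 4^-1 = (4^-1 : R)%:C); last by rewrite fmorphV rmorph_nat.
by rewrite ReM /= mul0r subr0.
Qed.

Lemma Im4V (z : C) : Im (4^-1 * z) = 4^-1 * Im z.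
Proof.
rewrite (_ : 4^-1 = (4^-1 : R)%:C); last by rewrite fmorphV rmorph_nat.
by rewrite ImM /= mul0r addr0.
Qed.

Lemma cintegral_realE x (f : R -> R) : cintegral (mu x) (fun l => (f l)%:C) = (J f x)%:C.
Proof.
rewrite /cintegral /=; congr (_ +i* _).
by rewrite Rintegral_cst//= mul0r.
Qed.

Local Notation Id := (fun l : R => l).
Local Notation L := (pvm_id_dom E).

Lemma Re_pvm_cintegral_real (f : R -> R) x z :
  Re (pvm_cintegral E (fun l => (f l)%:C) x z) = 4^-1 * (J f (x + z) - J f (x - z)).
Proof.
by rewrite pvm_cintegralE !cintegral_realE Re4V !ReImE /=; congr (_ * _); ring.
Qed.

Lemma Im_pvm_cintegral_real (f : R -> R) x z :
  Im (pvm_cintegral E (fun l => (f l)%:C) x z) =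
  4^-1 * (J f (x + i *: z) - J f (x - i *: z)).
Proof.
by rewrite pvm_cintegralE !cintegral_realE Im4V !ReImE /=; congr (_ * _); ring.
Qed.

(** Symmetry of [E B], carried through polarisation. Since [E B] commutes with every [E S], the
    cross terms of [y] with [E B z] and of [E B y] with [z] agree on each [S]. *)
Lemma pvm_real_integral_proj (f : R -> R) B y z : measurable B ->
  (forall w, (w = y + E B z \/ w = y - E B z) \/ (w = E B y + z \/ w = E B y - z) ->
     (mu w).-integrable setT (EFin \o f)) ->
  J f (y + E B z) - J f (y - E B z) = J f (E B y + z) - J f (E B y - z).
Proof.
move=> mB fi.
have h : J f (y + E B z) + J f (E B y - z) =
    1 * J f (E B y + z) + 1 * J f (y - E B z).
  apply: pvm_integral_combination => //; try (by apply: fi; tauto).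
  move=> S mS; rewrite !mul1r !pvmD// !pvmN// !nrm2D !nrm2N !dotNr !ReN.
  rewrite !(pvm_comm E S B)//.
  have -> : Re (dot (E S y) (E B (E S z))) = Re (dot (E B (E S y)) (E S z)).
    by rewrite (pvm_sym E mB).
  ring.
lra.
Qed.

Lemma pvm_integral0 (f : R -> R) : J f 0 = 0.
Proof.
rewrite /pvm_rintegral /Rintegral (@eq_measure_integral _ _ _ setT mzero).
  by rewrite integral_measure_zero.
move=> S mS _; have : (nrm2 (E S 0))%:E = 0%E by rewrite pvm_0// nrm2_0.
by [].
Qed.

(** Polarisation on the diagonal: the measure of [x + x] is four times that of [x]. *)
Lemma pvm_integral_diag (f : R -> R) x :
  (mu x).-integrable setT (EFin \o f) ->
  (mu (x + x)).-integrable setT (EFin \o f) ->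
  (mu 0).-integrable setT (EFin \o f) ->
  4^-1 * (J f (x + x) - J f (x - x)) = J f x.
Proof.
move=> fx fxx f0; rewrite subrr pvm_integral0.
have := @pvm_integral_combination _ _ _ E f (x + x) 0 x 0 4 0 (ler0n _ _) (lexx 0).
rewrite pvm_integral0 mulr0 !addr0 => -> //; first by field.
by move=> S mS; rewrite !pvm_0// !nrm2_0 mulr0 pvmD// nrm2D /sqnrm; ring.
Qed.

Section Operator.
Variable A : V -> V.
Hypothesis A_contr : forall x, nrm2 (A x) <= Re (dot (A x) x).
Hypothesis A_pos : forall x, Re (dot (A x) x) = 0 -> x = 0.
Hypothesis hE : spectral_measure_of E [set p | p.1 = A p.2].

Lemma inverse_domP w : L (A w).
Proof.
have : [set p : V * V | p.1 = A p.2] (A w, w) by [].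
by rewrite hE => -[].
Qed.

Lemma inverse_Re w z : L z ->
  Re (dot w z) = 4^-1 * (J Id (A w + z) - J Id (A w - z)).
Proof.
move=> Lz; have : [set p : V * V | p.1 = A p.2] (A w, w) by [].
by rewrite hE => -[_ /(_ z Lz)] /= ->; rewrite -Re_pvm_cintegral_real.
Qed.

Lemma inverse_Im w z : L z ->
  Im (dot w z) = 4^-1 * (J Id (A w + i *: z) - J Id (A w - i *: z)).
Proof.
move=> Lz; have : [set p : V * V | p.1 = A p.2] (A w, w) by [].
by rewrite hE => -[_ /(_ z Lz)] /= ->; rewrite -Im_pvm_cintegral_real.
Qed.

Lemma inverse_diag w : Re (dot w (A w)) = J Id (A w).
Proof.
have LA := inverse_domP w.
have L0 : L 0.
  by rewrite -(subrr (A w)); apply: pvm_id_domD => //; exact: pvm_id_domN.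
rewrite inverse_Re// pvm_integral_diag//.
- exact: pvm_id_integrable.
- by apply: pvm_id_integrable; exact: pvm_id_domD.
- exact: pvm_id_integrable.
Qed.

(** It is enough that [(E B (A w), E B w)] lies in the graph of the spectral integral. The
    projection is moved onto the test vector, where [hE] applies to [(A w, w)], and moved back by
    [pvm_real_integral_proj]. *)
Lemma inverse_pvm_comm B w : measurable B -> A (E B w) = E B (A w).
Proof.
move=> mB; have Ly := inverse_domP w.
have key : [set p : V * V | p.1 = A p.2] (E B (A w), E B w).
  rewrite hE; split=> /=; first exact: pvm_id_dom_proj.
  move=> z Lz.
  have int u : L u -> forall v, (v = A w + E B u \/ v = A w - E B u) \/
     (v = E B (A w) + u \/ v = E B (A w) - u) ->
     (mu v).-integrable setT (EFin \o Id).
    move=> Lu v h; apply: pvm_id_integrable.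
    have LB x := pvm_id_dom_proj E B x mB; have LN := @pvm_id_domN _ _ _ E.
    by case: h => -[] ->; apply: pvm_id_domD => //; auto.
  have LBz := pvm_id_dom_proj E _ _ mB Lz.
  rewrite (pvm_sym E mB); apply: complex_ext.
    rewrite inverse_Re// Re_pvm_cintegral_real; congr (_ * _).
    by apply: pvm_real_integral_proj => //; exact: int.
  rewrite inverse_Im// Im_pvm_cintegral_real; congr (_ * _).
  rewrite -pvmZ//; apply: pvm_real_integral_proj => //; apply: int.
  exact: pvm_id_domZ.
by rewrite -[RHS]/((E B (A w), E B w).1) key.
Qed.

(** Let [u] be the projected vector and [v = A u]. From [|v|^2 <= <A u, u>], the integral of [1 - l]
    against the measure of [v] is at most 0. That measure lives where [1 - l > 0], so it vanishes;
    hence [v = 0], and [u = 0] by positivity of [A]. *)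
Lemma pvm_support_lt1 w : E `]-oo, (1 : R)[%classic w = 0.
Proof.
set B := `]-oo, 1[%classic.
have mB : measurable B by exact: measurable_itv.
set u := E B w; set v := A u.
have vB : E B v = v by rewrite /v /u -inverse_pvm_comm// pvm_idem.
have le1 : nrm2 v <= J Id v.
  by rewrite -inverse_diag ReJdot; exact: A_contr.
have Lv : L v by exact: inverse_domP.
have i1 : (mu v).-integrable setT (EFin \o Id) by exact: pvm_id_integrable.
have i0 : (mu v).-integrable setT (EFin \o (fun=> 1)).
  by apply: pvm_integrable_bounded => // l; rewrite normr1.
have nB : (mu v (~` B) = 0)%E.
  rewrite pvm_measureE -vB -pvmI//; last exact: measurableC.
  by rewrite setIC setICr pvm0 nrm2_0.
pose f l : R := 1 - l.
have mf : measurable_fun setT (EFin \o f).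
  by apply/measurable_EFinP; apply: measurable_funB.
have fi : (mu v).-integrable setT (EFin \o f).
  have := integrableB measurableT i0 i1; apply: eq_integrable => //.
have aeB : {ae mu v, forall l, B l}.
  exists (~` B); split => //; exact: measurableC.
have intf : (\int[mu v]_l `|(EFin \o f) l| = (\int[mu v]_l f l)%:E)%E.
  rewrite /Rintegral fineK; last exact: integrable_fin_num.
  apply: ae_eq_integral => //.
    exact: measurableT_comp.
  move: aeB; apply: filterS => l Bl _ /=; rewrite ger0_norm// subr_ge0.
  by move: Bl; rewrite /B /= in_itv /= => /ltW.
have int0 : \int[mu v]_l f l <= 0.
  rewrite RintegralB// subr_le0.
  apply: le_trans le1.
  rewrite Rintegral_cst// mul1r le_eqVlt; apply/orP; left; apply/eqP.
  exact: (congr1 fine (pvm_measureT E v)).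
have abs0 : (\int[mu v]_l `|(EFin \o f) l| = 0)%E.
  apply/le_anti; rewrite integral_ge0 ?andbT//.
  by rewrite intf lee_fin.
have /(ae_eq_integral_abs _ measurableT mf) f0 := abs0.
(* The two almost-everywhere facts contradict each other at every point, so the whole line is a null
   set. *)
have : {ae mu v, forall l : R, False}.
  apply: filterS2 aeB f0 => l Bl /(_ I) /= [].
  by move: Bl; rewrite /B /= in_itv /= /f; lra.
move=> [N [mN N0 sN]].
have NT : N = setT by apply/seteqP; split=> // x _; apply: sN => /=; tauto.
have v0 : v = 0.
  by apply: (@nrm2_eq0 _ _ dot); apply: EFin_inj; rewrite -(pvm_measureT E) -NT.
by apply: A_pos; rewrite -/v v0 dot0l.
Qed.

End Operator.

End SpectralIntegral.

(** * Spectral windows, and a lower bound for the unitary group *)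

Section Window.
Context {R : realType} {V : completeNormedModType R[i]}.
Context {dot : {dot V for @conjc R}}.
Variable E : pvm dot.
Local Notation C := (R[i]).
Local Notation nrm2 := (sqnrm dot).
Local Notation mu := (pvm_measure E).
Local Notation J := (pvm_rintegral E).
Local Notation L := (pvm_id_dom E).
Local Notation i := ('i%C : C).
Local Notation Id := (fun l : R => l).

Lemma pvm_ae_support S z : measurable S -> E S z = z -> {ae mu z, forall l, S l}.
Proof.
move=> mS Sz; exists (~` S); split => //; first exact: measurableC.
rewrite pvm_measureE -Sz -pvmI//; last exact: measurableC.
by rewrite setIC setICr pvm0 nrm2_0.
Qed.

Lemma pvm_integral_ae_ge0 (f : R -> R) z :
  (mu z).-integrable setT (EFin \o f) -> {ae mu z, forall l, 0 <= f l} ->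
  0 <= J f z.
Proof.
move=> fi f0; have mf := measurable_int _ fi.
rewrite /pvm_rintegral /Rintegral (_ : integral _ _ _ = \int[mu z]_l `|(EFin \o f) l|)%E.
  by rewrite fine_ge0// integral_ge0.
apply: ae_eq_integral => //; first exact: measurableT_comp.
by move: f0; apply: filterS => l f0 _ /=; rewrite ger0_norm.
Qed.

Lemma pvm_id_dom_bounded S a z : measurable S -> E S z = z ->
  (forall l, S l -> `|l| <= a) -> L z.
Proof.
move=> mS Sz Sa; apply/pvm_id_domE.
apply: (@le_lt_trans _ _ (\int[mu z]_l (cst (a ^+ 2)%:E) l)%E); last first.
  rewrite integral_cst//; apply: lte_mul_pinfty => //.
    by rewrite lee_fin sqr_ge0.
  by rewrite [X in (X < _)%E]pvm_measureT ltry.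
apply: ae_ge0_le_integral => //.
- by move=> l _; rewrite lee_fin sqr_ge0.
- exact: measurable_sqr_EFin.
- by move=> l _; rewrite lee_fin sqr_ge0.
- move: (pvm_ae_support _ _ mS Sz); apply: filterS => l /Sa la _ /=.
  by rewrite lee_fin -[l ^+ 2]real_normK ?num_real// ler_pXn2r ?nnegrE// (le_trans _ la).
Qed.

Section Operator.
Variable A : V -> V.
Hypothesis A_contr : forall x, nrm2 (A x) <= Re (dot (A x) x).
Hypothesis A_pos : forall x, Re (dot (A x) x) = 0 -> x = 0.
Hypothesis hE : spectral_measure_of E [set p | p.1 = A p.2].

(** The complementary projection kills [w], so this one preserves its norm; an orthogonal projection
    preserving the norm of a vector fixes it. *)
Lemma pvm_support_ge1 w : E `[1%R, +oo[%classic w = w.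
Proof.
set S := `[1, +oo[%classic; set S' := `]-oo, (1 : R)[%classic.
have mS : measurable S by exact: measurable_itv.
have mS' : measurable S' by exact: measurable_itv.
have disj : S `&` S' = set0.
  by rewrite -subset0 => l [] /=; rewrite /S /S' /= !in_itv /= andbT; lra.
have cup : setT = S `|` S'.
  apply/esym; rewrite -subTset => l _ /=; rewrite /S /S' /= !in_itv /= andbT.
  by case: (leP 1 l); [left|right].
have nw : nrm2 (E S w) = nrm2 w.
  rewrite -[in RHS](pvmT E w) cup pvm_additive//.
  by rewrite (pvm_support_lt1 E A A_contr A_pos hE) nrm2_0 addr0.
apply/eqP; rewrite -subr_eq0; apply/eqP; apply: (@nrm2_eq0 _ _ dot).
by rewrite nrm2B -nrm2_pvm// nw; ring.
Qed.

Lemma pvm_id_integral_ge0 w : L w -> 0 <= J Id w.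
Proof.
move=> Lw; apply: pvm_integral_ae_ge0; first exact: pvm_id_integrable.
have m1 : measurable `[(1 : R), +oo[%classic by exact: measurable_itv.
move: (pvm_ae_support _ _ m1 (pvm_support_ge1 w)); apply: filterS => l /=.
rewrite in_itv /=; lra.
Qed.

(* With [z = E([1, a)) x], polarise [<x, z / a>] as the integral of the identity
   against [<E A x, z / a>] and drop the negative square. *)
Lemma pvm_window_bound a x : 1 < a ->
  nrm2 (E `[1%R, a[%classic x) <= a * Re (dot (A x) x).
Proof.
move=> a1; set S := `[1, a[%classic; set z := E S x.
have mS : measurable S by exact: measurable_itv.
have Sz : E S z = z by rewrite /z pvm_idem.
have Lz : L z.
  apply: (pvm_id_dom_bounded S a) => // l; rewrite /S /= in_itv /= => /andP[l1 la].
  by rewrite ger0_norm; lra.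
have Ly : L (A x) by exact: inverse_domP hE x.
have Jz : J Id z <= a * nrm2 z.
  have i1 : (mu z).-integrable setT (EFin \o Id) by exact: pvm_id_integrable.
  have ia : (mu z).-integrable setT (EFin \o (fun=> a)).
    have h : (mu z).-integrable setT (EFin \o (fun=> 1)).
      by apply: pvm_integrable_bounded => // l; rewrite normr1.
    have := integrableZl measurableT a h; apply: eq_integrable => // l _ /=.
    by rewrite mule1.
  have : 0 <= J (fun l => a - l) z.
    apply: pvm_integral_ae_ge0.
      have := integrableB measurableT ia i1; exact: eq_integrable.
    move: (pvm_ae_support _ _ mS Sz); apply: filterS => l.
    by rewrite /S /= in_itv /=; lra.
  rewrite /pvm_rintegral RintegralB// subr_ge0 Rintegral_cst//.
  by have -> : fine (mu z setT) = nrm2 z by exact: (congr1 fine (pvm_measureT E z)).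
pose c := a^-1; have a0 : 0 < a by lra.
have c0 : 0 < c by rewrite invr_gt0.
have Lcz : L (c%:C *: z) by exact: pvm_id_domZ.
have h1 := inverse_Re E A hE x _ Lcz.
have dz : Re (dot x (c%:C *: z)) = c * nrm2 z.
  rewrite dotZr ReM /= oppr0 mul0r subr0 ReJdot; congr (_ * _).
  by rewrite /z nrm2_pvm.
rewrite dz in h1.
have Lp : L (A x + c%:C *: z) by exact: pvm_id_domD.
have Lm : L (A x - c%:C *: z) by apply: pvm_id_domD => //; exact: pvm_id_domN.
have h2 : J Id (A x + c%:C *: z) + J Id (A x - c%:C *: z) =
    2 * J Id (A x) + (2 * c ^+ 2) * J Id z.
  apply: pvm_integral_combination => //; try exact: pvm_id_integrable.
  - by rewrite mulr_ge0// sqr_ge0.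
  - move=> P mP; rewrite pvm_parallelogram// nrm2_pvmZ// /sqnorm /=.
    by rewrite expr0n addr0 mulrA.
have h3 := pvm_id_integral_ge0 _ Lm.
rewrite -(inverse_diag E A hE x) (ReJdot dot (A x) x) in h2.
set q := Re (dot (A x) x) in h2 *.
have h4 : c * nrm2 z <= 2^-1 * (q + c ^+ 2 * (a * nrm2 z)).
  have := ler_wpM2l (sqr_ge0 c) Jz; nra.
(* The scale [c = 1/a] is chosen so that the quadratic term equals the left-hand side of [h4], half
   of which can then be absorbed. *)
have e : c ^+ 2 * (a * nrm2 z) = c * nrm2 z.
  by rewrite /c; field; rewrite gt_eqF.
rewrite e in h4.
have h5 : c * nrm2 z <= q by lra.
rewrite -ler_pdivrMl//; exact: h5.
Qed.

End Operator.

(** With [z = E S x], the number [<E P x, E P z> = |E P z|^2] is real. Hence the measures of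
    [x + i z] and [x - i z] coincide, while those of [x + z] and [x - z] differ by four times that
    of [z]. *)
Lemma pvm_unitary_dot (th : R -> R) x w S : measurable_fun setT th ->
  measurable S ->
  spectral_integral E (fun l => expi (th l)) (x, w) ->
  Re (dot w (E S x)) = J (fun l => cos (th l)) (E S x) /\
  Im (dot w (E S x)) = J (fun l => sin (th l)) (E S x).
Proof.
move=> mth mS [_ /(_ (E S x)) /=]; set z := E S x => h.
have {}h : dot w z = pvm_cintegral E (fun l => expi (th l)) x z.
  apply: h; rewrite /in_pvm_dom (eq_integral (cst 1%E)).
    by rewrite integral_cst// mul1e [X in (X < _)%E]pvm_measureT ltry.
  by move=> l _; rewrite /sqnorm /= cos2Dsin2.
have mc : measurable_fun setT (fun l => cos (th l)).
  exact: measurableT_comp (continuous_measurable_fun (@continuous_cos R)) mth.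
have ms : measurable_fun setT (fun l => sin (th l)).
  exact: measurableT_comp (continuous_measurable_fun (@continuous_sin R)) mth.
have ic v := pvm_integrable_bounded E _ v mc (fun l => cos_max (th l)).
have is_ v := pvm_integrable_bounded E _ v ms (fun l => sin_max (th l)).
have cE v : cintegral (mu v) (fun l => expi (th l)) =
   J (fun l => cos (th l)) v +i* J (fun l => sin (th l)) v by [].
have zz P : measurable P -> dot (E P x) (E P z) = (nrm2 (E P z))%:C.
  move=> mP; rewrite /z pvm_comm// -[in LHS](pvm_idem E S (E P x) mS).
  by rewrite -(pvm_sym E mS) dotxx.
have ReI P : measurable P -> Re (dot (E P x) (i *: E P z)) = 0.
  by move=> mP; rewrite dotZr zz// ReM /=; ring.
have eqI f : J f (x + i *: z) = J f (x - i *: z).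
  rewrite /pvm_rintegral /Rintegral; congr fine; apply: eq_measure_integral => P mP _.
  apply: (congr1 EFin); rewrite -/(sqnrm _ _) -[RHS]/(nrm2 (E P (x - i *: z))).
  by rewrite !pvmD// pvmN// pvmZ// nrm2D nrm2B ReI//; ring.
have diff f : (forall v, (mu v).-integrable setT (EFin \o f)) ->
    J f (x + z) - J f (x - z) = 4 * J f z.
  move=> fi.
  have := @pvm_integral_combination _ _ _ E f (x + z) 0 (x - z) z 1 4 ler01 (ler0n _ _).
  rewrite pvm_integral0 addr0 mul1r => ->; rewrite ?addrK//; first by ring.
  move=> P mP; rewrite pvm_0// nrm2_0 mul1r !pvmD// pvmN// nrm2D nrm2B zz//=.
  ring.
rewrite h pvm_cintegralE !cE !eqI subrr mulr0 addr0.
rewrite Re4V Im4V !ReImE /= !diff//; by split; field.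
Qed.

(* Everywhere one of [cos], [- cos], [sin], [- sin] is at least 1/2, and on the
   part of [x] living there [<w, E(S) x>] is at least half of [|E(S) x|^2]. *)
Lemma pvm_unitary_lower (th : R -> R) x w : measurable_fun setT th ->
  spectral_integral E (fun l => expi (th l)) (x, w) ->
  nrm2 x <= 16 * nrm2 w.
Proof.
move=> mth hw.
have mc : measurable_fun setT (fun l => cos (th l)).
  exact: measurableT_comp (continuous_measurable_fun (@continuous_cos R)) mth.
have ms : measurable_fun setT (fun l => sin (th l)).
  exact: measurableT_comp (continuous_measurable_fun (@continuous_sin R)) mth.
have key (f : R -> R) (c : R[i]) : measurable_fun setT f ->
    (forall l, `|f l| <= 1) -> sqnorm c = 1 ->
    (forall S, measurable S -> Re (c * dot w (E S x)) = J f (E S x)) ->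
    nrm2 (E [set l | 2^-1 <= f l] x) <= 4 * nrm2 w.
  move=> mf f1 c1 hf; set S := [set l | _].
  have mS : measurable S.
    rewrite (_ : S = setT `&` f @^-1` `[2^-1, +oo[%classic).
      exact: mf.
    by rewrite setTI; apply/seteqP; split => l /=; rewrite in_itv /= andbT.
  set z := E S x; have Sz : E S z = z by rewrite /z pvm_idem.
  have i1 : (mu z).-integrable setT (EFin \o f) by exact: pvm_integrable_bounded.
  have ih : (mu z).-integrable setT (EFin \o (fun=> 2^-1)).
    by apply: pvm_integrable_bounded => // l; rewrite ger0_norm; lra.
  have lo : 2^-1 * nrm2 z <= J f z.
    have : 0 <= J (fun l => f l - 2^-1) z.
      apply: pvm_integral_ae_ge0.
        have := integrableB measurableT i1 ih; exact: eq_integrable.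
      move: (pvm_ae_support _ _ mS Sz); apply: filterS => l.
      by rewrite /S /=; lra.
    rewrite /pvm_rintegral RintegralB// subr_ge0 Rintegral_cst//.
    by have -> : fine (mu z setT) = nrm2 z by exact: (congr1 fine (pvm_measureT E z)).
  (* From [|z|^2 / 2 <= |w| |z|] follows [|z|^2 <= 4 |w|^2]; the four pieces add up to the constant
     16. *)
  have := dot_CS dot (c *: w) z.
  rewrite dotZl hf// nrm2Z c1 mul1r -/z => cs.
  have n0 := nrm2_ge0 dot z; have w0 := nrm2_ge0 dot w.
  have [z0|zn] := eqVneq (nrm2 z) 0; first by rewrite z0 mulr_ge0.
  have z1 : 0 < nrm2 z by rewrite lt_neqAle eq_sym zn.
  have cs2 : (2^-1 * nrm2 z) ^+ 2 <= nrm2 w * nrm2 z.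
    by apply: le_trans cs; rewrite ler_pXn2r// nnegrE; lra.
  rewrite -(ler_pM2r z1); lra.
have d S (mS : measurable S) := pvm_unitary_dot th x w S mth mS hw.
have J_N f S : (mu (E S x)).-integrable setT (EFin \o f) ->
    J (fun l => - f l) (E S x) = - J f (E S x).
  move=> fi; rewrite /pvm_rintegral -mulN1r -RintegralZl//.
  by apply: eq_Rintegral => l _; rewrite mulN1r.
have ic v := pvm_integrable_bounded E _ v mc (fun l => cos_max (th l)).
have is_ v := pvm_integrable_bounded E _ v ms (fun l => sin_max (th l)).
have k1 : nrm2 (E [set l | 2^-1 <= cos (th l)] x) <= 4 * nrm2 w.
  apply: (key _ 1) => //; first by move=> l; exact: cos_max.
    by rewrite /sqnorm /=; ring.
  by move=> S /d[+ _]; rewrite mul1r.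
have k2 : nrm2 (E [set l | 2^-1 <= - cos (th l)] x) <= 4 * nrm2 w.
  apply: (key (fun l => - cos (th l)) (-1)).
  - exact: measurableT_comp.
  - by move=> l; rewrite normrN; exact: cos_max.
  - by rewrite /sqnorm !ReImE /=; ring.
  - by move=> S mS; rewrite J_N// mulN1r ReN (d _ mS).1.
have k3 : nrm2 (E [set l | 2^-1 <= sin (th l)] x) <= 4 * nrm2 w.
  apply: (key _ (- i)) => //; first by move=> l; exact: sin_max.
    by rewrite /sqnorm !ReImE /=; ring.
  by move=> S /d[_ <-]; rewrite !ReImE /=; ring.
have k4 : nrm2 (E [set l | 2^-1 <= - sin (th l)] x) <= 4 * nrm2 w.
  apply: (key (fun l => - sin (th l)) i).
  - exact: measurableT_comp.
  - by move=> l; rewrite normrN; exact: sin_max.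
  - by rewrite /sqnorm /=; ring.
  - by move=> S mS; rewrite J_N// -(d _ mS).2 !ReImE /=; ring.
have mset (f : R -> R) : measurable_fun setT f -> measurable [set l | 2^-1 <= f l].
  move=> mf; rewrite (_ : [set l | _] = setT `&` f @^-1` `[2^-1, +oo[%classic).
    exact: mf.
  by rewrite setTI; apply/seteqP; split => l /=; rewrite in_itv /= andbT.
have mc' : measurable_fun setT (fun l => - cos (th l)) by exact: measurableT_comp.
have ms' : measurable_fun setT (fun l => - sin (th l)) by exact: measurableT_comp.
move: (mset _ mc) (mset _ mc') (mset _ ms) (mset _ ms') k1 k2 k3 k4.
set S1 := [set l | _]; set S2 := [set l | _ <= - cos _].
set S3 := [set l | _ <= sin _]; set S4 := [set l | _ <= - sin _].
move=> m1 m2 m3 m4 k1 k2 k3 k4.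
have cov : setT = (S1 `|` S2) `|` (S3 `|` S4).
  apply/esym; rewrite -subTset => l _; apply: contrapT.
  rewrite /S1 /S2 /S3 /S4 /= => h; have := cos2Dsin2 (th l).
  have h1 : cos (th l) < 2^-1 by rewrite ltNge; apply/negP; tauto.
  have h2 : - cos (th l) < 2^-1 by rewrite ltNge; apply/negP; tauto.
  have h3 : sin (th l) < 2^-1 by rewrite ltNge; apply/negP; tauto.
  have h4 : - sin (th l) < 2^-1 by rewrite ltNge; apply/negP; tauto.
  by nra.
have m12 : measurable (S1 `|` S2) by exact: measurableU.
have m34 : measurable (S3 `|` S4) by exact: measurableU.
have := pvm_subadditive E x _ _ m12 m34; rewrite -cov pvmT.
have := pvm_subadditive E x _ _ m1 m2; have := pvm_subadditive E x _ _ m3 m4; lra.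
Qed.

End Window.

(** * The spectrum of the inverse of a positive contraction *)

Section InverseSpectrum.
Context {R : realType} {V : completeNormedModType R[i]}.
Variable dot : {dot V for @conjc R}.
Hypothesis hn : hilbert_norm dot.
Local Notation C := (R[i]).
Local Notation nrm2 := (sqnrm dot).
Variable A : V -> V.
Hypothesis A_linear : linear A.
Hypothesis A_sym : forall x y, dot (A x) y = dot x (A y).
Hypothesis A_contr : forall x, nrm2 (A x) <= Re (dot (A x) x).
Hypothesis A_le : forall x, Re (dot (A x) x) <= nrm2 x.
Local Notation T := [set p : V * V | p.1 = A p.2].

(** Under the substitution [x = A w], the resolvent equation for the inverse of [A] becomes
    [(1 - l A) w = y]. *)
Lemma resolvent_inverse (l : C) : Re l < 1 -> resolvent_on setT T l.
Proof.
move=> l1.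
have AIm x : Im (dot (A x) x) = 0.
  by have := congr1 (@complex.Im R) (dotJ dot (A x) x); rewrite -A_sym ImJ => h; lra.
(* For [Re l >= 0] coercivity uses [<A x, x> <= |x|^2] and has constant [1 - Re l]; for [Re l < 0]
   it uses [<A x, x> >= 0] and has constant 1. *)
pose c := Num.min 1 (1 - Re l).
have c0 : 0 < c by rewrite /c lt_min ltr01 subr_gt0.
pose B x := x - l *: A x.
have BL : linear B.
  move=> a x y; rewrite /B A_linear !scalerDr scalerN !scalerA (mulrC l a).
  by rewrite opprD addrACA.
have q0 x : 0 <= Re (dot (A x) x) by exact: le_trans (nrm2_ge0 _ _) (A_contr x).
have coer x : c * nrm2 x <= Re (dot (B x) x).
  rewrite /B dotDl dotNl dotZl ReD ReN ReM AIm mulr0 subr0.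
  have := q0 x; have := A_le x; rewrite -/(nrm2 x).
  have : c <= 1 by rewrite /c ge_min lexx.
  have : c <= 1 - Re l by rewrite /c ge_min lexx orbT.
  have := nrm2_ge0 dot x.
  by case: (leP 0 (Re l)); nra.
have bnd x : nrm2 (B x) <= (2 + 2 * sqnorm l) * nrm2 x.
  have := parallelogram dot x (l *: A x); rewrite nrm2Z -/(B x).
  have := nrm2_ge0 dot (x + l *: A x); have := sqnorm_ge0 l.
  have := le_trans (A_contr x) (A_le x); nra.
split.
  move=> y _.
  have [|w Bw] := coercive_surj dot hn B c _ BL c0 _ coer bnd y.
    by have := sqnorm_ge0 l; lra.
  by exists (A w) => //=; rewrite -Bw /B subrK.
exists c^-1 => x y _ _ /= xE.
set w := y + l *: x in xE.
have Bw : B w = y by rewrite /B -xE /w addrK.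
have xw : nrm2 x <= nrm2 w by rewrite xE; exact: le_trans (A_contr w) (A_le w).
have wy : c ^+ 2 * nrm2 w <= nrm2 y.
  have h1 := dot_CS dot y w; have h2 := coer w; rewrite Bw in h2.
  have := nrm2_ge0 dot w; rewrite le_eqVlt => /orP[/eqP <-|n0].
    by rewrite mulr0 nrm2_ge0.
  have cn : 0 <= c * nrm2 w by rewrite mulr_ge0 ?ltW.
  rewrite -(ler_pM2r n0); apply: le_trans h1.
  rewrite -mulrA -expr2 -exprMn.
  by rewrite ler_pXn2r ?nnegrE// (le_trans cn).
rewrite !(normE dot hn) -rmorphM /= lecR.
rewrite -(ler_pXn2r (n := 2)) ?nnegrE ?mulr_ge0 ?sqrtr_ge0 ?invr_ge0 ?(ltW c0)//.
rewrite exprMn !sqr_sqrtr ?nrm2_ge0// exprVn ler_pdivlMl ?exprn_gt0//.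
by apply: le_trans wy; rewrite ler_pM2l ?exprn_gt0.
Qed.

Lemma spectrum_inverse1 :
  (forall e, 0 < e -> exists x, nrm2 x <= 1 /\ 1 - e < Re (dot (A x) x)) ->
  spectrum T 1.
Proof.
move=> apx [_ [c hc]].
(* Chosen for a contradiction: a bounded inverse would give [|A w|^2 <= c^2 e <= 1/8], whereas
   [<A w, w> > 1 - e >= 1/2] gives [|A w|^2 > 1/4]. *)
pose e := Num.min 2^-1 (8 * (c ^+ 2 + 1))^-1.
have c1 : 0 < c ^+ 2 + 1 by rewrite ltr_wpDl ?sqr_ge0.
have e0 : 0 < e by rewrite /e lt_min !invr_gt0 mulr_gt0 ?andbT.
have e1 : e <= 2^-1 by rewrite /e ge_min lexx.
have e2 : c ^+ 2 * e <= 8^-1.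
  have e2 : e <= (8 * (c ^+ 2 + 1))^-1 by rewrite /e ge_min lexx orbT.
  apply: (le_trans (ler_wpM2l (sqr_ge0 c) e2)).
  rewrite invfM mulrCA -[leRHS]mulr1 ler_pM2l ?invr_gt0//.
  by rewrite ler_pdivrMr// mul1r lerDl.
have [w [w1 qw]] := apx e e0.
have := hc (A w) (w - A w) I I; rewrite /= scale1r subrK => /(_ erefl).
rewrite !(normE dot hn) -rmorphM /= lecR.
set a := Num.sqrt _; set b := Num.sqrt _ => ab.
have a2 : a ^+ 2 = nrm2 (A w) by rewrite sqr_sqrtr// nrm2_ge0.
have b2 : b ^+ 2 = nrm2 (w - A w) by rewrite sqr_sqrtr// nrm2_ge0.
have ab2 : a ^+ 2 <= c ^+ 2 * b ^+ 2.
  have a0 : 0 <= a by exact: sqrtr_ge0.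
  by rewrite -exprMn ler_pXn2r ?nnegrE// (le_trans a0).
rewrite a2 b2 in ab2.
have h1 : nrm2 (w - A w) <= e.
  by rewrite nrm2B ReJdot; have := A_contr w; lra.
have h2 := dot_CS dot (A w) w.
have h3 := ler_wpM2l (sqr_ge0 c) h1.
have h4 := nrm2_ge0 dot (A w).
have h5 : Re (dot (A w) w) ^+ 2 <= nrm2 (A w).
  by apply: (le_trans h2); rewrite -[leRHS]mulr1 ler_wpM2l.
by nra.
Qed.

Lemma inf_spectrum_inverse :
  (forall e, 0 < e -> exists x, nrm2 x <= 1 /\ 1 - e < Re (dot (A x) x)) ->
  inf [set Re z | z in spectrum T] = 1.
Proof.
move=> /spectrum_inverse1 s1; apply/le_anti/andP; split.
  apply: ge_inf; last by exists 1.
  exists 1 => _ [z sz <-]; rewrite leNgt; apply/negP => /resolvent_inverse.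
  exact: sz.
apply: lb_le_inf; first by exists 1, 1.
move=> _ [z sz <-]; rewrite leNgt; apply/negP => /resolvent_inverse.
exact: sz.
Qed.

End InverseSpectrum.

(** * Square-integrable functions *)

Section L2Algebra.
Context {R : realType}.
Local Notation C := (R[i]).
Local Notation leb := (@lebesgue_measure R).
Local Notation L2 := (@L2 R).
Implicit Types f g h : R -> C.

Lemma leb_aeS (P Q : R -> Prop) : (forall x, P x -> Q x) ->
  {ae leb, forall x, P x} -> {ae leb, forall x, Q x}.
Proof. by move=> PQ; apply: filterS; first exact: (ae_filter_ringOfSetsType leb). Qed.

Lemma leb_aeS2 (P Q S : R -> Prop) : (forall x, P x -> Q x -> S x) ->
  {ae leb, forall x, P x} -> {ae leb, forall x, Q x} -> {ae leb, forall x, S x}.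
Proof. by move=> PQ; apply: filterS2; first exact: (ae_filter_ringOfSetsType leb). Qed.

Definition L2sq f : R := \int[leb]_s sqnorm (f s).

Lemma measurable_sqnorm f : cmeasurable f ->
  measurable_fun setT (fun s => sqnorm (f s)).
Proof. by move=> [mr mi]; apply: measurable_funD; exact: measurable_funX. Qed.

Lemma sqnormD_le (z w : C) : sqnorm (z + w) <= 2 * sqnorm z + 2 * sqnorm w.
Proof.
rewrite /sqnorm !ReImE.
have := sqr_ge0 (Re z - Re w); have := sqr_ge0 (Im z - Im w); nra.
Qed.

Lemma cmeasurable_comb (a : C) f g : cmeasurable f -> cmeasurable g ->
  cmeasurable (a *: f + g).
Proof.
move=> [fr fi] [gr gi]; split.
  rewrite (_ : (fun s => _) = (fun s => (Re a * Re (f s) - Im a * Im (f s)) + Re (g s))).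
    apply: measurable_funD => //; apply: measurable_funB.
      by apply: measurable_funM.
    by apply: measurable_funM.
  by apply/funext => s; rewrite !fctE !ReImE.
rewrite (_ : (fun s => _) = (fun s => (Re a * Im (f s) + Im a * Re (f s)) + Im (g s))).
  apply: measurable_funD => //; apply: measurable_funD.
    by apply: measurable_funM.
  by apply: measurable_funM.
by apply/funext => s; rewrite !fctE !ReImE.
Qed.

Lemma L2_sq_integrable f : L2 f -> leb.-integrable setT (EFin \o (fun s => sqnorm (f s))).
Proof.
move=> [mf ff]; apply/integrableP; split.
  by apply/measurable_EFinP; exact: measurable_sqnorm.
by under eq_integral do rewrite /= ger0_norm ?sqnorm_ge0//.
Qed.

Lemma L2_comb (a : C) f g : L2 f -> L2 g -> L2 (a *: f + g).
Proof.
move=> Lf Lg; have [mf _] := Lf; have [mg _] := Lg.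
split; first exact: cmeasurable_comb.
have fi := L2_sq_integrable _ Lf; have gi := L2_sq_integrable _ Lg.
have hi : leb.-integrable setT
    (EFin \o (fun s => (2 * sqnorm a) * sqnorm (f s) + 2 * sqnorm (g s))).
  have h1 := integrableZl measurableT (2 * sqnorm a) fi.
  have h2 := integrableZl measurableT 2 gi.
  by have := integrableD measurableT h1 h2; apply: eq_integrable.
apply: le_lt_trans (integrable_lty measurableT hi).
apply: ge0_le_integral => //.
- by move=> s _; rewrite lee_fin sqnorm_ge0.
- by apply/measurable_EFinP; apply: measurable_sqnorm; exact: cmeasurable_comb.
- exact: measurable_int hi.
- move=> s _; rewrite /= lee_fin !fctE; apply: le_trans (sqnormD_le _ _) _.
  by rewrite sqnormM mulrA.
Qed.

Lemma L2_0 : L2 0.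
Proof.
split.
  by split; rewrite (_ : (fun=> _) = (fun=> 0)).
rewrite integral0_eq// => s _; rewrite (_ : (0 : R -> C) s = 0)//.
by rewrite /sqnorm /= expr0n addr0.
Qed.

Lemma L2D f g : L2 f -> L2 g -> L2 (f + g).
Proof. by move=> Lf Lg; rewrite -[f]scale1r; exact: L2_comb. Qed.

Lemma L2Z a f : L2 f -> L2 (a *: f).
Proof. by move=> Lf; rewrite -[a *: f]addr0; apply: L2_comb => //; exact: L2_0. Qed.

Lemma L2N f : L2 f -> L2 (- f).
Proof. by move=> Lf; rewrite -scaleN1r; exact: L2Z. Qed.

Lemma L2B f g : L2 f -> L2 g -> L2 (f - g).
Proof. by move=> Lf Lg; apply: L2D => //; exact: L2N. Qed.

Lemma cmeasurable_mulJ f g : cmeasurable f -> cmeasurable g ->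
  cmeasurable (fun s => f s * conjc (g s)).
Proof.
move=> [fr fi] [gr gi]; split.
  rewrite (_ : (fun s => _) = (fun s => Re (f s) * Re (g s) + Im (f s) * Im (g s))).
    by apply: measurable_funD; exact: measurable_funM.
  by apply/funext => s; rewrite !ReImE; ring.
rewrite (_ : (fun s => _) = (fun s => Im (f s) * Re (g s) - Re (f s) * Im (g s))).
  by apply: measurable_funB; exact: measurable_funM.
by apply/funext => s; rewrite !ReImE; ring.
Qed.

Lemma mulJ_bound (z w : C) : `|Re (z * conjc w)| <= sqnorm z + sqnorm w /\
  `|Im (z * conjc w)| <= sqnorm z + sqnorm w.
Proof.
rewrite /sqnorm !ReImE; move: (Re z) (Im z) (Re w) (Im w) => a b c d.
have := sqr_ge0 (a - c); have := sqr_ge0 (a + c); have := sqr_ge0 (b - d).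
have := sqr_ge0 (b + d); have := sqr_ge0 (a - d); have := sqr_ge0 (a + d).
have := sqr_ge0 (b - c); have := sqr_ge0 (b + c).
have := sqr_ge0 a; have := sqr_ge0 b; have := sqr_ge0 c; have := sqr_ge0 d.
by move=> *; split; rewrite ler_norml; apply/andP; split; nra.
Qed.

Lemma L2_dot_integrable f g : L2 f -> L2 g ->
  leb.-integrable setT (EFin \o (fun s => Re (f s * conjc (g s)))) /\
  leb.-integrable setT (EFin \o (fun s => Im (f s * conjc (g s)))).
Proof.
move=> Lf Lg; have [mf _] := Lf; have [mg _] := Lg.
have fi := L2_sq_integrable _ Lf; have gi := L2_sq_integrable _ Lg.
have [m1 m2] := cmeasurable_mulJ _ _ mf mg.
have hi := integrableD measurableT fi gi.
split.
  apply: le_integrable hi => //; first exact/measurable_EFinP.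
  move=> s _; rewrite /= lee_fin [leRHS](ger0_norm (addr_ge0 (sqnorm_ge0 _) (sqnorm_ge0 _))).
  exact: (mulJ_bound _ _).1.
apply: le_integrable hi => //; first exact/measurable_EFinP.
move=> s _; rewrite /= lee_fin [leRHS](ger0_norm (addr_ge0 (sqnorm_ge0 _) (sqnorm_ge0 _))).
exact: (mulJ_bound _ _).2.
Qed.

Lemma L2dot_comb (a : C) f g h : L2 f -> L2 g -> L2 h ->
  L2dot (a *: f + g) h = a * L2dot f h + L2dot g h.
Proof.
move=> Lf Lg Lh.
have [r1 i1] := L2_dot_integrable _ _ Lf Lh; have [r2 i2] := L2_dot_integrable _ _ Lg Lh.
have Z (x : R) (p : R -> R) : leb.-integrable setT (EFin \o p) ->
    leb.-integrable setT (EFin \o (fun s => x * p s)).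
  by move=> pi; have := integrableZl measurableT x pi; apply: eq_integrable.
have S (p q : R -> R) : leb.-integrable setT (EFin \o p) ->
    leb.-integrable setT (EFin \o q) ->
    leb.-integrable setT (EFin \o (fun s => p s + q s)).
  by move=> pi qi; have := integrableD measurableT pi qi; apply: eq_integrable.
apply: complex_ext; rewrite ?ReD ?ImD ?ReM ?ImM /L2dot /cintegral /=.
  rewrite -mulNr -!RintegralZl// -!RintegralD//; try (by repeat apply: S; repeat apply: Z).
  by apply: eq_Rintegral => s _; rewrite !fctE !ReImE; ring.
rewrite -!RintegralZl// -!RintegralD//; try (by repeat apply: S; repeat apply: Z).
by apply: eq_Rintegral => s _; rewrite !fctE !ReImE; ring.
Qed.

Lemma L2dotJ f g : L2 f -> L2 g -> L2dot g f = conjc (L2dot f g).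
Proof.
move=> Lf Lg; have [_ i1] := L2_dot_integrable _ _ Lf Lg.
apply: complex_ext; rewrite ?ReJ ?ImJ /L2dot /cintegral /=.
  by apply: eq_Rintegral => s _; rewrite !ReImE; ring.
rewrite -mulN1r -RintegralZl//.
by apply: eq_Rintegral => s _; rewrite !ReImE; ring.
Qed.

Lemma L2dotff f : L2dot f f = (L2sq f)%:C.
Proof.
apply: complex_ext; rewrite /L2dot /cintegral /=.
  by apply: eq_Rintegral => s _; rewrite !ReImE /sqnorm; ring.
transitivity (\int[leb]_s (0 : R)); last by rewrite Rintegral_cst ?mul0r.
by apply: eq_Rintegral => s _; rewrite !ReImE /=; ring.
Qed.

Lemma L2normE f : L2norm f = Num.sqrt (L2sq f).
Proof. by rewrite /L2norm L2dotff. Qed.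

Lemma L2sq_ge0 f : 0 <= L2sq f.
Proof. by apply: Rintegral_ge0 => s _; exact: sqnorm_ge0. Qed.

Lemma L2dot0l h : L2dot 0 h = 0.
Proof.
have z : \int[leb]_s (0 : R) = 0 by rewrite Rintegral_cst ?mul0r.
by apply: complex_ext; rewrite /L2dot /cintegral /= -[RHS]z;
  apply: eq_Rintegral => s _; rewrite (_ : (0 : R -> C) s = 0)// mul0r.
Qed.

Definition rdot f g : R := Re (L2dot f g).

Lemma rdotff f : rdot f f = L2sq f. Proof. by rewrite /rdot L2dotff. Qed.

Lemma rdotC f g : L2 f -> L2 g -> rdot g f = rdot f g.
Proof. by move=> Lf Lg; rewrite /rdot (L2dotJ f g)// ReJ. Qed.

Lemma rdotDl f g h : L2 f -> L2 g -> L2 h -> rdot (f + g) h = rdot f h + rdot g h.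
Proof.
by move=> Lf Lg Lh; rewrite /rdot -[f]scale1r L2dot_comb// mul1r scale1r ReD.
Qed.

Lemma rdotNl f h : L2 f -> L2 h -> rdot (- f) h = - rdot f h.
Proof.
move=> Lf Lh; rewrite /rdot -[- f]addr0 -scaleN1r L2dot_comb//; last exact: L2_0.
by rewrite L2dot0l addr0 mulN1r ReN.
Qed.

Lemma rdotBl f g h : L2 f -> L2 g -> L2 h -> rdot (f - g) h = rdot f h - rdot g h.
Proof. by move=> Lf Lg Lh; rewrite rdotDl ?rdotNl//; exact: L2N. Qed.

Lemma L2sqD f g : L2 f -> L2 g -> L2sq (f + g) = L2sq f + L2sq g + 2 * rdot f g.
Proof.
move=> Lf Lg; have LD := L2D _ _ Lf Lg.
rewrite -rdotff rdotDl// rdotC// rdotDl// (rdotC (f + g) g)// rdotDl//.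
rewrite (rdotC f g)// !rdotff; ring.
Qed.

Lemma L2sqB f g : L2 f -> L2 g -> L2sq (f - g) = L2sq f + L2sq g - 2 * rdot f g.
Proof.
move=> Lf Lg; rewrite L2sqD//; last exact: L2N.
have LN := L2N _ Lg; rewrite (rdotC (- g) f)// rdotNl// (rdotC f g)//.
have -> : L2sq (- g) = L2sq g; last by ring.
by apply: eq_Rintegral => s _; rewrite /sqnorm !fctE !ReImE !sqrrN.
Qed.

Lemma L2_CS f g : L2 f -> L2 g -> rdot f g ^+ 2 <= L2sq f * L2sq g.
Proof.
move=> Lf Lg; apply: discriminant => [|t]; first exact: L2sq_ge0.
have := L2sq_ge0 (f + t%:C *: g); have Lt := L2Z t%:C _ Lg.
rewrite L2sqD// (rdotC (t%:C *: g) f)//.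
have -> : rdot (t%:C *: g) f = t * rdot f g.
  rewrite -(rdotC f g)//.
  rewrite /rdot -[t%:C *: g]addr0 L2dot_comb//; last exact: L2_0.
  by rewrite L2dot0l addr0 ReM /= mul0r subr0.
have -> : L2sq (t%:C *: g) = t ^+ 2 * L2sq g.
  rewrite /L2sq -RintegralZl//; last exact: L2_sq_integrable.
  by apply: eq_Rintegral => s _; rewrite !fctE sqnormM /sqnorm /= expr0n addr0.
by congr (_ <= _); ring.
Qed.

Lemma rdot_amgm f g t : 0 < t -> L2 f -> L2 g ->
  2 * rdot f g <= t * L2sq f + L2sq g / t.
Proof. by move=> t0 Lf Lg; apply: sqr_le_amgm; rewrite ?L2sq_ge0 ?L2_CS. Qed.

Lemma L2dot_aeql f g h : cmeasurable f -> cmeasurable g -> cmeasurable h ->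
  aeq f g -> L2dot f h = L2dot g h.
Proof.
move=> mf mg mh fg; have [r1 i1] := cmeasurable_mulJ _ _ mf mh.
have [r2 i2] := cmeasurable_mulJ _ _ mg mh.
rewrite /L2dot /cintegral /Rintegral; congr (fine _ +i* fine _).
  apply: ae_eq_integral => //; try exact/measurable_EFinP.
  by move: fg; apply: leb_aeS => s -> _.
apply: ae_eq_integral => //; try exact/measurable_EFinP.
by move: fg; apply: leb_aeS => s -> _.
Qed.

Lemma L2sq_eq0 f : L2 f -> L2sq f = 0 -> aeq f 0.
Proof.
move=> Lf f0; have fi := L2_sq_integrable _ Lf.
have : (\int[leb]_s (sqnorm (f s))%:E = 0)%E.
  have fin : (\int[leb]_s (sqnorm (f s))%:E)%E \is a fin_num by exact: integrable_fin_num.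
  by rewrite -(fineK fin) -[fine _]/(L2sq f) f0.
have e : (\int[leb]_s `|(EFin \o (fun s => sqnorm (f s))) s|)%E =
         (\int[leb]_s (sqnorm (f s))%:E)%E.
  by apply: eq_integral => s _ /=; rewrite ger0_norm ?sqnorm_ge0.
rewrite -e => /(ae_eq_integral_abs _ measurableT (measurable_int _ fi)).
by apply: leb_aeS => s /(_ I) /= [] /sqnorm_eq0.
Qed.

End L2Algebra.

(** * Goursat's theorem on rectangles and strips *)

Section RectangleFunction.
Context {R : realType}.
Variables (W : R -> R -> R -> R -> R) (a b c d : R).
Hypothesis ab : a <= b.
Hypothesis cd : c <= d.
Hypothesis W_splitx : forall x1 x2 x3 y1 y2,
  a <= x1 -> x1 <= x2 -> x2 <= x3 -> x3 <= b -> c <= y1 -> y1 <= y2 -> y2 <= d ->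
  W x1 x3 y1 y2 = W x1 x2 y1 y2 + W x2 x3 y1 y2.
Hypothesis W_splity : forall x1 x2 y1 y2 y3,
  a <= x1 -> x1 <= x2 -> x2 <= b -> c <= y1 -> y1 <= y2 -> y2 <= y3 -> y3 <= d ->
  W x1 x2 y1 y3 = W x1 x2 y1 y2 + W x1 x2 y2 y3.
Hypothesis W_local : forall x y, a <= x -> x <= b -> c <= y -> y <= d ->
  forall e, 0 < e -> exists2 del, 0 < del & forall x1 x2 y1 y2,
    a <= x1 -> x1 <= x -> x <= x2 -> x2 <= b ->
    c <= y1 -> y1 <= y -> y <= y2 -> y2 <= d ->
    x2 - x1 < del -> y2 - y1 < del ->
    `|W x1 x2 y1 y2| <= e * ((x2 - x1) + (y2 - y1)) ^+ 2.

Let A := b - a.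
Let B := d - c.
Let A0 : 0 <= A. Proof. by rewrite subr_ge0. Qed.
Let B0 : 0 <= B. Proof. by rewrite subr_ge0. Qed.
Let h (n : nat) : R := 2^-1 ^+ n.
Let h_ge0 n : 0 <= h n. Proof. by rewrite exprn_ge0. Qed.
Let hS n : h n = 2 * h n.+1. Proof. by rewrite /h exprS; field. Qed.
Let inside (n : nat) (p : R * R) := [/\ a <= p.1, p.1 + A * h n <= b,
  c <= p.2 & p.2 + B * h n <= d].
Let cell n (p : R * R) := W p.1 (p.1 + A * h n) p.2 (p.2 + B * h n).

(** The condition [inside n p] sits under the existential quantifier so that [choice] yields a step
    function defined on all pairs. *)
Let bisect n p : exists p' : R * R, inside n p ->
  [/\ inside n.+1 p', `|cell n p| <= 4 * `|cell n.+1 p'|,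
      p.1 <= p'.1, p'.1 + A * h n.+1 <= p.1 + A * h n &
      p.2 <= p'.2 /\ p'.2 + B * h n.+1 <= p.2 + B * h n].
Proof.
have [ins|] := pselect (inside n p); last by exists p.
have [i1 i2 i3 i4] := ins.
have Ah : 0 <= A * h n.+1 by rewrite mulr_ge0.
have Bh : 0 <= B * h n.+1 by rewrite mulr_ge0.
rewrite (hS n) in i2 i4 *; set u := A * h n.+1 in i2 i4 Ah *.
set v := B * h n.+1 in i2 i4 Bh *.
have eA : A * (2 * h n.+1) = u + u by rewrite /u; ring.
have eB : B * (2 * h n.+1) = v + v by rewrite /v; ring.
rewrite eA eB in i2 i4 *.
have e : cell n p = (cell n.+1 p + cell n.+1 (p.1, p.2 + v)) +
   (cell n.+1 (p.1 + u, p.2) + cell n.+1 (p.1 + u, p.2 + v)).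
  rewrite /cell (hS n) eA eB /= -/u -/v.
  rewrite (W_splitx p.1 (p.1 + u)); try lra.
  rewrite (W_splity _ _ p.2 (p.2 + v)); try lra.
  rewrite (W_splity (p.1 + u) _ p.2 (p.2 + v)); try lra.
  by rewrite !addrA.
apply: contrapT => /forallNP H.
have small q : inside n.+1 q -> p.1 <= q.1 -> q.1 + u <= p.1 + (u + u) ->
   p.2 <= q.2 -> q.2 + v <= p.2 + (v + v) -> 4 * `|cell n.+1 q| < `|cell n p|.
  move=> q1 q2 q3 q4 q5; rewrite ltNge; apply/negP => q6.
  by apply: (H q) => _; split.
have s1 : 4 * `|cell n.+1 p| < `|cell n p|.
  by apply: small; rewrite /inside -/u -/v; try split; lra.
have s2 : 4 * `|cell n.+1 (p.1, p.2 + v)| < `|cell n p|.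
  by apply: small; rewrite /inside /= -/u -/v; try split; lra.
have s3 : 4 * `|cell n.+1 (p.1 + u, p.2)| < `|cell n p|.
  by apply: small; rewrite /inside /= -/u -/v; try split; lra.
have s4 : 4 * `|cell n.+1 (p.1 + u, p.2 + v)| < `|cell n p|.
  by apply: small; rewrite /inside /= -/u -/v; try split; lra.
have := ler_normD (cell n.+1 p + cell n.+1 (p.1, p.2 + v))
  (cell n.+1 (p.1 + u, p.2) + cell n.+1 (p.1 + u, p.2 + v)).
have := ler_normD (cell n.+1 p) (cell n.+1 (p.1, p.2 + v)).
have := ler_normD (cell n.+1 (p.1 + u, p.2)) (cell n.+1 (p.1 + u, p.2 + v)).
rewrite -e; lra.
Qed.

Let nested (x : nat -> R) (l : R) : 0 <= l -> (forall n, x n <= x n.+1) ->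
  (forall n, x n.+1 + l * h n.+1 <= x n + l * h n) ->
  exists z, forall n, x n <= z /\ z <= x n + l * h n.
Proof.
move=> l0 xS yS.
have xm n k : x n <= x (n + k)%N.
  by elim: k => [|k IH]; rewrite ?addn0// addnS (le_trans IH).
have ym n k : x (n + k)%N + l * h (n + k) <= x n + l * h n.
  by elim: k => [|k IH]; rewrite ?addn0// addnS (le_trans (yS _)).
have ub n m : x m <= x n + l * h n.
  apply: (le_trans (xm m n)); rewrite addnC; apply: le_trans (ym n m).
  by rewrite lerDl mulr_ge0.
have hs : has_sup (range x).
  by split; [exists (x 0%N), 0%N|exists (x 0%N + l * h 0%N) => _ [m _ <-]].
exists (sup (range x)) => n; split.
  by apply: ub_le_sup; [case: hs|exists n].
by apply: sup_le_ub; [case: hs|move=> _ [m _ <-]].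
Qed.

(** Goursat's bisection, free of integrals. Some quarter always keeps at least a quarter of the
    value, so after [n] steps at most a factor [4 ^+ n] is lost. The nested cells shrink to a point,
    and near it the bound [W_local], quadratic in the side lengths, gains exactly [4 ^- n] times an
    arbitrary [e]. *)
Lemma rectangle_function_eq0 : W a b c d = 0.
Proof.
have [step hstep] := choice (fun np : nat * (R * R) => bisect np.1 np.2).
pose p := fix p n := if n is m.+1 then step (m, p m) else (a, c).
have ins n : inside n (p n).
  elim: n => [|n IH]; last by have [] := hstep (n, p n) IH.
  by rewrite /inside /= /h expr0 /A /B; split; lra.
have H n := hstep (n, p n) (ins n).
have pn n : `|W a b c d| <= 4 ^+ n * `|cell n (p n)|.
  elim: n => [|n IH].
    rewrite /cell /= /h !expr0 /A /B !mulr1 mul1r.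
    by rewrite (addrC a) subrK (addrC c) subrK.
  apply: (le_trans IH); rewrite exprSr -mulrA ler_pM2l ?exprn_gt0//.
  by have [] := H n.
have [x hx] : exists z, forall n, (p n).1 <= z /\ z <= (p n).1 + A * h n.
  by apply: nested => // n; have [] := H n.
have [y hy] : exists z, forall n, (p n).2 <= z /\ z <= (p n).2 + B * h n.
  by apply: nested => // n; have [_ _ _ _ []] := H n.
have [ax xb cy yd] : [/\ a <= x, x <= b, c <= y & y <= d].
  have [i1 i2 i3 i4] := ins 0%N.
  have [x1 x2] := hx 0%N; have [y1 y2] := hy 0%N.
  split; [exact: le_trans x1|exact: le_trans x2 i2|exact: le_trans y1|exact: le_trans y2 i4].
have key e : 0 < e -> `|W a b c d| <= e * (A + B) ^+ 2.
  move=> e0; have [del del0 hd] := W_local x y ax xb cy yd e e0.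
  have [n hn] : exists n, (A + B + 1) * h n < del.
    have AB : 0 < A + B + 1 by rewrite ltr_wpDl// addr_ge0.
    have : h n @[n --> \oo] --> (0 : R).
      by apply: cvg_expr; rewrite ger0_norm// invf_lt1// ltr1n.
    move/cvgrPdist_lt => /(_ _ (divr_gt0 del0 AB)) [n _ hn].
    exists n; have := hn n (leqnn n).
    by rewrite /= sub0r normrN ger0_norm// ltr_pdivlMr// mulrC.
  have [i1 i2 i3 i4] := ins n; have [x1 x2] := hx n; have [y1 y2] := hy n.
  have hA : A * h n <= (A + B + 1) * h n.
    by rewrite ler_wpM2r// -addrA lerDl addr_ge0.
  have hB : B * h n <= (A + B + 1) * h n.
    by rewrite ler_wpM2r// addrAC lerDr addr_ge0.
  apply: (le_trans (pn n)).
  have := hd (p n).1 ((p n).1 + A * h n) (p n).2 ((p n).2 + B * h n).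
  rewrite !(addrAC _ (_ * _)) !subrr !add0r -/(cell n (p n)).
  move=> /(_ i1 x1 x2 i2 i3 y1 y2 i4 (le_lt_trans hA hn) (le_lt_trans hB hn)) hc.
  have f4 : 0 < (4 : R) ^+ n by rewrite exprn_gt0.
  rewrite -(ler_pM2l f4) in hc; apply: (le_trans hc).
  have h2 : h n ^+ 2 = (4 ^+ n)^-1.
    by rewrite /h -exprM mulnC exprM -exprVn; congr (_ ^+ _); field.
  rewrite -mulrDl exprMn h2; move: f4; set X := 4 ^+ n => X0.
  by rewrite le_eqVlt; apply/orP; left; apply/eqP; field; rewrite gt_eqF.
apply/eqP; rewrite -normr_le0; apply/ler_addgt0Pr => e e0.
have AB : 0 < (A + B) ^+ 2 + 1 by rewrite ltr_wpDl ?sqr_ge0.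
apply: (le_trans (key _ (divr_gt0 e0 AB))).
rewrite add0r mulrAC ler_pdivrMr// ler_pM2l//; lra.
Qed.

End RectangleFunction.

Section Goursat.
Context {R : realType}.
Local Notation leb := (@lebesgue_measure R).

(** Continuity is two-sided even at the endpoints: [closed_form_at] controls a full neighbourhood of
    each point. *)
Definition continuous_on (f : R -> R) (a b : R) : Prop :=
  forall x, a <= x -> x <= b -> {for x, continuous f}.

Lemma continuous_on_integrable (f : R -> R) a b : continuous_on f a b ->
  leb.-integrable `[a, b] (EFin \o f).
Proof.
move=> cf; apply: continuous_compact_integrable; first exact: segment_compact.
apply: continuous_in_subspaceT => x; rewrite inE /= in_itv /= => /andP[ax xb].
exact: cf.
Qed.

Lemma continuous_onB (f g : R -> R) a b : continuous_on f a b ->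
  continuous_on g a b -> continuous_on (fun x => f x - g x) a b.
Proof. by move=> cf cg x ax xb; apply: continuousB; [exact: cf|exact: cg]. Qed.

Lemma seg_split (f : R -> R) a m b : a <= m -> m <= b -> continuous_on f a b ->
  \int[leb]_(x in `[a, b]) f x =
  \int[leb]_(x in `[a, m]) f x + \int[leb]_(x in `[m, b]) f x.
Proof.
move=> am mb cf; have fi := continuous_on_integrable _ _ _ cf.
apply/eqP; rewrite addrC -subr_eq; apply/eqP.
rewrite (@Rintegral_itvB _ f (BLeft a) (BRight b) m fi)//.
apply: Rintegral_itv_obnd_cbnd; apply: integrableS fi => //.
by apply: subset_itv; rewrite bnd_simp.
Qed.

Lemma leb_seg (a b : R) : a <= b -> fine (leb `[a, b]%classic) = b - a.
Proof.
move=> ab; rewrite lebesgue_measure_itv /= lte_fin.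
case: ltP => // ba; have -> : a = b by apply/le_anti; rewrite ab ba.
by rewrite subrr.
Qed.

Lemma seg_bound (f : R -> R) a b k M : a <= b -> continuous_on f a b ->
  (forall x, a <= x -> x <= b -> `|f x - k| <= M) ->
  `|\int[leb]_(x in `[a, b]) f x - k * (b - a)| <= M * (b - a).
Proof.
move=> ab cf fM; have fi := continuous_on_integrable _ _ _ cf.
have ci r : leb.-integrable `[a, b] (EFin \o (fun=> r)).
  by apply: continuous_on_integrable => x _ _; exact: cvg_cst.
have lo : \int[leb]_(x in `[a, b]) (k - M) <= \int[leb]_(x in `[a, b]) f x.
  apply: le_Rintegral => // x; rewrite /= in_itv /= => /andP[ax xb].
  by have := fM x ax xb; rewrite ler_norml => /andP[]; lra.
have hi : \int[leb]_(x in `[a, b]) f x <= \int[leb]_(x in `[a, b]) (k + M).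
  apply: le_Rintegral => // x; rewrite /= in_itv /= => /andP[ax xb].
  by have := fM x ax xb; rewrite ler_norml => /andP[]; lra.
move: lo hi; rewrite !Rintegral_cst// leb_seg//.
move: (Rintegral _ _ _) => I lo hi.
by rewrite ler_norml; apply/andP; split; lra.
Qed.

(* [P dx + Q dy] is differentiable at the point, with [Q_x = P_y] there. *)
Definition closed_form_at (P Q : R -> R -> R) (x0 y0 : R) : Prop :=
  exists al be ga : R, forall e, 0 < e -> exists2 del, 0 < del &
    forall x y, `|x - x0| < del -> `|y - y0| < del ->
    `|P x y - P x0 y0 - (al * (x - x0) + be * (y - y0))|
      <= e * (`|x - x0| + `|y - y0|) /\
    `|Q x y - Q x0 y0 - (be * (x - x0) + ga * (y - y0))|
      <= e * (`|x - x0| + `|y - y0|).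

Lemma affine_continuous (f : R -> R) x0 k : (exists2 del, 0 < del &
    forall x, `|x - x0| < del -> `|f x - f x0 - k * (x - x0)| <= `|x - x0|) ->
  {for x0, continuous f}.
Proof.
move=> [del del0 h]; apply/cvgrPdist_le => e e0.
have k0 : 0 < `|k| + 1 by rewrite ltr_wpDl.
apply/nbhs_ballP; exists (Num.min del (e / (`|k| + 1))) => /=.
  by rewrite lt_min del0 divr_gt0.
move=> x; rewrite /ball /= distrC lt_min ltr_pdivlMr// => /andP[xd xe].
have h1 := h x xd; rewrite distrC.
have -> : f x - f x0 = (f x - f x0 - k * (x - x0)) + k * (x - x0) by ring.
apply: (le_trans (ler_normD _ _)); rewrite normrM; apply: le_trans (ltW xe).
by rewrite [leRHS]mulrDr mulr1 [leRHS]addrC lerD// [leRHS]mulrC.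
Qed.

(** For the local estimate, the first-order parts of [P] and [Q] contribute [- be * X * Y] and
    [be * X * Y] on a rectangle with sides [X] and [Y]. They cancel because [closed_form_at] uses
    the same [be] for both, and only the remainders are left. *)
Lemma goursat (P Q : R -> R -> R) a b c d : a <= b -> c <= d ->
  (forall x y, a <= x -> x <= b -> c <= y -> y <= d -> closed_form_at P Q x y) ->
  \int[leb]_(x in `[a, b]) (P x c - P x d) +
  \int[leb]_(y in `[c, d]) (Q b y - Q a y) = 0.
Proof.
move=> ab cd hPQ.
have cP y x1 x2 : a <= x1 -> x2 <= b -> c <= y -> y <= d -> continuous_on (P^~ y) x1 x2.
  move=> ax xb cy yd x x1x xx2.
  have [||||al [be [ga h]]] := hPQ x y; rewrite ?(le_trans ax)// ?(le_trans xx2)//.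
  apply: (@affine_continuous _ x al); have [del del0 hd] := h 1 ltr01.
  exists del => // t tx.
  have yd' : `|y - y| < del by rewrite subrr normr0.
  have [+ _] := hd t y tx yd'.
  by rewrite subrr normr0 mulr0 !addr0 mul1r.
have cQ x y1 y2 : c <= y1 -> y2 <= d -> a <= x -> x <= b -> continuous_on (Q x) y1 y2.
  move=> cy yd ax xb y y1y yy2.
  have [||||al [be [ga h]]] := hPQ x y; rewrite ?(le_trans cy)// ?(le_trans yy2)//.
  apply: (@affine_continuous _ y ga); have [del del0 hd] := h 1 ltr01.
  exists del => // t ty.
  have xd : `|x - x| < del by rewrite subrr normr0.
  have [_] := hd x t xd ty.
  by rewrite subrr normr0 mulr0 !add0r mul1r.
pose W x1 x2 y1 y2 := \int[leb]_(x in `[x1, x2]) (P x y1 - P x y2) +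
  \int[leb]_(y in `[y1, y2]) (Q x2 y - Q x1 y).
apply: (@rectangle_function_eq0 R W a b c d ab cd).
- move=> x1 x2 x3 y1 y2 ax x12 x23 xb cy y12 yd; rewrite /W.
  have c1 : c <= y2 by lra. have c2 : y1 <= d by lra.
  have a2 : a <= x2 by lra. have b2 : x2 <= b by lra. have a3 : a <= x3 by lra.
  have b1 : x1 <= b by lra.
  rewrite (@seg_split _ x1 x2 x3)//; last by apply: continuous_onB; exact: cP.
  have -> : \int[leb]_(y in `[y1, y2]) (Q x3 y - Q x1 y) =
      \int[leb]_(y in `[y1, y2]) (Q x2 y - Q x1 y) +
      \int[leb]_(y in `[y1, y2]) (Q x3 y - Q x2 y).
    rewrite -RintegralD//; last 2 first.
      by apply: continuous_on_integrable; apply: continuous_onB; exact: cQ.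
      by apply: continuous_on_integrable; apply: continuous_onB; exact: cQ.
    by apply: eq_Rintegral => y _; ring.
  by rewrite addrACA.
- move=> x1 x2 y1 y2 y3 ax x12 xb cy y12 y23 yd; rewrite /W.
  have c2 : c <= y2 by lra. have c3 : c <= y3 by lra.
  have d1 : y1 <= d by lra. have d2 : y2 <= d by lra.
  have a2 : a <= x2 by lra. have b1 : x1 <= b by lra.
  rewrite (@seg_split _ y1 y2 y3)//; last by apply: continuous_onB; exact: cQ.
  have -> : \int[leb]_(x in `[x1, x2]) (P x y1 - P x y3) =
      \int[leb]_(x in `[x1, x2]) (P x y1 - P x y2) +
      \int[leb]_(x in `[x1, x2]) (P x y2 - P x y3).
    rewrite -RintegralD//; last 2 first.
      by apply: continuous_on_integrable; apply: continuous_onB; exact: cP.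
      by apply: continuous_on_integrable; apply: continuous_onB; exact: cP.
    by apply: eq_Rintegral => x _; ring.
  by rewrite addrACA.
- move=> x y ax xb cy yd e e0.
  have [al [be [ga h]]] := hPQ x y ax xb cy yd.
  have [del del0 hd] := h (e / 2) (divr_gt0 e0 (ltr0n _ 2)).
  exists del => // x1 x2 y1 y2 ax1 x1x xx2 x2b cy1 y1y yy2 y2d dx dy.
  set X := x2 - x1 in dx *; set Y := y2 - y1 in dy *.
  have near1 t : x1 <= t -> t <= x2 -> `|t - x| <= X.
    by move=> *; rewrite ler_norml; apply/andP; split; rewrite /X; lra.
  have near2 t : y1 <= t -> t <= y2 -> `|t - y| <= Y.
    by move=> *; rewrite ler_norml; apply/andP; split; rewrite /Y; lra.
  have app s t : x1 <= s -> s <= x2 -> y1 <= t -> t <= y2 ->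
      `|P s t - P x y - (al * (s - x) + be * (t - y))| <= e / 2 * (X + Y) /\
      `|Q s t - Q x y - (be * (s - x) + ga * (t - y))| <= e / 2 * (X + Y).
    move=> h1 h2 h3 h4; have n1 := near1 s h1 h2; have n2 := near2 t h3 h4.
    have [g1 g2] := hd s t (le_lt_trans n1 dx) (le_lt_trans n2 dy).
    have m : e / 2 * (`|s - x| + `|t - y|) <= e / 2 * (X + Y).
      by rewrite ler_pM2l ?divr_gt0// lerD.
    by split; [exact: le_trans g1 m|exact: le_trans g2 m].
  have x12 : x1 <= x2 by lra. have y12 : y1 <= y2 by lra.
  have b1 : `|\int[leb]_(x in `[x1, x2]) (P x y1 - P x y2) - (be * (y1 - y2)) * X|
      <= e * (X + Y) * X.
    apply: seg_bound => //; first by apply: continuous_onB; apply: cP => //; lra.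
    move=> t h1 h2.
    have [+ _] := app t y1 h1 h2 (lexx _) y12.
    have [+ _] := app t y2 h1 h2 y12 (lexx _).
    rewrite !ler_norml => /andP[? ?] /andP[? ?]; apply/andP; split; lra.
  have b2 : `|\int[leb]_(y in `[y1, y2]) (Q x2 y - Q x1 y) - (be * (x2 - x1)) * Y|
      <= e * (X + Y) * Y.
    apply: seg_bound => //; first by apply: continuous_onB; apply: cQ => //; lra.
    move=> t h1 h2.
    have [_ +] := app x1 t (lexx _) x12 h1 h2.
    have [_ +] := app x2 t x12 (lexx _) h1 h2.
    rewrite !ler_norml => /andP[? ?] /andP[? ?]; apply/andP; split; lra.
  rewrite /W; move: b1 b2; set I1 := Rintegral _ _ _; set I2 := Rintegral _ _ _.
  have -> : be * (y1 - y2) * X = - (be * X * Y) by rewrite /Y; ring.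
  have -> : be * (x2 - x1) * Y = be * X * Y by rewrite /X; ring.
  have -> : e * (X + Y) ^+ 2 = e * (X + Y) * X + e * (X + Y) * Y by ring.
  rewrite !ler_norml => /andP[? ?] /andP[? ?]; apply/andP; split; lra.
Qed.

End Goursat.

(** * Cauchy's theorem between two horizontal lines *)

Section Strip.
Context {R : realType}.
Local Notation leb := (@lebesgue_measure R).

Definition continuous2_at (q : R -> R -> R) (x y : R) : Prop :=
  forall e, 0 < e -> exists2 del, 0 < del & forall x' y',
    `|x' - x| < del -> `|y' - y| < del -> `|q x' y' - q x y| < e.

(** The set where [q] exceeds [t] is open, hence the union of the countably many rational boxes
    contained in it. *)
Lemma measurable_fun_R2 (q : R -> R -> R) : (forall x y, continuous2_at q x y) ->
  measurable_fun setT (fun p : R * R => q p.1 p.2).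
Proof.
move=> cq; apply: (measurability _ (RGenOInfty.measurableE R)) => _ [_ [t ->] <-].
rewrite setTI.
pose box (a b r : rat) : set (R * R) :=
  [set p | `|p.1 - ratr a| < ratr r /\ `|p.2 - ratr b| < ratr r].
pose S := [set p : R * R | t < q p.1 p.2].
have mbox a b r : measurable (box a b r).
  have m (s : R) : measurable [set z : R | `|z - s| < ratr r].
    rewrite (_ : [set z | _] = `]s - ratr r, s + ratr r[%classic).
      exact: measurable_itv.
    by apply/seteqP; split => z /=; rewrite in_itv /= ltr_distl.
  rewrite (_ : box a b r = [set z : R | `|z - ratr a| < ratr r] `*`
     [set z : R | `|z - ratr b| < ratr r]) //.
  exact: measurableX.
rewrite (_ : _ @^-1` _ = \bigcup_a \bigcup_b \bigcup_r
    (if `[< box a b r `<=` S >] then box a b r else set0)).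
  by do 3 (apply: bigcupT_measurable_rat => ?); case: ifP.
apply/seteqP; split => [[x y] /=|[x y] [a _ [b _ [r _]]]]; last first.
  by case: asboolP => // bS /bS; rewrite /S /= in_itv /= andbT.
rewrite in_itv /= andbT => txy.
have e0 : 0 < q x y - t by rewrite subr_gt0.
have [del del0 hd] := cq x y _ e0.
(* A box of radius below [del / 2] that contains [(x, y)] stays within [del] of that point in each
   coordinate. *)
have [r] : exists r, ratr r \in `](del / 4), (del / 2)[ by apply: rat_in_itvoo; lra.
rewrite in_itv /= => /andP[r1 r2].
have rx : x - ratr r < x + ratr r by lra.
have ry : y - ratr r < y + ratr r by lra.
have [a] := rat_in_itvoo rx; rewrite in_itv /= => /andP[a1 a2].
have [b] := rat_in_itvoo ry; rewrite in_itv /= => /andP[b1 b2].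
exists a => //; exists b => //; exists r => //.
case: asboolP => [_|[]].
  by split => /=; rewrite ltr_distl; apply/andP; split; lra.
move=> [x' y'] [/=]; rewrite !ltr_distl => /andP[h1 h2] /andP[h3 h4].
have h5 : `|x' - x| < del by rewrite ltr_distl; apply/andP; split; lra.
have h6 : `|y' - y| < del by rewrite ltr_distl; apply/andP; split; lra.
by have := hd x' y' h5 h6; rewrite /S /= ltr_distl => /andP[]; lra.
Qed.

Lemma integrableTS (D : set R) (f : R -> \bar R) : measurable D ->
  leb.-integrable setT f -> leb.-integrable D f.
Proof. by move=> mD; apply: integrableS. Qed.

(** Otherwise [S >= e] on all of [[X0, X0 + N]], and this [N] makes the integral at least [|C| + e].
    It supplies the vertical sides of the rectangles. *)
Lemma integral_small_right (S : R -> \bar R) (C X0 e : R) :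
  measurable_fun setT S -> (forall x, 0 <= S x)%E -> 0 < e ->
  (\int[leb]_x S x <= C%:E)%E -> exists2 X, X0 <= X & (S X < e%:E)%E.
Proof.
move=> mS S0 e0 hC; apply: contrapT => /forall2NP H.
pose N := `|C| / e + 1; have N0 : 0 < N by rewrite ltr_wpDl// divr_ge0// ltW.
pose D : set R := `[X0, X0 + N]%classic.
have mD : measurable D by exact: measurable_itv.
have : (e%:E * leb D <= C%:E)%E.
  rewrite -integral_cst//; apply: le_trans hC.
  apply: (@le_trans _ _ (\int[leb]_(x in D) S x)%E).
    apply: ge0_le_integral => //.
    - by move=> x _; rewrite lee_fin ltW.
    - exact: measurable_funTS.
    - move=> x; rewrite /D /= in_itv /= => /andP[Xx _].
      by case: (H x) => [/(_ Xx)//|/negP]; rewrite -leNgt.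
  exact: ge0_subset_integral.
rewrite /D lebesgue_measure_itv /= lte_fin ltrDl N0 -EFinD -EFinM lee_fin.
have -> : e * (X0 + N - X0) = `|C| + e by rewrite /N; field; rewrite gt_eqF.
have := ler_norm C; lra.
Qed.

Lemma integral_small_left (S : R -> \bar R) (C X0 e : R) :
  measurable_fun setT S -> (forall x, 0 <= S x)%E -> 0 < e ->
  (\int[leb]_x S x <= C%:E)%E -> exists2 X, X <= X0 & (S X < e%:E)%E.
Proof.
move=> mS S0 e0 hC; apply: contrapT => /forall2NP H.
pose N := `|C| / e + 1; have N0 : 0 < N by rewrite ltr_wpDl// divr_ge0// ltW.
pose D : set R := `[X0 - N, X0]%classic.
have mD : measurable D by exact: measurable_itv.
have : (e%:E * leb D <= C%:E)%E.
  rewrite -integral_cst//; apply: le_trans hC.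
  apply: (@le_trans _ _ (\int[leb]_(x in D) S x)%E).
    apply: ge0_le_integral => //.
    - by move=> x _; rewrite lee_fin ltW.
    - exact: measurable_funTS.
    - move=> x; rewrite /D /= in_itv /= => /andP[_ Xx].
      by case: (H x) => [/(_ Xx)//|/negP]; rewrite -leNgt.
  exact: ge0_subset_integral.
rewrite /D lebesgue_measure_itv /= lte_fin ltrBlDr ltrDl N0 -EFinD -EFinM lee_fin.
have -> : e * (X0 - (X0 - N)) = `|C| + e by rewrite /N; field; rewrite gt_eqF.
have := ler_norm C; lra.
Qed.

Lemma Rintegral_tail (f : R -> R) (e : R) : leb.-integrable setT (EFin \o f) -> 0 < e ->
  exists X0, forall X1 X2, X1 <= - X0 -> X0 <= X2 ->
    `|\int[leb]_x f x - \int[leb]_(x in `[X1, X2]) f x| < e.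
Proof.
move=> fi e0.
have nfi : leb.-integrable setT (EFin \o (fun x => `|f x|)) by exact: integrable_norm.
have mnf := measurable_int _ nfi.
pose I (n : nat) : set R := `[- n%:R, n%:R]%classic.
have mI n : measurable (I n) by exact: measurable_itv.
have cI : \bigcup_n I n = setT.
  rewrite -subTset => x _; exists (Num.truncn `|x|).+1 => //=.
  rewrite /I /= in_itv /= -ler_norml ltW//.
  by have /andP[] := truncn_itv (normr_ge0 x).
have h : (\int[leb]_(x in I n) (`|f x|)%:E)%E @[n --> \oo] --> (\int[leb]_x (`|f x|)%:E)%E.
  rewrite -[in X in _ --> X]cI.
  apply: ge0_nondecreasing_set_cvg_integral => //.
  - move=> n m nm; apply/subsetPset => x; rewrite /I /= !in_itv /= => /andP[a b].
    have nmR : (n%:R : R) <= m%:R by rewrite ler_nat.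
    by apply/andP; split; lra.
  - by move=> n; exact: measurable_funTS.
have fin : (\int[leb]_x (`|f x|)%:E)%E \is a fin_num by exact: integrable_fin_num.
have [n hn] : exists n, \int[leb]_x `|f x| - \int[leb]_(x in I n) `|f x| < e.
  move: h; rewrite -(fineK fin) => /fine_cvgP[_] /cvgrPdist_lt /(_ e e0) [n _ /(_ n (leqnn n))] /= hn.
  by exists n; apply: le_lt_trans hn; exact: ler_norm.
exists n%:R => X1 X2 h1 h2.
have IX : I n `<=` `[X1, X2]%classic.
  by move=> x; rewrite /I /= !in_itv /= => /andP[a b]; apply/andP; split; lra.
have mX : measurable `[X1, X2]%classic by exact: measurable_itv.
have nI : leb.-integrable (I n) (EFin \o (fun x => `|f x|)).
  exact: integrableTS.
have nX : leb.-integrable `[X1, X2] (EFin \o (fun x => `|f x|)).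
  exact: integrableTS.
have spl (g : R -> R) : leb.-integrable setT (EFin \o g) ->
    \int[leb]_x g x - \int[leb]_(x in `[X1, X2]) g x =
    \int[leb]_(x in ~` `[X1, X2]) g x.
  move=> gi; rewrite -{1}(setUv `[X1, X2]%classic) Rintegral_setU//.
  - by rewrite addrAC subrr add0r.
  - exact: measurableC.
  - by rewrite setUv.
  - by apply/disj_setPS; rewrite setICr.
rewrite spl//; apply: (le_lt_trans (le_normr_Rintegral _ _)).
- exact: measurableC.
- by apply: integrableTS => //; exact: measurableC.
rewrite -spl//; apply: le_lt_trans hn; rewrite lerD2l lerN2.
rewrite /Rintegral fine_le//.
- by apply: integrable_fin_num => //; exact: mI.
- by apply: integrable_fin_num => //; exact: mX.
- apply: ge0_subset_integral => //; first exact: mI.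
  exact: measurable_funTS.
Qed.

Lemma closed_form_continuous2 (P Q : R -> R -> R) x y :
  closed_form_at P Q x y -> continuous2_at Q x y.
Proof.
move=> [al [be [ga h]]] e e0; have [del del0 hd] := h 1 ltr01.
pose K := `|be| + `|ga| + 2; have K0 : 0 < K by rewrite /K ltr_wpDl ?addr_ge0.
exists (Num.min del (e / K)); first by rewrite lt_min del0 divr_gt0.
move=> x' y'; rewrite !lt_min => /andP[x1 x2] /andP[y1 y2].
have [_ h1] := hd x' y' x1 y1; rewrite mul1r in h1.
rewrite !ltr_pdivlMr// /K in x2 y2.
have n1 := ler_norm (be * (x' - x)); have n2 := ler_norm (- (be * (x' - x))).
have n3 := ler_norm (ga * (y' - y)); have n4 := ler_norm (- (ga * (y' - y))).
rewrite !normrN !normrM in n1 n2 n3 n4.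
have b0 := normr_ge0 be; have g0 := normr_ge0 ga.
have u0 := normr_ge0 (x' - x); have v0 := normr_ge0 (y' - y).
move: h1; rewrite ler_norml => /andP[h1 h2].
set u := `|x' - x| in x2 n1 n2 u0 h1 h2; set v := `|y' - y| in y2 n3 n4 v0 h1 h2.
set B := `|be| in x2 y2 n1 n2 b0; set G := `|ga| in x2 y2 n3 n4 g0.
have h3 : (B + 1) * u + (G + 1) * v < e by case: (leP u v) => uv; nra.
rewrite ltr_norml; apply/andP; split; lra.
Qed.

(** The vertical sides of a rectangle need not be small everywhere. By Tonelli, [S x], the integral
    of [|Q x y|] across the strip, is itself integrable in [x], so there are abscissae arbitrarily
    far out on both sides at which it is small. *)
Lemma strip_integral (P Q : R -> R -> R) c d (M : R) : c <= d ->
  (forall x y, c <= y -> y <= d -> closed_form_at P Q x y) ->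
  leb.-integrable setT (EFin \o P^~ c) -> leb.-integrable setT (EFin \o P^~ d) ->
  (forall y, c <= y -> y <= d -> (\int[leb]_x (`|Q x y|)%:E <= M%:E)%E) ->
  \int[leb]_x P x c = \int[leb]_x P x d.
Proof.
move=> cd hPQ Pc Pd hM.
(* [Q] is controlled only over the strip. Clamping the ordinate, which is 1-Lipschitz, gives a
   function continuous on the whole plane, hence jointly measurable as Tonelli requires. *)
pose cl y := Num.max c (Num.min y d).
have cl_in y : c <= cl y /\ cl y <= d.
  by split; rewrite /cl ?le_max ?lexx// ge_max cd ge_min lexx orbT.
have clE y : c <= y -> y <= d -> cl y = y.
  by move=> cy yd; rewrite /cl min_l// max_r.
have cl_lip y y' : `|cl y' - cl y| <= `|y' - y|.
  have clA z : z <= c -> cl z = c.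
    by move=> zc; rewrite /cl min_l ?max_l// (le_trans zc).
  have clB z : d <= z -> cl z = d by move=> dz; rewrite /cl min_r// max_r.
  have tri z : [\/ z <= c /\ cl z = c, d <= z /\ cl z = d |
      (c <= z /\ z <= d) /\ cl z = z].
    case: (leP z c) => zc; first by constructor 1; split => //; exact: clA.
    case: (leP d z) => dz; first by constructor 2; split => //; exact: clB.
    by constructor 3; have zc' := ltW zc; have dz' := ltW dz; split => //; exact: clE.
  have n1 := ler_norm (y' - y); have := ler_norm (- (y' - y)); rewrite normrN => n2.
  case: (tri y) => -[h1 ->]; case: (tri y') => -[h2 ->];
  by rewrite ler_norml; apply/andP; split; lra.
have mq : measurable_fun setT (fun p : R * R => `|Q p.1 (cl p.2)|).
  apply: (measurable_fun_R2 (fun x y => `|Q x (cl y)|)) => x y e e0.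
  have [c1 c2] := cl_in y.
  have [del del0 hd] := closed_form_continuous2 _ _ _ _ (hPQ x (cl y) c1 c2) e e0.
  exists del => // x' y' hx hy; apply: le_lt_trans (ler_dist_dist _ _) _.
  by apply: hd => //; exact: le_lt_trans (cl_lip _ _) hy.
pose D : set R := `[c, d]%classic.
have mD : measurable D by exact: measurable_itv.
pose f (p : R * R) : \bar R := (`|Q p.1 (cl p.2)| * \1_D p.2)%:E.
have f0 p : (0 <= f p)%E by rewrite lee_fin mulr_ge0.
have mf : measurable_fun setT f.
  apply/measurable_EFinP; apply: measurable_funM => //.
  by apply: measurableT_comp => //; exact: measurable_snd.
pose S x := (\int[leb]_y f (x, y))%E.
have mS : measurable_fun setT S by exact: measurable_fun_fubini_tonelli_F.
have S0 x : (0 <= S x)%E by apply: integral_ge0.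
have SE x : S x = (\int[leb]_(y in D) (`|Q x y|)%:E)%E.
  rewrite /S [RHS]integral_mkcond; apply: eq_integral => y _.
  rewrite /f patchE /= indicE; case: ifPn => yD; last by rewrite mulr0.
  by move: yD; rewrite inE /D /= in_itv /= => /andP[cy yd]; rewrite clE// mulr1.
have SM : (\int[leb]_x S x <= (M * (d - c))%:E)%E.
  rewrite /S fubini_tonelli//.
  apply: (@le_trans _ _ (\int[leb]_y (M * \1_D y)%:E)%E).
    apply: ge0_le_integral => //.
    - by move=> y _; apply: integral_ge0.
    - exact: measurable_fun_fubini_tonelli_G.
    - by apply/measurable_EFinP; apply: measurable_funM.
    move=> y _; rewrite /f /= indicE; case: (boolP (y \in D)) => yD; last first.
      by rewrite mulr0 integral0_eq// => x _; rewrite mulr0.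
    rewrite mulr1; move: yD; rewrite inE /D /= in_itv /= => /andP[cy yd].
    by under eq_integral do rewrite mulr1 clE//; exact: hM.
  have M0 : 0 <= M.
    rewrite -lee_fin; apply: le_trans (hM c (lexx c) cd).
    by apply: integral_ge0 => x _; rewrite lee_fin.
  under eq_integral do rewrite EFinM.
  rewrite ge0_integralZl//.
    rewrite integral_indic// setIT -[X in (_ * X)%E]/(leb D).
    have -> : leb D = (d - c)%:E.
      rewrite /D lebesgue_measure_itv /= lte_fin; case: ltP => // dc.
      have -> : c = d by apply/le_anti; rewrite cd dc.
      by rewrite subrr.
    by rewrite -EFinM.
  by apply/measurable_EFinP; exact: measurable_indic.
have [//|ne] := eqVneq (\int[leb]_x P x c) (\int[leb]_x P x d).
(* A quarter of the supposed discrepancy: two tails and two vertical sides will each cost less than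
   [e]. *)
pose e := `|\int[leb]_x P x c - \int[leb]_x P x d| / 4.
have e0 : 0 < e by rewrite divr_gt0// normr_gt0 subr_eq0.
have [Xc hc] := Rintegral_tail _ e Pc e0.
have [Xd hd] := Rintegral_tail _ e Pd e0.
pose X0 := Num.max 0 (Num.max Xc Xd).
have X00 : 0 <= X0 by rewrite /X0 le_max lexx.
have Xc0 : Xc <= X0 by rewrite /X0 !le_max lexx /= orbT.
have Xd0 : Xd <= X0 by rewrite /X0 !le_max lexx !orbT.
have [X2 X02 SX2] := integral_small_right S _ X0 e mS S0 e0 SM.
have [X1 X01 SX1] := integral_small_left S _ (- X0) e mS S0 e0 SM.
have X12 : X1 <= X2 by lra.
have {}hc : `|\int[leb]_x P x c - \int[leb]_(x in `[X1, X2]) P x c| < e.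
  by apply: hc; lra.
have {}hd : `|\int[leb]_x P x d - \int[leb]_(x in `[X1, X2]) P x d| < e.
  by apply: hd; lra.
have G := goursat P Q X1 X2 c d X12 cd (fun x y _ _ => hPQ x y).
have cQ x : continuous_on (Q x) c d.
  move=> y cy yd; apply/cvgrPdist_lt => r r0.
  have [del del0 hdel] := closed_form_continuous2 _ _ _ _ (hPQ x y cy yd) r r0.
  apply/nbhs_ballP; exists del => //= y'; rewrite /ball /= distrC => yy.
  by rewrite distrC; apply: hdel => //; rewrite subrr normr0.
have Qi x := continuous_on_integrable _ _ _ (cQ x).
have Qs x : (S x < e%:E)%E -> `|\int[leb]_(y in `[c, d]) Q x y| < e.
  move=> Sx; apply: (le_lt_trans (le_normr_Rintegral _ _)) => //.
  by rewrite /Rintegral -SE -lte_fin fineK// ge0_fin_numE// (lt_trans Sx) ?ltry.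
have q1 := Qs _ SX1; have q2 := Qs _ SX2.
rewrite RintegralB// in G; last 2 first.
  by apply: integrableTS.
  by apply: integrableTS.
rewrite (RintegralB _ (Qi X2) (Qi X1))// in G.
exfalso; have : 4 * e = `|\int[leb]_x P x c - \int[leb]_x P x d| by rewrite /e; field.
move: hc hd q1 q2 G; rewrite !ltr_norml.
move: (\int[leb]_x P x c) (\int[leb]_x P x d) => a b.
move: (\int[leb]_(x in `[X1, X2]) P x c) (\int[leb]_(x in `[X1, X2]) P x d) => a' b'.
move: (\int[leb]_(y in `[c, d]) Q X1 y) (\int[leb]_(y in `[c, d]) Q X2 y) => u v.
move=> /andP[? ?] /andP[? ?] /andP[? ?] /andP[? ?] G h.
have : `|a - b| < 4 * e by rewrite ltr_norml; apply/andP; split; lra.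
by rewrite h ltxx.
Qed.

End Strip.

(** * Complex derivatives *)

Section ComplexDerivative.
Context {R : realType}.
Local Notation C := (R[i]).
Implicit Types (z w h : C) (F K : C -> C).

(** A submultiplicative norm equivalent to the modulus, but real-valued and without square roots. *)
Definition l1norm z : R := `|Re z| + `|Im z|.

Lemma l1norm_ge0 z : 0 <= l1norm z. Proof. by rewrite addr_ge0. Qed.

Lemma l1normD z w : l1norm (z + w) <= l1norm z + l1norm w.
Proof.
rewrite /l1norm !ReImE; have := ler_normD (Re z) (Re w); have := ler_normD (Im z) (Im w).
lra.
Qed.

Lemma l1normM z w : l1norm (z * w) <= l1norm z * l1norm w.
Proof.
rewrite /l1norm !ReImE.
apply: (le_trans (lerD (ler_normB _ _) (ler_normD _ _))).
by rewrite !normrM le_eqVlt; apply/orP; left; apply/eqP; ring.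
Qed.

Lemma l1normJ z : l1norm (conjc z) = l1norm z.
Proof. by rewrite /l1norm ReJ ImJ normrN. Qed.

Lemma normc_le_l1norm z : `|z| <= (l1norm z)%:C.
Proof.
rewrite normcsq lecR -[leRHS](ger0_norm (l1norm_ge0 z)) -sqrtr_sqr ler_wsqrtr//.
rewrite /sqnorm /l1norm -(real_normK (num_real (Re z))) -(real_normK (num_real (Im z))).
have := normr_ge0 (Re z); have := normr_ge0 (Im z); nra.
Qed.

Lemma l1norm_le_normc z (e : R) : `|z| <= e%:C -> l1norm z <= 2 * e.
Proof.
move=> h; have := le_trans (normc_ge_Re z) h.
have : `|Im z|%:C <= `|z|.
  by have := normc_ge_Re ('i%C * z); rewrite normrM ReM /= mul0r mul1r sub0r normrN
    (_ : `|'i%C| = 1 :> C) ?mul1r// normcsq /sqnorm /= expr0n expr1n add0r sqrtr1.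
move=> /le_trans /(_ h); rewrite !lecR /l1norm; lra.
Qed.

Lemma first_order (K : numFieldType) (f : K^o -> K^o) (x : K) : derivable f x 1 ->
  forall e : K, 0 < e -> exists2 del : K, 0 < del &
    forall h : K, `|h| < del -> `|f (x + h) - f x - 'D_1 f x * h| <= e * `|h|.
Proof.
move=> df e e0.
have := df; rewrite /derivable => /cvgrPdist_le /(_ e e0).
rewrite -/(derive f x 1) => /nbhs_ballP[del /= del0 hd].
exists del => // h hh.
have [->|h0] := eqVneq h 0; first by rewrite addr0 subrr mulr0 subrr normr0 mulr0.
have := hd h; rewrite /ball /= sub0r normrN => /(_ hh h0).
have -> : f (h *: 1 + x) = f (x + h) by rewrite -[h *: 1]/(h * 1) mulr1 addrC.
move=> h1; have hn : 0 < `|h| by rewrite normr_gt0.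
rewrite -(ler_pM2r hn) -normrM in h1; apply: le_trans h1.
rewrite -normrN mulrBl -[h^-1 *: _]/(h^-1 * (f (x + h) - f x)) mulrAC mulVf// mul1r.
by rewrite opprB.
Qed.

(** Complex differentiability as a first-order expansion with real error bounds. The linear part is
    multiplication by a complex number, which encodes the Cauchy-Riemann equations. *)
Definition cdiff F z : Prop := exists D : C, forall e : R, 0 < e ->
  exists2 del : R, 0 < del & forall h, l1norm h < del ->
    l1norm (F (z + h) - F z - D * h) <= e * l1norm h.

Lemma derivable_cdiff F z : derivable (F : C^o -> C^o) z 1 -> cdiff F z.
Proof.
move=> dF; pose D : C := 'D_1 (F : C^o -> C^o) (z : C^o).
exists D => e e0.
have e2 : 0 < (e / 2)%:C by rewrite ltcR divr_gt0.
have [del] := first_order C F z dF _ e2; rewrite ltcE => /andP[/eqP delI del0] hd.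
have delE : del = (Re del)%:C by apply: complex_ext => //=; rewrite delI.
exists (Re del) => // h hh.
have hdel : `|h| < del by rewrite delE; apply: le_lt_trans (normc_le_l1norm h) _; rewrite ltcR.
have := hd h hdel => h1.
have h2 : `|F (z + h) - F z - D * h| <= (e / 2 * l1norm h)%:C.
  have -> : (e / 2 * l1norm h)%:C = (e / 2)%:C * (l1norm h)%:C :> C.
    by apply: complex_ext; rewrite !ReImE /=; ring.
  by apply: (le_trans h1); rewrite ler_pM2l// normc_le_l1norm.
by have := l1norm_le_normc _ _ h2; congr (_ <= _); field.
Qed.

Lemma cdiffM F K z : cdiff F z -> cdiff K z -> cdiff (fun z => F z * K z) z.
Proof.
move=> [D hD] [E hE]; exists (D * K z + F z * E) => e e0.
(* The summands are the coefficients of [e' * l1norm h] in the bounds [t1] to [t6] on the six parts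
   of the remainder. *)
pose B := l1norm (F z) + l1norm (K z) + l1norm D + l1norm E + l1norm D * l1norm E + 1.
have B0 : 0 < B.
  by rewrite /B ltr_wpDl// !addr_ge0 ?mulr_ge0 ?l1norm_ge0.
have [e' [e'0 e'1 e'B]] : exists e' : R, [/\ 0 < e', e' <= 1 & e' * B <= e].
  exists (Num.min 1 (e / B)); rewrite -ler_pdivlMr// !ge_min !lexx orbT; split => //.
  by rewrite lt_min ltr01 divr_gt0.
have [d1 d10 h1] := hD e' e'0; have [d2 d20 h2] := hE e' e'0.
exists (Num.min (Num.min d1 d2) e'); first by rewrite !lt_min d10 d20 e'0.
move=> h; rewrite !lt_min => /andP[/andP[hd1 hd2] he'].
set r := F (z + h) - F z - D * h; set s := K (z + h) - K z - E * h.
have r1 : l1norm r <= e' * l1norm h by exact: h1.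
have s1 : l1norm s <= e' * l1norm h by exact: h2.
have -> : F (z + h) * K (z + h) - F z * K z - (D * K z + F z * E) * h =
    (F z * s + D * h * (E * h)) + (D * h * s + r * K z) + (r * (E * h) + r * s).
  by rewrite /r /s; ring.
have n0 := l1norm_ge0 h.
have t1 : l1norm (F z * s) <= l1norm (F z) * (e' * l1norm h).
  by apply: (le_trans (l1normM _ _)); rewrite ler_wpM2l ?l1norm_ge0.
have Dh : l1norm (D * h) <= l1norm D * l1norm h by exact: l1normM.
have Eh : l1norm (E * h) <= l1norm E * l1norm h by exact: l1normM.
have t2 : l1norm (D * h * (E * h)) <= l1norm D * l1norm E * (e' * l1norm h).
  apply: (le_trans (l1normM _ _)); apply: (le_trans (ler_pM _ _ Dh Eh)); rewrite ?l1norm_ge0//.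
  have -> : l1norm D * l1norm h * (l1norm E * l1norm h) = l1norm D * l1norm E * (l1norm h * l1norm h) by ring.
  by rewrite ler_wpM2l ?mulr_ge0 ?l1norm_ge0// ler_wpM2r// ltW.
have t3 : l1norm (D * h * s) <= l1norm D * (e' * l1norm h).
  apply: (le_trans (l1normM _ _)); apply: (le_trans (ler_pM _ _ Dh s1)); rewrite ?l1norm_ge0//.
  rewrite -mulrA ler_wpM2l ?l1norm_ge0// -[leRHS]mul1r ler_wpM2r ?mulr_ge0 ?(ltW e'0)//.
  by rewrite (le_trans (ltW he')).
have t4 : l1norm (r * K z) <= (e' * l1norm h) * l1norm (K z).
  by apply: (le_trans (l1normM _ _)); rewrite ler_wpM2r ?l1norm_ge0.
have t5 : l1norm (r * (E * h)) <= (e' * l1norm h) * l1norm E.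
  apply: (le_trans (l1normM _ _)); apply: (le_trans (ler_pM _ _ r1 Eh)); rewrite ?l1norm_ge0//.
  rewrite ler_wpM2l ?mulr_ge0 ?(ltW e'0)// -[leRHS]mulr1 ler_wpM2l ?l1norm_ge0//.
  by rewrite (le_trans (ltW he')).
have t6 : l1norm (r * s) <= e' * l1norm h.
  apply: (le_trans (l1normM _ _)); apply: (le_trans (ler_pM _ _ r1 s1)); rewrite ?l1norm_ge0//.
  rewrite -[leRHS]mulr1 ler_wpM2l ?mulr_ge0 ?(ltW e'0)//.
  rewrite (le_trans (ler_wpM2r n0 e'1))// mul1r (le_trans (ltW he'))//.
apply: (le_trans (l1normD _ _)).
have a1 := l1normD (F z * s + D * h * (E * h)) (D * h * s + r * K z).
have a2 := l1normD (F z * s) (D * h * (E * h)).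
have a3 := l1normD (D * h * s) (r * K z).
have a4 := l1normD (r * (E * h)) (r * s).
have a5 : (e' * l1norm h) * B <= e * l1norm h by rewrite mulrAC ler_wpM2r.
by apply: le_trans a5; rewrite /B; lra.
Qed.

(** Schwarz reflection: conjugating both argument and value preserves holomorphy. It makes the
    conjugate factor of an inner product the restriction of a holomorphic function. *)
Lemma cdiff_reflect F z c : cdiff F (conjc z + c) ->
  cdiff (fun z => conjc (F (conjc z + c))) z.
Proof.
move=> [D hD]; exists (conjc D) => e e0; have [del del0 hd] := hD e e0.
exists del => // h hh.
have := hd (conjc h); rewrite !l1normJ => /(_ hh); congr (_ <= _).
rewrite -[RHS]l1normJ; congr l1norm.
by rewrite !rmorphB rmorphM /= !conjcK rmorphD /= (addrAC (conjc z)).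
Qed.

(** This is [e^{i t z}], the holomorphic extension of the multiplier of [u(-t)]. *)
Definition cexpi (t : R) z : C := (expR (- t * Im z))%:C * expi (t * Re z).

Lemma expiD (a b : R) : expi (a + b) = expi a * expi b.
Proof.
by apply: complex_ext; rewrite !ReImE /= ?cosD ?sinD; ring.
Qed.

Lemma cexpiD t z w : cexpi t (z + w) = cexpi t z * cexpi t w.
Proof.
rewrite /cexpi !ReImE !mulrDr expRD expiD rmorphM /=; ring.
Qed.

(** Multiplicativity reduces the claim to the origin, where it follows from the real derivatives of
    exp, cos and sin at 0. *)
Lemma cdiff_cexpi t z : cdiff (cexpi t) z.
Proof.
exists (cexpi t z * ('i%C * t%:C)) => e e0.
suff [del del0 hd] : exists2 del : R, 0 < del & forall h, l1norm h < del ->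
    l1norm (cexpi t h - 1 - 'i%C * t%:C * h) <= e / (l1norm (cexpi t z) + 1) * l1norm h.
  exists del => // h hh.
  have c1 : 0 < l1norm (cexpi t z) + 1 by rewrite ltr_wpDl ?l1norm_ge0.
  rewrite cexpiD (_ : _ - _ = cexpi t z * (cexpi t h - 1 - 'i%C * t%:C * h)); last by ring.
  apply: (le_trans (l1normM _ _)); apply: (le_trans (ler_wpM2l (l1norm_ge0 _) (hd h hh))).
  rewrite mulrA ler_wpM2r ?l1norm_ge0// mulrCA -[leRHS]mulr1 ler_pM2l//.
  by rewrite ler_pdivrMr// mul1r lerDl.
have c1 : 0 < l1norm (cexpi t z) + 1 by rewrite ltr_wpDl ?l1norm_ge0.
move: (e / _) (divr_gt0 e0 c1) => {e0 c1}e e0.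
have fo (f : R -> R) (df : R) : is_derive (0 : R) (1 : R) f df -> forall r : R, 0 < r ->
    exists2 del : R, 0 < del & forall h : R, `|h| < del -> `|f h - f 0 - df * h| <= r * `|h|.
  move=> [dv <-] r r0; have [del del0 hd] := first_order R f 0 dv r r0.
  by exists del => // h hh; have := hd h hh; rewrite add0r.
pose T := `|t| + 1; have T0 : 0 < T by rewrite ltr_wpDl.
(* The bounds [R1] and [R2] below add up to [r * (|p| + 5 |q|)], and [T] bounds the passage from
   [p], [q] back to [v], [u]. *)
have [r [r0 r1 rT]] : exists r : R, [/\ 0 < r, r <= 1 & r * (5 * T) <= e].
  have TT : 0 < 5 * T by rewrite mulr_gt0.
  exists (Num.min 1 (e / (5 * T))).
  rewrite -ler_pdivlMr// !ge_min !lexx orbT; split => //.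
  by rewrite lt_min ltr01 divr_gt0.
have [d1 d10 h1] := fo _ _ (is_derive_expR 0) r r0.
have [d2 d20 h2] := fo _ _ (is_derive_cos 0) r r0.
have [d3 d30 h3] := fo _ _ (is_derive_sin 0) r r0.
have [del [del0 dd1 dd2 dd3 dr]] : exists del : R, [/\ 0 < del, del <= d1, del <= d2,
    del <= d3 & del <= r / 2].
  exists (Num.min (Num.min d1 d2) (Num.min d3 (r / 2))).
  by split; rewrite ?lt_min ?d10 ?d20 ?d30 ?divr_gt0// ?ge_min ?lexx ?orbT.
exists (del / T); first by rewrite divr_gt0.
move=> h; rewrite ltr_pdivlMr// /l1norm => hT.
set u := Re h in hT *; set v := Im h in hT *.
have uT : `|t * u| <= T * `|u| by rewrite normrM ler_wpM2r// lerDl.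
have vT : `|- t * v| <= T * `|v| by rewrite normrM normrN ler_wpM2r// lerDl.
have u0 := normr_ge0 u; have v0 := normr_ge0 v.
have sT : T * `|u| + T * `|v| < del by lra.
have ud : `|t * u| < del by have := mulr_ge0 (ltW T0) v0; lra.
have vd : `|- t * v| < del by have := mulr_ge0 (ltW T0) u0; lra.
have g1 := h1 _ (lt_le_trans vd dd1); have g2 := h2 _ (lt_le_trans ud dd2).
have g3 := h3 _ (lt_le_trans ud dd3).
rewrite expR0 mul1r in g1; rewrite cos0 sin0 oppr0 mul0r subr0 in g2.
rewrite sin0 cos0 subr0 mul1r in g3.
rewrite /cexpi /expi !ReImE /= -/u -/v.
move: (expR _) (cos _) (sin _) g1 g2 g3 => a b c.
have vd' : `|- t * v| <= r / 2 by rewrite (le_trans (ltW vd)).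
have ud' : `|t * u| <= r / 2 by rewrite (le_trans (ltW ud)).
have pE : - (t * v) = - t * v by ring.
move: uT vT vd' ud'; set p := - t * v; set q := t * u => uT vT pd qd g1 g2 g3.
have p0 := normr_ge0 p; have q0 := normr_ge0 q.
have a1 : `|a - 1| <= r.
  rewrite (_ : a - 1 = (a - 1 - p) + p); last by ring.
  apply: (le_trans (ler_normD _ _)).
  have := ler_wpM2r p0 r1; lra.
have a2 : `|a| <= 2.
  rewrite (_ : a = (a - 1) + 1); last by ring.
  by apply: (le_trans (ler_normD _ _)); rewrite normr1; lra.
have R1 : `|a * b - 1 - p| <= r * (`|p| + 2 * `|q|).
  rewrite (_ : a * b - 1 - p = (a - 1 - p) + a * (b - 1)); last by ring.
  apply: (le_trans (ler_normD _ _)); rewrite (normrM a).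
  have := ler_pM (normr_ge0 _) (normr_ge0 _) a2 g2; lra.
have R2 : `|a * c - q| <= r * (3 * `|q|).
  rewrite (_ : a * c - q = a * (c - q) + (a - 1) * q); last by ring.
  apply: (le_trans (ler_normD _ _)); rewrite (normrM a) (normrM (a - 1)).
  have := ler_pM (normr_ge0 _) (normr_ge0 _) a2 g3; have := ler_wpM2r q0 a1; lra.
rewrite (_ : _ - (_ * u - _ * v) = a * b - 1 - p); last by rewrite /p; ring.
rewrite (_ : _ - (_ * v + _ * u) = a * c - q); last by rewrite /q; ring.
apply: (@le_trans _ _ (r * (5 * T) * (`|u| + `|v|))); last by rewrite ler_wpM2r ?addr_ge0.
have k1 := ler_wpM2l (ltW r0) uT; have k2 := ler_wpM2l (ltW r0) vT.
have k3 : 0 <= r * (T * `|v|) by rewrite !mulr_ge0// ltW.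
lra.
Qed.

(** The form is the real part of [F dz]; the common coefficient demanded by [closed_form_at] is
    [- Im D], by Cauchy-Riemann. *)
Lemma cdiff_closed_Re F x y : cdiff F (x +i* y) ->
  closed_form_at (fun x y => Re (F (x +i* y))) (fun x y => - Im (F (x +i* y))) x y.
Proof.
move=> [D hD]; exists (Re D), (- Im D), (- Re D) => e e0.
have [del del0 hd] := hD e e0; exists (del / 2); first by rewrite divr_gt0.
move=> x' y' hx hy; pose h := (x' - x) +i* (y' - y).
have n1h : l1norm h = `|x' - x| + `|y' - y| by [].
have hh : l1norm h < del by rewrite n1h; lra.
have := hd h hh; have -> : x +i* y + h = x' +i* y'.
  by apply: complex_ext; rewrite /= addrC subrK.
rewrite n1h /l1norm !ReImE /h /= => H.
have a := normr_ge0 (Re (F (x' +i* y')) - Re (F (x +i* y)) -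
  (Re D * (x' - x) - Im D * (y' - y))).
have b := normr_ge0 (Im (F (x' +i* y')) - Im (F (x +i* y)) -
  (Re D * (y' - y) + Im D * (x' - x))).
split.
  rewrite mulNr; lra.
rewrite -normrN.
have -> : - (- Im (F (x' +i* y')) - - Im (F (x +i* y)) -
  (- Im D * (x' - x) + - Re D * (y' - y))) =
  Im (F (x' +i* y')) - Im (F (x +i* y)) - (Re D * (y' - y) + Im D * (x' - x)) by ring.
lra.
Qed.

Lemma cdiff_closed_Im F x y : cdiff F (x +i* y) ->
  closed_form_at (fun x y => Im (F (x +i* y))) (fun x y => Re (F (x +i* y))) x y.
Proof.
move=> [D hD]; exists (Im D), (Re D), (- Im D) => e e0.
have [del del0 hd] := hD e e0; exists (del / 2); first by rewrite divr_gt0.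
move=> x' y' hx hy; pose h := (x' - x) +i* (y' - y).
have n1h : l1norm h = `|x' - x| + `|y' - y| by [].
have hh : l1norm h < del by rewrite n1h; lra.
have := hd h hh; have -> : x +i* y + h = x' +i* y'.
  by apply: complex_ext; rewrite /= addrC subrK.
rewrite n1h /l1norm !ReImE /h /= => H.
have a := normr_ge0 (Re (F (x' +i* y')) - Re (F (x +i* y)) -
  (Re D * (x' - x) - Im D * (y' - y))).
have b := normr_ge0 (Im (F (x' +i* y')) - Im (F (x +i* y)) -
  (Re D * (y' - y) + Im D * (x' - x))).
split; first by rewrite (addrC (Im D * _)); lra.
rewrite mulNr; lra.
Qed.

Lemma cdiff_continuous_line F x y : cdiff F (x +i* y) ->
  {for x, continuous (fun x => Re (F (x +i* y)))} /\
  {for x, continuous (fun x => Im (F (x +i* y)))}.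
Proof.
move=> dF; split.
  have [al [be [ga h]]] := cdiff_closed_Re _ _ _ dF.
  apply: (affine_continuous _ x al); have [del del0 hd] := h 1 ltr01.
  exists del => // t tx.
  have yd' : `|y - y| < del by rewrite subrr normr0.
  have [+ _] := hd t y tx yd'.
  by rewrite subrr normr0 mulr0 !addr0 mul1r.
have [al [be [ga h]]] := cdiff_closed_Im _ _ _ dF.
apply: (affine_continuous _ x al); have [del del0 hd] := h 1 ltr01.
exists del => // t tx.
have yd' : `|y - y| < del by rewrite subrr normr0.
have [+ _] := hd t y tx yd'.
by rewrite subrr normr0 mulr0 !addr0 mul1r.
Qed.

End ComplexDerivative.

(** * Hardy functions on horizontal lines *)

Section Hardy.
Context {R : realType}.
Local Notation C := (R[i]).
Local Notation leb := (@lebesgue_measure R).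
Variable s : R.
Hypothesis ss : s * s = 1.
Implicit Types F K : C -> C.

Definition hardy_fun F : Prop :=
  (forall z, halfplane s z -> cdiff F z) /\
  exists M : R, forall y, 0 < y ->
    (\int[leb]_x (sqnorm (F (x +i* (s * y))))%:E <= M%:E)%E.

Lemma hardy2_fun F : hardy2 s F -> hardy_fun F.
Proof. by move=> [dF hM]; split => // z /dF; exact: derivable_cdiff. Qed.

(** Here [y] is the distance to the real axis, positive in both half-planes; the ordinate is
    [s * y]. *)
Definition hardy_line F (y : R) : R -> C := fun x => F (x +i* (s * y)).

Lemma halfplane_line x y : 0 < y -> halfplane s (x +i* (s * y)).
Proof. by move=> y0; rewrite /halfplane /= mulrA ss mul1r. Qed.

Lemma hardy_line_L2 F y : hardy_fun F -> 0 < y -> L2 (hardy_line F y).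
Proof.
move=> [dF [M hM]] y0; split; last by apply: le_lt_trans (hM y y0) _; rewrite ltry.
split; apply: continuous_measurable_fun => x.
  exact: (cdiff_continuous_line _ _ _ (dF _ (halfplane_line x y y0))).1.
exact: (cdiff_continuous_line _ _ _ (dF _ (halfplane_line x y y0))).2.
Qed.

Lemma hardy_bounded F : hardy_fun F ->
  exists M : R, forall y, 0 < y -> L2sq (hardy_line F y) <= M.
Proof.
move=> hF; have [_ [M hM]] := hF; exists M => y y0.
have fi := L2_sq_integrable _ (hardy_line_L2 _ _ hF y0).
by rewrite -lee_fin fineK ?hM//; exact: integrable_fin_num.
Qed.

(* Cauchy's theorem for [F z * conj (K (conj z + i s e))], holomorphic on the strip. *)
Lemma hardy_strip F K (e u v : R) : hardy_fun F -> hardy_fun K ->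
  u <= v -> 0 < s * u -> s * u < e -> 0 < s * v -> s * v < e ->
  rdot (hardy_line F (s * u)) (hardy_line K (e - s * u)) = rdot (hardy_line F (s * v)) (hardy_line K (e - s * v)).
Proof.
move=> hF hK uv u0 ue v0 ve.
(* At ordinate [y] the reflected argument has height [e - s * y], so the integral of [G] over that
   line pairs the line of [F] at height [s * y] with that of [K] at height [e - s * y]. *)
pose G z := F z * conjc (K (conjc z + 0 +i* (s * e))).
have GE x y : G (x +i* y) = F (x +i* (s * (s * y))) * conjc (K (x +i* (s * (e - s * y)))).
  rewrite /G mulrBr !mulrA ss !mul1r; congr (_ * conjc (K _)).
  by apply: complex_ext; rewrite /= ?addr0// addrC.
have inside y : u <= y -> y <= v -> 0 < s * y /\ s * y < e.
  move=> uy yv; have [s0|s0] := leP 0 s.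
    have := ler_wpM2l s0 uy; have := ler_wpM2l s0 yv; lra.
  have := ler_wnM2l (ltW s0) uy; have := ler_wnM2l (ltW s0) yv; lra.
have dG x y : u <= y -> y <= v -> cdiff G (x +i* y).
  move=> uy yv; have [y0 ye] := inside y uy yv.
  apply: cdiffM; first by apply: hF.1; rewrite /halfplane /=.
  apply: (cdiff_reflect K); apply: hK.1; rewrite /halfplane /= mulrDr mulrN mulrA ss.
  lra.
have dotE y : rdot (hardy_line F (s * y)) (hardy_line K (e - s * y)) = \int[leb]_x Re (G (x +i* y)).
  by rewrite /rdot /L2dot /cintegral /=; apply: eq_Rintegral => x _; rewrite GE.
have Gi y : 0 < s * y -> s * y < e ->
    leb.-integrable setT (EFin \o (fun x => Re (G (x +i* y)))).
  move=> y0 ye; have ey : 0 < e - s * y by lra.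
  have [+ _] := L2_dot_integrable _ _ (hardy_line_L2 _ _ hF y0) (hardy_line_L2 _ _ hK ey).
  by apply: eq_integrable => // x _; rewrite /= GE.
have [MF hMF] := hF.2; have [MK hMK] := hK.2.
rewrite !dotE.
apply: (@strip_integral R (fun x y => Re (G (x +i* y))) (fun x y => - Im (G (x +i* y)))
  u v (MF + MK) uv).
- by move=> x y uy yv; apply: cdiff_closed_Re; exact: dG.
- exact: Gi.
- exact: Gi.
move=> y uy yv; have [y0 ye] := inside y uy yv; have ey : 0 < e - s * y by lra.
have LF := hardy_line_L2 _ _ hF y0; have LK := hardy_line_L2 _ _ hK ey.
rewrite EFinD; apply: le_trans (leeD (hMF _ y0) (hMK _ ey)).
have fi := L2_sq_integrable _ LF; have ki := L2_sq_integrable _ LK.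
rewrite -ge0_integralD//; last 4 first.
- by move=> x _; rewrite lee_fin sqnorm_ge0.
- exact: measurable_int fi.
- by move=> x _; rewrite lee_fin sqnorm_ge0.
- exact: measurable_int ki.
have [_ gi] := L2_dot_integrable _ _ LF LK.
apply: ge0_le_integral => //.
- apply/measurable_EFinP; apply: measurableT_comp => //.
  have /measurable_EFinP mg := measurable_int _ gi.
  rewrite (_ : (fun x => _) = (fun x => - Im (hardy_line F (s * y) x * conjc (hardy_line K (e - s * y) x)))).
    exact: measurableT_comp mg.
  by apply/funext => x; rewrite GE.
- by have := integrableD measurableT fi ki; exact: measurable_int.
- move=> x _; rewrite GE normrN -EFinD lee_fin; exact: (mulJ_bound _ _).2.
Qed.

Lemma hardy_shift F K a b a' b' : hardy_fun F -> hardy_fun K ->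
  0 < a -> 0 < b -> 0 < a' -> 0 < b' -> a + b = a' + b' ->
  rdot (hardy_line F a) (hardy_line K b) = rdot (hardy_line F a') (hardy_line K b').
Proof.
move=> hF hK a0 b0 a0' b0' ab.
have sK x : s * (s * x) = x by rewrite mulrA ss mul1r.
have -> : b = (a + b) - s * (s * a) by rewrite sK; ring.
have -> : b' = (a + b) - s * (s * a') by rewrite sK ab; ring.
rewrite -[in hardy_line F a](sK a) -[in hardy_line F a'](sK a').
have [uv|vu] := leP (s * a) (s * a').
  by apply: hardy_strip => //; rewrite sK; lra.
by apply/esym; apply: hardy_strip => //; rewrite ?sK ?(ltW vu)//; lra.
Qed.

Lemma hardy_dist F a b : hardy_fun F -> 0 < a -> 0 < b ->
  L2sq (hardy_line F a - hardy_line F b) =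
  L2sq (hardy_line F a) + L2sq (hardy_line F b) - 2 * L2sq (hardy_line F ((a + b) / 2)).
Proof.
move=> hF a0 b0; have m0 : 0 < (a + b) / 2 by lra.
rewrite L2sqB; try exact: hardy_line_L2.
by rewrite (hardy_shift F F a b ((a + b) / 2) ((a + b) / 2))// ?rdotff//; field.
Qed.

(* The squared norms on horizontal lines form a bounded midpoint-convex function. *)
Lemma hardy_line_monotone F a b : hardy_fun F -> 0 < a -> a <= b ->
  L2sq (hardy_line F b) <= L2sq (hardy_line F a).
Proof.
move=> hF a0 ab; rewrite leNgt; apply/negP => H.
(* An increase from [a] to [b] would propagate: by convexity every later increment along this
   progression is at least as large, so [u] would grow linearly, against [hardy_bounded]. *)
pose d := b - a; pose u (k : nat) := L2sq (hardy_line F (a + k%:R * d)).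
have d0 : 0 <= d by rewrite /d; lra.
have pos k : 0 < a + k%:R * d by rewrite ltr_wpDr// mulr_ge0.
have conv k : 2 * u k.+1 <= u k + u k.+2.
  have := L2sq_ge0 (hardy_line F (a + k%:R * d) - hardy_line F (a + k.+2%:R * d)).
  rewrite hardy_dist// (_ : (_ + _) / 2 = a + k.+1%:R * d); first by rewrite /u; lra.
  by rewrite -addn2 -addn1 !natrD; field.
have inc k : u 1%N - u 0%N <= u k.+1 - u k.
  elim: k => [//|k IH]; have := conv k; lra.
have grow k : k%:R * (u 1%N - u 0%N) <= u k - u 0%N.
  elim: k => [|k IH]; first by rewrite mul0r subrr.
  rewrite -addn1 natrD mulrDl mul1r addn1; have := inc k; lra.
have D0 : 0 < u 1%N - u 0%N.
  by rewrite subr_gt0 /u mul0r addr0 mul1r (_ : a + d = b) // /d; ring.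
have [M hM] := hardy_bounded _ hF.
have [k hk] : exists k : nat, M / (u 1%N - u 0%N) < k%:R.
  exists (Num.truncn `|M / (u 1%N - u 0%N)|).+1.
  by have /andP[_] := truncn_itv (normr_ge0 (M / (u 1%N - u 0%N)));
    apply: le_lt_trans; exact: ler_norm.
rewrite ltr_pdivrMr// in hk; have := grow k; have := hM _ (pos k); rewrite -/(u k).
have := L2sq_ge0 (hardy_line F (a + 0%:R * d)); rewrite -/(u 0%N); lra.
Qed.

(** Choose [y0] whose squared norm is within [e / 2] of the supremum. By monotonicity this persists
    at all lower heights, midpoints included, so [hardy_dist] is at most [2 * (e / 2)]. *)
Lemma hardy_line_cauchy F e : hardy_fun F -> 0 < e -> exists2 y0, 0 < y0 &
  forall a b, 0 < a -> a <= y0 -> 0 < b -> b <= y0 ->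
  L2sq (hardy_line F a - hardy_line F b) <= e.
Proof.
move=> hF e0; have [M hM] := hardy_bounded _ hF.
pose S := [set L2sq (hardy_line F y) | y in [set y | 0 < y]].
have supS : has_sup S.
  split; first by exists (L2sq (hardy_line F 1)), 1 => /=.
  by exists M => _ [y y0 <-]; exact: hM.
have e2 : 0 < e / 2 by rewrite divr_gt0.
have [_ [y0 /= y00 <-] hy] := sup_adherent e2 supS.
have ub y : 0 < y -> L2sq (hardy_line F y) <= sup S.
  by move=> y1; apply: ub_le_sup; [case: supS|exists y].
exists y0 => // a b a0 ay b0 by_; rewrite hardy_dist//.
have m0 : 0 < (a + b) / 2 by lra.
have my : (a + b) / 2 <= y0 by lra.
have := hardy_line_monotone F _ _ hF m0 my; have := ub a a0; have := ub b b0; lra.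
Qed.

End Hardy.

(** * Boundary values of Hardy functions *)

Section HardyBoundary.
Context {R : realType}.
Local Notation C := (R[i]).
Local Notation leb := (@lebesgue_measure R).
Variable s : R.
Hypothesis ss : s * s = 1.
Implicit Types (F K : C -> C) (f g p : R -> C).
Local Notation line := (hardy_line s).
Local Notation hardy_fun := (hardy_fun s).

(** The part of nontangential convergence retained from here on: approach along the vertical ray,
    which lies in every cone. *)
Definition vertical_limit F (x : R) (l : C) : Prop :=
  forall e, 0 < e -> exists2 del, 0 < del &
    forall y, 0 < y -> y < del -> l1norm (line F y x - l) < e.

Definition hardy_pair F f : Prop :=
  [/\ hardy_fun F, L2 f & {ae leb, forall x, vertical_limit F x (f x)}].

Lemma nontangential_vertical F x l :
  nontangential_limit s F x l -> vertical_limit F x l.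
Proof.
move=> /(_ 1 ltr01) h e e0.
have e2 : 0 < (e / 4)%:C by rewrite ltcR divr_gt0.
have FF : Filter (within (cone s x 1) (nbhs (x%:C : C^o))) by apply: within_filter.
have := (@cvgrPdist_lt C C^o C (within (cone s x 1) (nbhs (x%:C : C^o))) FF
  (F : C -> C^o) (l : C^o)).1 h _ e2.
move=> H; have {}H : nbhs (x%:C : C^o) (fun z : C^o => cone s x 1 z -> `|l - F z| < (e / 4)%:C) := H.
have [del /=] := (nbhs_ballP (x%:C : C^o) _).1 H.
rewrite ltcE => /andP[/eqP delI del0] hd.
have delE : del = (Re del)%:C by apply: complex_ext => //=; rewrite delI.
exists (Re del) => // y y0 yd.
have b : ball (x%:C : C^o) del (x +i* (s * y)).
  rewrite /ball /= delE; have -> : x%:C - x +i* (s * y) = 0 +i* (- (s * y)) :> C.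
    by apply: complex_ext; rewrite /= ?subrr ?sub0r.
  rewrite normcsq ltcR /sqnorm /= expr0n add0r sqrrN exprMn (expr2 s) ss mul1r.
  by rewrite sqrtr_sqr ger0_norm ?ltW.
have c : cone s x 1 (x +i* (s * y)).
  split; first by rewrite /halfplane /= mulrA ss mul1r.
  by rewrite /= subrr normr0 mul1r mulrA ss mul1r.
have := hd _ b c; rewrite distrC => /ltW /l1norm_le_normc; rewrite /hardy_line => h5.
apply: (le_lt_trans h5); lra.
Qed.

Lemma hardy_boundary_pair f : hardy_boundary s f -> exists F, hardy_pair F f.
Proof.
move=> [Lf [F [hF hl]]]; exists F; split => //; first exact: hardy2_fun.
by move: hl; apply: leb_aeS => x; exact: nontangential_vertical.
Qed.

Lemma sqnorm_cvg F f x a : vertical_limit F x (f x) ->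
  sqnorm (line F a x - line F n.+1%:R^-1 x) @[n --> \oo] -->
  sqnorm (line F a x - f x).
Proof.
move=> h.
have small (e : R) : 0 < e -> \forall n \near \oo, l1norm (line F n.+1%:R^-1 x - f x) < e.
  move=> e0; have [del del0 hd] := h e e0.
  have [N _ hN] := near_infty_natSinv_lt (PosNum del0).
  by exists N => // n /hN /= nd; apply: hd => //; rewrite invr_gt0.
have cR : Re (line F n.+1%:R^-1 x) @[n --> \oo] --> Re (f x).
  apply/cvgrPdist_lt => e /small; apply: filterS => n; apply: le_lt_trans.
  by rewrite distrC -ReN -ReD lerDl.
have cI : Im (line F n.+1%:R^-1 x) @[n --> \oo] --> Im (f x).
  apply/cvgrPdist_lt => e /small; apply: filterS => n; apply: le_lt_trans.
  by rewrite distrC -ImN -ImD lerDr.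
have E z w : sqnorm (z - w : C) =
    (Re z - Re w) * (Re z - Re w) + (Im z - Im w) * (Im z - Im w).
  by rewrite /sqnorm !ReImE !expr2.
rewrite E; under eq_fun do rewrite E.
by apply: cvgD; apply: cvgM; apply: cvgB => //; exact: cvg_cst.
Qed.

Lemma limn_einf_le (u : nat -> \bar R) (c : \bar R) :
  (\forall n \near \oo, (u n <= c)%E) -> (limn_einf u <= c)%E.
Proof.
move=> h; rewrite limn_einf_lim; apply: lime_le; first exact: is_cvg_einfs.
move: h; apply: filterS => n; apply: le_trans.
by apply: ereal_inf_lbound; exists n => //=.
Qed.

(** The height [a] stays fixed while the second height runs through [1/(n+1)]; Fatou then passes the
    Cauchy estimate to the boundary, uniformly in [a <= y0]. *)
Lemma hardy_boundary_cvg F f e : hardy_pair F f -> 0 < e -> exists2 y0, 0 < y0 &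
  forall a, 0 < a -> a <= y0 -> L2sq (line F a - f) <= e.
Proof.
move=> [hF Lf hl] e0; have [y0 y00 hy] := hardy_line_cauchy s ss F e hF e0.
exists y0 => // a a0 ay; have La := hardy_line_L2 s ss F a hF a0.
pose u (n : nat) x := (sqnorm (line F a x - line F n.+1%:R^-1 x))%:E.
have L2n n : L2 (line F a - line F n.+1%:R^-1).
  by apply: L2B => //; apply: hardy_line_L2 => //; rewrite invr_gt0.
have mu n : measurable_fun setT (u n).
  exact: (measurable_int _ (L2_sq_integrable _ (L2n n))).
have Ld := L2B _ _ La Lf; have di := L2_sq_integrable _ Ld.
have u0 n x : (0 <= u n x)%E by rewrite lee_fin sqnorm_ge0.
have F1 := fatou leb measurableT mu (fun n x _ => u0 n x).
rewrite -lee_fin fineK; last exact: integrable_fin_num.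
rewrite (_ : integral _ _ _ = \int[leb]_x limn_einf (u^~ x))%E; last first.
  apply: ae_eq_integral => //.
  - exact: measurable_int di.
  - rewrite (_ : (fun x => _) = (fun x => - limn_esup (fun n => - u n x))%E) //.
    apply: measurableT_comp => //; apply: measurable_fun_limn_esup => n.
    exact: (measurableT_comp (@oppe_measurable R setT) (mu n)).
  - move: hl; apply: leb_aeS => x hx _ /=; apply/esym.
    have := sqnorm_cvg _ _ _ a hx => c1.
    have c2 : u n x @[n --> \oo] --> (sqnorm (line F a x - f x))%:E.
      by apply/fine_cvgP; split; [exact: nearW | exact: c1].
    by have [-> _] := cvg_limn_einf_sup c2.
apply: (le_trans F1); apply: limn_einf_le.
have [N _ hN] := near_infty_natSinv_lt (PosNum y00).
exists N => // n /hN /= nd.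
have h1 := hy a n.+1%:R^-1 a0 ay; rewrite invr_gt0 in h1.
have {}h1 := h1 (ltr0Sn _ _) (ltW nd).
have ni := L2_sq_integrable _ (L2n n).
rewrite -(fineK (integrable_fin_num measurableT ni)) lee_fin; exact: h1.
Qed.

Lemma hardy_line_le F f a : hardy_pair F f -> 0 < a -> L2sq (line F a) <= L2sq f.
Proof.
move=> hp a0; have [hF Lf _] := hp; apply/ler_addgt0Pr => e e0.
pose t := e / (2 * (L2sq f + 1)).
have f1 : 0 < L2sq f + 1 by rewrite ltr_wpDl ?L2sq_ge0.
have t0 : 0 < t by rewrite divr_gt0 ?mulr_gt0.
have tf : t * L2sq f <= e / 2.
  apply: (@le_trans _ _ (t * (L2sq f + 1))); first by rewrite ler_pM2l// lerDl.
  by rewrite /t le_eqVlt; apply/orP; left; apply/eqP; field; rewrite gt_eqF.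
(* Expanding [|f + (F_b - f)|^2] with weight [t] on the cross term gives [|F_b - f|^2] the
   coefficient [1 + 1/t]. *)
have k0 : 0 < 1 + t^-1 by rewrite addr_gt0 ?invr_gt0.
have r0 : 0 < e / 2 / (1 + t^-1) by rewrite !divr_gt0.
have [y0 y00 hy] := hardy_boundary_cvg _ _ _ hp r0.
pose b := Num.min a y0; have b0 : 0 < b by rewrite /b lt_min a0.
have ba : b <= a by rewrite /b ge_min lexx.
have by_ : b <= y0 by rewrite /b ge_min lexx orbT.
have Lb := hardy_line_L2 s ss F b hF b0; have Ld := L2B _ _ Lb Lf.
apply: (le_trans (hardy_line_monotone s ss F b a hF b0 ba)).
have -> : line F b = f + (line F b - f) by rewrite addrC subrK.
rewrite L2sqD//; have h1 := rdot_amgm f (line F b - f) t t0 Lf Ld.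
have := hy b b0 by_; rewrite ler_pdivlMr// mulrDr mulr1 => h2; lra.
Qed.

Lemma rdot_small f g t : 0 < t -> L2 f -> L2 g ->
  `|2 * rdot f g| <= t * L2sq f + L2sq g / t.
Proof.
move=> t0 Lf Lg; rewrite ler_norml rdot_amgm// andbT.
have := rdot_amgm (- f) g t t0 (L2N _ Lf) Lg; rewrite rdotNl//.
have -> : L2sq (- f) = L2sq f.
  by apply: eq_Rintegral => x _; rewrite /sqnorm !fctE !ReImE !sqrrN.
lra.
Qed.

(** The weight [t] is fixed first, making [t * c] small; then [e] is taken small relative to [t]. *)
Lemma eq_near_zero (x y c k : R) : 0 <= c -> 0 <= k ->
  (forall t e, 0 < t -> 0 < e -> `|x - y| <= t * c + k * (e / t)) -> x = y.
Proof.
move=> c0 k0 h; apply/eqP; rewrite -subr_eq0 -normr_le0; apply/ler_addgt0Pr => e e0.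
have c1 : 0 < c + 1 by rewrite ltr_wpDl.
have k1 : 0 < k + 1 by rewrite ltr_wpDl.
pose t := e / 2 / (c + 1); have t0 : 0 < t by rewrite !divr_gt0.
pose r := t * (e / 2) / (k + 1); have r0 : 0 < r.
  by apply: divr_gt0 => //; apply: mulr_gt0 => //; exact: divr_gt0.
have := h t r t0 r0.
have h1 : t * c <= e / 2.
  by rewrite /t mulrAC ler_pdivrMr// ler_pM2l ?divr_gt0// lerDl.
have h2 : k * (r / t) <= e / 2.
  have -> : r / t = e / 2 / (k + 1) by rewrite /r; field; rewrite !gt_eqF.
  by rewrite mulrA ler_pdivrMr//; lra.
lra.
Qed.

(** Limit of the identity [<F_e, K_b> = <F_b, K_e>] of [hardy_shift] as [b] tends to 0, where [K_b]
    tends to [g] and [F_b] to [f]. *)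
Lemma hardy_duality F f K g e : hardy_pair F f -> hardy_pair K g -> 0 < e ->
  rdot (line F e) g = rdot f (line K e).
Proof.
move=> hF hK e0; have [hF' Lf _] := hF; have [hK' Lg _] := hK.
have LFe := hardy_line_L2 s ss F e hF' e0; have LKe := hardy_line_L2 s ss K e hK' e0.
apply: (@eq_near_zero _ _ (L2sq (line F e) + L2sq (line K e)) 2).
- by rewrite addr_ge0 ?L2sq_ge0.
- by [].
move=> t r t0 r0.
have [y1 y10 h1] := hardy_boundary_cvg _ _ _ hF r0.
have [y2 y20 h2] := hardy_boundary_cvg _ _ _ hK r0.
pose b := Num.min y1 y2; have b0 : 0 < b by rewrite /b lt_min y10.
have b1 : b <= y1 by rewrite /b ge_min lexx.
have b2 : b <= y2 by rewrite /b ge_min lexx orbT.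
have LFb := hardy_line_L2 s ss F b hF' b0; have LKb := hardy_line_L2 s ss K b hK' b0.
have {h1} := h1 b b0 b1; have {h2} := h2 b b0 b2.
have LdF := L2B _ _ LFb Lf; have LdK := L2B _ _ LKb Lg.
have S := hardy_shift s ss F K e b b e hF' hK' e0 b0 b0 e0 (addrC _ _).
have e1 : rdot (line F e) g = rdot (line F e) (line K b) - rdot (line F e) (line K b - g).
  by rewrite (rdotC (line K b - g))// rdotBl// (rdotC (line F e)) // (rdotC (line F e) g)//; ring.
have e2 : rdot f (line K e) = rdot (line F b) (line K e) - rdot (line F b - f) (line K e).
  by rewrite rdotBl//; ring.
have s1 := rdot_small (line F e) (line K b - g) t t0 LFe LdK.
have s2 := rdot_small (line K e) (line F b - f) t t0 LKe LdF.
rewrite -(rdotC (line K e))// in s2 => h2 h1.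
have q1 : L2sq (line K b - g) / t <= r / t by rewrite ler_pM2r ?invr_gt0.
have q2 : L2sq (line F b - f) / t <= r / t by rewrite ler_pM2r ?invr_gt0.
rewrite e1 e2 S mulrDr; move: s1 s2 q1 q2.
set A := rdot _ (_ - g); set B := rdot (_ - f) _.
set c1 := t * L2sq (line F e); set c2 := t * L2sq (line K e).
have c10 : 0 <= c1 by rewrite mulr_ge0 ?L2sq_ge0 ?ltW.
have c20 : 0 <= c2 by rewrite mulr_ge0 ?L2sq_ge0 ?ltW.
have rt : 0 <= r / t by rewrite divr_ge0 ?ltW.
rewrite !ler_norml => /andP[? ?] /andP[? ?] ? ?; apply/andP; split; lra.
Qed.

End HardyBoundary.

(** * Decay of the Toeplitz semigroup *)

Section ToeplitzDecay.
Context {R : realType}.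
Local Notation C := (R[i]).
Variable s : R.
Hypothesis ss : s * s = 1.
Implicit Types (F P : C -> C) (f g p : R -> C).
Local Notation line := (hardy_line s).
Local Notation hardy_fun := (hardy_fun s).
Local Notation hardy_pair := (hardy_pair s).

Lemma sqnorm_expi (th : R) : sqnorm (expi th) = 1.
Proof. by rewrite /sqnorm /= cos2Dsin2. Qed.

Lemma L2_umul t f : L2 f -> L2 (umul t f).
Proof.
move=> [[mr mi] ff]; split.
  have mth : measurable_fun setT (fun x : R => - (x * t)).
    by apply: measurableT_comp => //; exact: measurable_funM.
  have mc : measurable_fun setT (fun x : R => cos (- (x * t))).
    exact: measurableT_comp (continuous_measurable_fun (@continuous_cos R)) mth.
  have ms : measurable_fun setT (fun x : R => sin (- (x * t))).
    exact: measurableT_comp (continuous_measurable_fun (@continuous_sin R)) mth.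
  split.
    rewrite (_ : (fun x => _) = (fun x : R => cos (- (x * t)) * Re (f x) - sin (- (x * t)) * Im (f x))).
      by apply: measurable_funB; exact: measurable_funM.
    by apply/funext => x; rewrite /umul ReM.
  rewrite (_ : (fun x => _) = (fun x : R => cos (- (x * t)) * Im (f x) + sin (- (x * t)) * Re (f x))).
    by apply: measurable_funD; exact: measurable_funM.
  by apply/funext => x; rewrite /umul ImM.
by under eq_integral do rewrite /umul sqnormM sqnorm_expi mul1r.
Qed.

Lemma L2sq_umul t f : L2sq (umul t f) = L2sq f.
Proof. by apply: eq_Rintegral => x _; rewrite /umul sqnormM sqnorm_expi mul1r. Qed.

Lemma expiN (th : R) : expi (- th) = conjc (expi th).
Proof. by rewrite /expi cosN sinN. Qed.

Lemma rdot_umul t f g : rdot (umul t f) g = rdot f (umul (- t) g).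
Proof.
rewrite /rdot /L2dot /cintegral /=; apply: eq_Rintegral => x _; congr Re.
by rewrite /umul mulrN opprK rmorphM /= expiN mulrCA mulrA.
Qed.

Lemma line_cexpi t P y x :
  line (fun z => cexpi t z * P z) y x =
  (expR (- (s * t) * y))%:C * (expi (t * x) * line P y x).
Proof.
rewrite /hardy_line /cexpi /= mulrA; congr ((expR _)%:C * _ * _); ring.
Qed.

Lemma sqnorm_line_cexpi t P y x :
  sqnorm (line (fun z => cexpi t z * P z) y x) =
  expR (- (s * t) * y) ^+ 2 * sqnorm (line P y x).
Proof.
by rewrite line_cexpi !sqnormM sqnorm_expi mul1r /sqnorm /= expr0n addr0.
Qed.

(** For [s * t >= 0] the factor [e^{i t z}] has modulus at most 1 on the half-plane, so the bound
    [M] of [P] still serves. *)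
Lemma hardy_fun_cexpi t P : 0 <= s * t -> hardy_fun P ->
  hardy_fun (fun z => cexpi t z * P z).
Proof.
move=> st [dP [M hM]].
have dQ z : halfplane s z -> cdiff (fun z => cexpi t z * P z) z.
  by move=> hz; apply: cdiffM; [exact: cdiff_cexpi|exact: dP].
split => //; exists M => y y0; apply: le_trans (hM y y0).
have LP := L2_sq_integrable _ (hardy_line_L2 s ss P y (conj dP (ex_intro _ M hM)) y0).
apply: ge0_le_integral => //.
- by move=> x _; rewrite lee_fin sqnorm_ge0.
- apply/measurable_EFinP; apply: (measurable_sqnorm (line (fun z => cexpi t z * P z) y)).
  split; apply: continuous_measurable_fun => x.
    exact: (cdiff_continuous_line _ _ _ (dQ _ (halfplane_line s ss x y y0))).1.
  exact: (cdiff_continuous_line _ _ _ (dQ _ (halfplane_line s ss x y y0))).2.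
- exact: measurable_int LP.
move=> x _; rewrite lee_fin -/(line (fun z => cexpi t z * P z) y x) sqnorm_line_cexpi.
rewrite -[leRHS]mul1r ler_wpM2r ?sqnorm_ge0// expr_le1 ?expR_ge0//.
by rewrite -expR0 ler_expR mulNr oppr_le0 mulr_ge0// ltW.
Qed.

Lemma l1norm_expi (th : R) : l1norm (expi th) <= 2.
Proof. by rewrite /l1norm /=; have := cos_max th; have := sin_max th; lra. Qed.

Lemma vertical_limit_cexpi t P x (l : C) : 0 <= s * t ->
  vertical_limit s P x l ->
  vertical_limit s (fun z => cexpi t z * P z) x (expi (t * x) * l).
Proof.
move=> st h e e0.
have e8 : 0 < Num.min 1 (e / 8) by rewrite lt_min ltr01 divr_gt0.
have [d1 d10 h1] := h _ e8.
(* The factor 4 leaves [e / 4] for the damping error and [e / 8] remains for [w - l]; both are at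
   most doubled by the factor [expi (t * x)]. *)
pose B := 4 * (s * t + 1) * (l1norm l + 1).
have l1 : 0 < l1norm l + 1 by rewrite ltr_wpDl ?l1norm_ge0.
have st1 : 0 < s * t + 1 by rewrite ltr_wpDl.
have B0 : 0 < B by rewrite !mulr_gt0.
exists (Num.min d1 (e / B)); first by rewrite lt_min d10 divr_gt0.
move=> y y0; rewrite lt_min ltr_pdivlMr// => /andP[y1 yB].
have := h1 y y0 y1; rewrite lt_min => /andP[k1 k2].
rewrite line_cexpi; set E := expR _; set w := line P y x in k1 k2 *.
have -> : E%:C * (expi (t * x) * w) - expi (t * x) * l =
    expi (t * x) * ((E - 1)%:C * w + (w - l)).
  by rewrite rmorphB /=; ring.
have stu : 0 <= s * t * y by rewrite mulr_ge0// ltW.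
have E1 : `|E - 1| <= (s * t + 1) * y.
  have g1 : E <= 1 by rewrite -expR0 ler_expR mulNr oppr_le0.
  have g2 := expR_ge1Dx (- (s * t) * y); rewrite -/E in g2.
  by rewrite ler_norml; apply/andP; split; lra.
have wl : l1norm w <= l1norm l + 1.
  by have := l1normD (w - l) l; rewrite subrK; lra.
apply: (le_lt_trans (l1normM _ _)).
have t1 : l1norm ((E - 1)%:C * w) <= (s * t + 1) * y * (l1norm l + 1).
  apply: (le_trans (l1normM _ _)); rewrite {1}/l1norm /= normr0 addr0.
  by rewrite ler_pM ?l1norm_ge0.
have t2 := l1normD ((E - 1)%:C * w) (w - l).
have t3 : (s * t + 1) * y * (l1norm l + 1) < e / 4.
  have -> : (s * t + 1) * y * (l1norm l + 1) = (y * B) / 4 by rewrite /B; field.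
  by rewrite ltr_pM2r// invr_gt0.
have := ler_wpM2r (l1norm_ge0 ((E - 1)%:C * w + (w - l))) (l1norm_expi (t * x)).
lra.
Qed.

Lemma hardy_pair_cexpi t P p : 0 <= s * t -> hardy_pair P p ->
  hardy_pair (fun z => cexpi t z * P z) (umul (- t) p).
Proof.
move=> st [hP Lp hl]; split; [exact: hardy_fun_cexpi|exact: L2_umul|].
move: hl; apply: leb_aeS => x /(vertical_limit_cexpi t P x _ st).
by rewrite /umul mulrN opprK (mulrC x t).
Qed.

Lemma L2sq_line_cexpi t P y : hardy_fun P -> 0 < y ->
  L2sq (line (fun z => cexpi t z * P z) y) =
  expR (- (s * t) * y) ^+ 2 * L2sq (line P y).
Proof.
move=> hP y0; rewrite /L2sq -RintegralZl//.
  by apply: eq_Rintegral => x _; rewrite sqnorm_line_cexpi.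
exact: L2_sq_integrable _ (hardy_line_L2 s ss P y hP y0).
Qed.

(* With [q = e^{i t .} p] one has |p|^2 = <f, q>, and <f_e, q> = <f, q_e> where
   the line [q_e] at height [e] has norm at most [e^{- t e} |p|]. *)
Lemma toeplitz_decay f (p : R -> R -> C) : hardy_boundary s f ->
  (forall t, 0 <= s * t -> toeplitz (hardy_boundary s) t f (p t)) ->
  forall e, 0 < e -> exists2 tau, 0 < tau & forall t, tau < s * t -> L2sq (p t) < e.
Proof.
move=> Hf hp e e0; have [F hF] := hardy_boundary_pair s ss f Hf.
have [hF' Lf _] := hF.
have main t eps eta : 0 <= s * t -> 0 < eps -> 0 < eta ->
    2 * L2sq (p t) <= (2 * eta + expR (- (s * t) * eps) ^+ 2 / eta) * L2sq f
      + L2sq (line F eps - f) / eta.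
  move=> st eps0 eta0; have [Hp proj] := hp t st.
  have [P hP] := hardy_boundary_pair s ss _ Hp; have [hP' Lp _] := hP.
  have Lu := L2_umul t _ Lf.
  have ortho : rdot (umul t f) (p t) = L2sq (p t).
    have := congr1 (@complex.Re R) (proj _ Hp); rewrite -/(rdot _ _) rdotBl// rdotff /=.
    by move=> h; lra.
  have contr : L2sq (p t) <= L2sq f.
    have := rdot_amgm _ _ 1 ltr01 Lu Lp; rewrite ortho L2sq_umul mul1r divr1; lra.
  set Q := fun z => cexpi t z * P z; set q := umul (- t) (p t).
  have hQ : hardy_pair Q q by exact: hardy_pair_cexpi.
  have [hQ' Lq _] := hQ.
  have dual := hardy_duality s ss F f Q q eps hF hQ eps0.
  have LF := hardy_line_L2 s ss F eps hF' eps0; have LQ := hardy_line_L2 s ss Q eps hQ' eps0.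
  have Ld := L2B _ _ LF Lf.
  have eq1 : L2sq (p t) = rdot f (line Q eps) - rdot (line F eps - f) q.
    by rewrite rdotBl// dual -ortho rdot_umul; ring.
  have b1 := rdot_amgm _ _ eta eta0 Lf LQ.
  have b2 := rdot_amgm (- q) _ eta eta0 (L2N _ Lq) Ld.
  rewrite rdotNl// (rdotC (line F eps - f))// in b2.
  have qn : L2sq (- q) = L2sq (p t).
    rewrite -(L2sq_umul (- t) (p t)); apply: eq_Rintegral => x _.
    by rewrite /sqnorm !fctE !ReImE !sqrrN.
  have Qn : L2sq (line Q eps) <= expR (- (s * t) * eps) ^+ 2 * L2sq f.
    rewrite L2sq_line_cexpi// ler_wpM2l ?sqr_ge0//.
    by apply: (le_trans (hardy_line_le s ss P (p t) eps hP eps0)).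
  rewrite qn in b2.
  have Qn' : L2sq (line Q eps) / eta <= expR (- (s * t) * eps) ^+ 2 / eta * L2sq f.
    by rewrite mulrAC ler_pM2r ?invr_gt0.
  have c1 := ler_wpM2l (ltW eta0) contr.
  rewrite eq1 mulrDl; lra.
have f1 : 0 < L2sq f + 1 by rewrite ltr_wpDl ?L2sq_ge0.
(* The choices are successive: [eta] brings [2 * eta * |f|^2] below [e / 2], then [eps] brings the
   boundary error below [e / 4], then [tau] brings the exponential term below [e / 4]. The total
   bounds [2 |p|^2]. *)
pose eta := e / 4 / (L2sq f + 1); have eta0 : 0 < eta by apply: divr_gt0 => //; exact: divr_gt0.
have r0 : 0 < e / 4 * eta by rewrite mulr_gt0// divr_gt0.
have [eps eps0 heps] := hardy_boundary_cvg s ss _ _ _ hF r0.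
have k0 : 0 < e * eta / (4 * (L2sq f + 1)).
  by apply: divr_gt0; apply: mulr_gt0.
(* By [1 + x <= e^x], the factor [e^{-x}] with [x = s t eps] is below the target once [x] exceeds
   the inverse of the target; its square is smaller still, as it is at most 1. *)
pose tau := (e * eta / (4 * (L2sq f + 1)))^-1 / eps.
have tau0 : 0 < tau by apply: divr_gt0 => //; rewrite invr_gt0.
exists tau => // t tt.
have st : 0 <= s * t by rewrite ltW// (lt_trans tau0).
have := main t eps eta st eps0 eta0.
have h1 : L2sq (line F eps - f) / eta <= e / 4.
  by rewrite ler_pdivrMr// heps.
have h2 : 2 * eta * L2sq f <= e / 2.
  have -> : e / 2 = 2 * eta * (L2sq f + 1) by rewrite /eta; field; rewrite gt_eqF.
  have e20 : 0 < 2 * eta by exact: mulr_gt0.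
  by rewrite (ler_pM2l e20) lerDl.
have h3 : expR (- (s * t) * eps) ^+ 2 / eta * L2sq f <= e / 4.
  set E := expR _; have E0 : 0 <= E by exact: expR_ge0.
  have E1 : E <= e * eta / (4 * (L2sq f + 1)).
    have : 1 + s * t * eps <= expR (s * t * eps) by exact: expR_ge1Dx.
    rewrite /E mulNr expRN => h.
    have h4 : (e * eta / (4 * (L2sq f + 1)))^-1 < s * t * eps.
      by rewrite -ltr_pdivrMr.
    have h5 : 0 < (e * eta / (4 * (L2sq f + 1)))^-1 by rewrite invr_gt0.
    rewrite -[leRHS]invrK lef_pV2 ?posrE ?expR_gt0//; lra.
  have E2 : E <= 1.
    by rewrite /E -expR0 ler_expR mulNr oppr_le0 mulr_ge0// ltW.
  have E3 : E ^+ 2 <= e * eta / (4 * (L2sq f + 1)).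
    by rewrite expr2; apply: le_trans (ler_wpM2l E0 E2) _; rewrite mulr1.
  have -> : e / 4 = e * eta / (4 * (L2sq f + 1)) / eta * (L2sq f + 1).
    by field; rewrite !gt_eqF.
  have i0 : 0 < eta^-1 by rewrite invr_gt0.
  apply: ler_pM.
  - by apply: divr_ge0; [exact: sqr_ge0|exact: ltW].
  - exact: L2sq_ge0.
  - by rewrite (ler_pM2r i0).
  - by rewrite lerDl.
rewrite mulrDl; lra.
Qed.

End ToeplitzDecay.

(** * The operators of the theorem *)

Section GramOperator.
Context {R : realType} {V : completeNormedModType R[i]}.
Variable dot : {dot V for @conjc R}.
Hypothesis hn : hilbert_norm dot.
Local Notation C := (R[i]).
Local Notation nrm2 := (sqnrm dot).
Variables (M : set (R -> C)) (Om : V -> R -> C).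
Hypothesis M_L2 : M `<=` @L2 R.
Hypothesis Om_contractive : contractive Om.
Hypothesis Om_quasi_affine : quasi_affine M Om.

Let Om_in x : M (Om x). Proof. by case: Om_quasi_affine. Qed.
Let Om_L2 x : L2 (Om x). Proof. exact: M_L2. Qed.

Lemma contractive_L2sq x : L2sq (Om x) <= nrm2 x.
Proof.
have := Om_contractive x; rewrite (normE dot hn) lecR L2normE => h.
by rewrite -(sqr_sqrtr (L2sq_ge0 (Om x))) -(sqr_sqrtr (nrm2_ge0 dot x)) ler_pXn2r// nnegrE sqrtr_ge0.
Qed.

(** [Om] is linear only up to null sets, so linearity of the form passes through [L2dot_aeql]. *)
Lemma form_linear y : linear_for *%R (fun x => L2dot (Om x) (Om y)).
Proof.
move=> a x z; have [_ lin _ _ _] := Om_quasi_affine.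
have Lc := L2_comb a _ _ (Om_L2 x) (Om_L2 z).
rewrite -L2dot_comb//; apply: L2dot_aeql; last exact: lin.
- by case: (Om_L2 (a *: x + z)).
- by case: Lc.
- by case: (Om_L2 y).
Qed.

Lemma dot_inj (u v : V) : (forall x, dot x u = dot x v) -> u = v.
Proof.
move=> h; apply/eqP; rewrite -subr_eq0; apply/eqP; apply: (re_dot_eq0 dot) => x.
by rewrite dotDr dotNr h subrr.
Qed.

Lemma gram_operator_exists : exists A : V -> V,
  forall x y, dot x (A y) = L2dot (Om x) (Om y).
Proof.
suff /choice[A hA] : forall y, exists z, forall x, dot x z = L2dot (Om x) (Om y).
  by exists A => x y; exact: hA.
move=> y; apply: (riesz dot hn _ (L2sq (Om y)) (form_linear y) (L2sq_ge0 _)) => x.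
apply: (le_trans (L2_CS _ _ (Om_L2 x) (Om_L2 y))).
by rewrite mulrC ler_wpM2l ?L2sq_ge0 ?contractive_L2sq.
Qed.

Variable A : V -> V.
Hypothesis hA : forall x y, dot x (A y) = L2dot (Om x) (Om y).

Lemma gram_sym x y : dot (A x) y = dot x (A y).
Proof. by rewrite (dotJ dot y (A x)) !hA -L2dotJ. Qed.

Lemma gram_linear : linear A.
Proof.
move=> a y z; apply: dot_inj => x.
rewrite dotDr dotZr !hA (L2dotJ (Om (a *: y + z)))//.
have -> : L2dot (Om (a *: y + z)) (Om x) = a * L2dot (Om y) (Om x) + L2dot (Om z) (Om x).
  exact: form_linear.
by rewrite rmorphD rmorphM /= (L2dotJ (Om y) (Om x))// (L2dotJ (Om z) (Om x)).
Qed.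

Lemma gram_diag x : Re (dot (A x) x) = L2sq (Om x).
Proof. by rewrite ReJdot hA -rdotff. Qed.

Lemma gram_le x : Re (dot (A x) x) <= nrm2 x.
Proof. by rewrite gram_diag contractive_L2sq. Qed.

(** [|A x|^2 = <Om (A x), Om x>], which is at most [|A x| |Om x|] by Cauchy-Schwarz and
    contractivity; a factor [|A x|] cancels. *)
Lemma gram_contr x : nrm2 (A x) <= Re (dot (A x) x).
Proof.
have [->|n0] := eqVneq (nrm2 (A x)) 0; first by rewrite gram_diag L2sq_ge0.
have n1 : 0 < nrm2 (A x) by rewrite lt_neqAle eq_sym n0 nrm2_ge0.
rewrite gram_diag -(ler_pM2l n1) -expr2.
rewrite [X in X ^+ 2 <= _](_ : _ = rdot (Om (A x)) (Om x)); last first.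
  by rewrite /sqnrm hA.
apply: (le_trans (L2_CS _ _ (Om_L2 _) (Om_L2 _))).
by rewrite ler_wpM2r ?L2sq_ge0 ?contractive_L2sq.
Qed.

(** Both [Om x] and [Om 0] vanish almost everywhere, the latter by contractivity, and injectivity of
    [Om] compares exactly such classes. *)
Lemma gram_pos x : Re (dot (A x) x) = 0 -> x = 0.
Proof.
rewrite gram_diag => h; have [_ _ inj _ _] := Om_quasi_affine.
have h0 : L2sq (Om 0) = 0.
  by apply/le_anti; rewrite L2sq_ge0 andbT -(nrm2_0 dot) contractive_L2sq.
apply: inj; move: (L2sq_eq0 _ (Om_L2 x) h) (L2sq_eq0 _ (Om_L2 0) h0).
by apply: leb_aeS2 => s -> ->.
Qed.

Lemma inverse_gramE : inverse_gram dot M Om = [set p | p.1 = A p.2].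
Proof.
apply/seteqP; split => -[y x] /=.
  by move=> [_ /= h]; apply: dot_inj => z; rewrite h hA.
by move=> ->; split => //= z; rewrite hA.
Qed.

Lemma op_norm1_approx : op_norm Om = 1 ->
  forall e, 0 < e -> exists x, nrm2 x <= 1 /\ 1 - e < Re (dot (A x) x).
Proof.
move=> h1 e e0; set S := [set L2norm (Om x) | x in [set x | `|x| <= 1]].
have unit_nrm2 x : `|x : V| <= 1 -> nrm2 x <= 1.
  rewrite (normE dot hn) -[1 : C]/((1 : R)%:C) lecR => h.
  by rewrite -(sqr_sqrtr (nrm2_ge0 dot x)) expr_le1// sqrtr_ge0.
have supS : has_sup S.
  split; first by exists (L2norm (Om 0)), 0 => //=; rewrite normr0.
  exists 1 => _ [x /unit_nrm2 x1 <-]; rewrite L2normE -[leRHS]sqrtr1 ler_wsqrtr//.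
  exact: le_trans (contractive_L2sq x) x1.
(* Squaring [1 - r < |Om x|] yields more than [1 - 2 r >= 1 - e]; the cap at 1 keeps [1 - r]
   nonnegative. *)
pose r := Num.min (e / 2) 1.
have r0 : 0 < r by rewrite /r lt_min ltr01 divr_gt0.
have r1 : r <= 1 by rewrite /r ge_min lexx orbT.
have re : r <= e / 2 by rewrite /r ge_min lexx.
have [_ [x /= /unit_nrm2 x1 <-]] := sup_adherent r0 supS.
rewrite -/(op_norm Om) h1 => hx; exists x; split => //; rewrite gram_diag.
rewrite L2normE in hx; have s0 := sqrtr_ge0 (L2sq (Om x)).
have : (1 - r) ^+ 2 < L2sq (Om x).
  by rewrite -(sqr_sqrtr (L2sq_ge0 (Om x))) ltr_pXn2r// nnegrE subr_ge0.
by have := sqr_ge0 r; nra.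
Qed.

End GramOperator.

(** * Bottom of the spectrum and escape from spectral windows *)

Section Departure.
Context {R : realType} {V : completeNormedModType R[i]}.
Variable dot : {dot V for @conjc R}.
Hypothesis hn : hilbert_norm dot.
Local Notation C := (R[i]).
Local Notation nrm2 := (sqnrm dot).
Variable s : R.
Hypothesis ss : s * s = 1.
Variable Om : V -> R -> C.
Hypothesis Om_contractive : contractive Om.
Hypothesis Om_quasi_affine : quasi_affine (hardy_boundary s) Om.
Local Notation T := (inverse_gram dot (hardy_boundary s) Om).

Lemma hardy_boundary_L2 : hardy_boundary s `<=` @L2 R.
Proof. by move=> f []. Qed.

(** The normalisation matters: half of [Om] is again a contractive quasi-affine map with the same
    intertwining property, but the operator [T] is multiplied by 4. *)
Lemma inf_spectrum_inverse_gram : op_norm Om = 1 ->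
  inf [set Re z | z in spectrum T] = 1.
Proof.
move=> h1; have ML := hardy_boundary_L2.
have [A hA] := gram_operator_exists dot hn _ Om ML Om_contractive Om_quasi_affine.
rewrite (inverse_gramE dot _ Om Om_quasi_affine A hA).
apply: (inf_spectrum_inverse dot hn).
- exact: (gram_linear dot _ Om ML Om_quasi_affine A hA).
- exact: (gram_sym dot _ Om ML Om_quasi_affine A hA).
- exact: (gram_contr dot hn _ Om ML Om_contractive Om_quasi_affine A hA).
- exact: (gram_le dot hn Om Om_contractive A hA).
- exact: (op_norm1_approx dot hn Om Om_contractive A hA h1).
Qed.

Variables (E : pvm dot) (U : R -> V -> V).
Hypothesis U_group : unitary_group_of E U.
Hypothesis U_intertwines : forall t g, 0 <= s * t ->
  toeplitz (hardy_boundary s) t (Om g) (Om (U t g)).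

(** The window part decays by [pvm_window_bound] and [toeplitz_decay]. As [|U(t) g|^2 >= |g|^2 / 16]
    and the two windows exhaust the space, the part in [[a, oo)] is nonzero once the other is below
    [|g|^2 / 16]. *)
Lemma spectral_departure (xi : pvm dot) (a : R) (g : V) :
  spectral_measure_of xi T -> 1 < a -> g != 0 ->
  (exists2 tau : R, 0 < tau & forall t, tau < s * t ->
     xi `[a, +oo[%classic (U t g) != 0) /\
  (forall e : R, 0 < e -> exists2 tau : R, 0 < tau & forall t, tau < s * t ->
     nrm2 (xi `[1%R, a[%classic (U t g)) < e).
Proof.
move=> hxi a1 g0; have ML := hardy_boundary_L2.
have [A hA] := gram_operator_exists dot hn _ Om ML Om_contractive Om_quasi_affine.
rewrite (inverse_gramE dot _ Om Om_quasi_affine A hA) in hxi.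
have Ac := gram_contr dot hn _ Om ML Om_contractive Om_quasi_affine A hA.
have Ap := gram_pos dot hn _ Om ML Om_contractive Om_quasi_affine A hA.
have decay (e : R) : 0 < e -> exists2 tau : R, 0 < tau & forall t, tau < s * t ->
     nrm2 (xi `[1%R, a[%classic (U t g)) < e.
  move=> e0; have ea : 0 < e / a by rewrite divr_gt0//; lra.
  have Mg : hardy_boundary s (Om g) by case: Om_quasi_affine.
  have [tau tau0 ht] := toeplitz_decay s ss (Om g) (fun t => Om (U t g)) Mg
    (fun t => U_intertwines t g) _ ea.
  exists tau => // t /ht h; apply: (le_lt_trans (pvm_window_bound xi A Ac Ap hxi a (U t g) a1)).
  rewrite (gram_diag dot Om A hA) mulrC -ltr_pdivlMr//; lra.
split=> //.
have ng : 0 < nrm2 g.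
  by rewrite lt_neqAle nrm2_ge0 andbT eq_sym; apply: contra g0 => /eqP/nrm2_eq0 ->.
have [tau tau0 ht] := decay (nrm2 g / 16) (divr_gt0 ng (ltr0n _ 16)).
exists tau => // t /ht h; apply/eqP => z.
have mth : measurable_fun setT (fun l : R => - (l * t)).
  by apply: measurableT_comp => //; exact: measurable_funM.
have low := pvm_unitary_lower E (fun l => - (l * t)) g (U t g) mth (U_group t g).
set w := U t g in h z low.
have m1 : measurable `[(1 : R), a[%classic by exact: measurable_itv.
have m2 : measurable `[a, +oo[%classic by exact: measurable_itv.
have : nrm2 w <= nrm2 (xi `[1%R, a[%classic w) + nrm2 (xi `[a, +oo[%classic w).
  rewrite -[in leLHS](pvm_support_ge1 xi A Ac Ap hxi w).
  rewrite (_ : `[1%R, +oo[%classic = `[1%R, a[%classic `|` `[a, +oo[%classic).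
    exact: pvm_subadditive.
  apply/seteqP; split => l /=; rewrite !in_itv /= ?andbT.
    by move=> l1; case: (ltP l a) => la; [left; rewrite l1|right].
  by case=> [/andP[]//|]; lra.
rewrite z nrm2_0; lra.
Qed.

End Departure.

(** The tolerance ranges over positive elements of [R[i]]; these are real, which brings the claim
    back to squared norms. *)
Lemma cvg_norm_of_nrm2 (R : realType) (V : completeNormedModType R[i])
    (dot : {dot V for @conjc R}) (hn : hilbert_norm dot) (F : set_system R)
    (FF : Filter F) (w : R -> V) :
  (forall e : R, 0 < e -> \forall t \near F, sqnrm dot (w t) < e) ->
  `|w t| @[t --> F] --> (0 : R[i]^o).
Proof.
move=> h.
apply/(@cvgrPdist_lt R[i] R[i]^o R F FF (fun t => `|w t|) 0) => e e0.
have [e1 r0] : e = (Re e)%:C /\ 0 < Re e.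
  move: e0; rewrite ltcE => /andP[/eqP i r]; split => //.
  by apply: complex_ext => //=; rewrite i.
apply: filterS (h (Re e ^+ 2) (exprn_gt0 2 r0)) => t ht.
rewrite sub0r normrN normr_id (normE dot hn) e1 ltcR.
by rewrite -[ltRHS]ger0_norm ?(ltW r0)// -sqrtr_sqr ltr_sqrt// exprn_gt0.
Qed.

Theorem theorem2 (R : realType) (V : completeNormedModType R[i])
  (dot : {dot V for @conjc R})
  (V_hilbert : hilbert_norm dot) (V_separable : separable V)
  (H : set (V * V)) (H_self_adjoint : self_adjoint dot H)
  (E : pvm dot) (E_spec : spectral_measure_of E H)
  (H_spectrum : spectrum H = [set x%:C | x in `[0, +oo[])
  (H_ac_spectrum : ac_spectrum E H = [set x%:C | x in `[0, +oo[])
  (H_ess_supp : ac_ess_support E `[0, +oo[)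
  (H_multiplicity_one : multiplicity_one E)
  (U : R -> V -> V) (U_group : unitary_group_of E U)
  (Of Ob : V -> R -> R[i])
  (Of_contractive : contractive Of) (Of_quasi_affine : quasi_affine Hplus Of)
  (Of_intertwines : forall (t : R) g, 0 <= t -> toeplitz Hplus t (Of g) (Of (U t g)))
  (Ob_contractive : contractive Ob) (Ob_quasi_affine : quasi_affine Hminus Ob)
  (Ob_intertwines : forall (t : R) g, t <= 0 -> toeplitz Hminus t (Ob g) (Ob (U t g))) :
  let TF := inverse_gram dot Hplus Of in
  let TB := inverse_gram dot Hminus Ob in
  [/\ (op_norm Of = 1 -> inf [set complex.Re z | z in spectrum TF] = 1) /\
      (op_norm Ob = 1 -> inf [set complex.Re z | z in spectrum TB] = 1),
      forall (xi : pvm dot), spectral_measure_of xi TF ->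
        forall (a : R), 1 < a ->
        forall g : V, g != 0 -> xi `[1, a[%classic g = g ->
          (exists2 tau : R, 0 < tau &
             forall t : R, tau < t -> xi `[a, +oo[%classic (U t g) != 0) /\
          `|xi `[1, a[%classic (U t g)| @[t --> +oo] --> (0 : R[i]^o) &
      forall (zeta : pvm dot), spectral_measure_of zeta TB ->
        forall (a : R), 1 < a ->
        forall g : V, g != 0 -> zeta `[1, a[%classic g = g ->
          (exists2 tau' : R, tau' < 0 &
             forall t : R, t < tau' -> zeta `[a, +oo[%classic (U t g) != 0) /\
          `|zeta `[1, a[%classic (U t g)| @[t --> -oo] --> (0 : R[i]^o)].
Proof.
move=> TF TB; have s1 : (1 : R) * 1 = 1 by rewrite mulr1.
have sN1 : (-1 : R) * -1 = 1 by rewrite mulrNN mulr1.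
split; first by split; exact: inf_spectrum_inverse_gram.
- move=> xi hxi a a1 g g0 _.
  have It t h : 0 <= 1 * t -> toeplitz (hardy_boundary 1) t (Of h) (Of (U t h)).
    by rewrite mul1r; exact: Of_intertwines.
  have [[tau tau0 h1] h2] := spectral_departure dot V_hilbert 1 s1 Of Of_contractive
    Of_quasi_affine E U U_group It xi a g hxi a1 g0.
  split; first by exists tau => // t tt; apply: h1; rewrite mul1r.
  apply: (cvg_norm_of_nrm2 _ _ dot V_hilbert) => e /h2[tau' _ h3].
  by exists tau'; split; [exact: num_real | move=> t tt; apply: h3; rewrite mul1r].
- move=> xi hxi a a1 g g0 _.
  have It t h : 0 <= -1 * t -> toeplitz (hardy_boundary (-1)) t (Ob h) (Ob (U t h)).
    by rewrite mulN1r oppr_ge0; exact: Ob_intertwines.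
  have [[tau tau0 h1] h2] := spectral_departure dot V_hilbert (-1) sN1 Ob Ob_contractive
    Ob_quasi_affine E U U_group It xi a g hxi a1 g0.
  split; first by exists (- tau); [rewrite oppr_lt0 | move=> t tt; apply: h1; lra].
  apply: (cvg_norm_of_nrm2 _ _ dot V_hilbert) => e /h2[tau' _ h3].
  by exists (- tau'); split; [exact: num_real | move=> t tt; apply: h3; lra].
Qed.
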